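(* Let $[K]=\{K_s:s\in\mathbb Z\}$ be a family of functions $K_s:\mathbb R^d\times\mathbb R^d\to\mathbb C$ with $$\mathrm{supp}\,K_s\subset\{(x,y):|x-y|<2^s\},\qquad \|[K]\|:=\sup_{s\in\mathbb Z}2^{sd}\sup_{x\in\mathbb R^d}\big(\|K_s(x,\cdot)\|_\infty+\|K_s(\cdot,x)\|_\infty\big)<\infty,$$ and such that for some $1<r<\infty$ $$\|[K]\|_{r,\star}:=\|T_\star[K]\|_{L^r(\mathbb R^d)}<\infty.$$ Assume that there exist $1\le p_1,p_2<\infty$ such that $$C_{\mathsf L}[K](p_1,p_2):=\sup_{\mathcal Q,t_1,t_2}\Big(\sup_{\substack{\|b\|_{\dot{\mathcal X}_{p_1}(\mathcal Q)}=1\\ \|f\|_{\mathcal Y_{p_2}(\mathcal Q)}=1}}\big|\mathcal Q[K]_{t_1}^{t_2}(b,f)\big|+\sup_{\substack{\|f\|_{\mathcal Y_\infty(\mathcal Q)}=1\\ \|b\|_{\dot{\mathcal X}_{p_2}(\mathcal Q)}=1}}\big|\mathcal Q[K]_{t_1}^{t_2}(f,b)\big|\Big)<\infty,$$ where the outer supremum is over all bounded measurable functions $t_1,t_2:\mathbb R^d\to\mathbb Z$ and all stopping collections $\mathcal Q$. Then $$\|T_\star[K]\|_{(p_1,p_2),\mathsf{sparse}}\lesssim\|[K]\|_{r,\star}+C_{\mathsf L}[K](p_1,p_2)$$ with an absolute dimensional implicit constant.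
   Context: Sparse norm: a countable collection $\mathcal S$ of cubes is $\eta$-sparse if there are pairwise disjoint measurable $E_I\subset I$, $I\in\mathcal S$, with $|E_I|\ge\eta|I|$; $\langle f\rangle_{p,Q}=|Q|^{-1/p}\|f\mathbf 1_Q\|_p$; $\|T\|_{(p_1,p_2),\mathsf{sparse}}$ is the least $C>0$ such that for all bounded compactly supported $f_1,f_2:\mathbb R^d\to\mathbb C$ there is a $\frac12$-sparse $\mathcal S$ with $|\langle Tf_1,f_2\rangle|\le C\sum_{Q\in\mathcal S}|Q|\langle f_1\rangle_{p_1,Q}\langle f_2\rangle_{p_2,Q}$. Operators: for $t_1,t_2\in\mathbb Z$, $T[K]f(x,t_1,t_2)=\sum_{t_1<s\le t_2}\int_{\mathbb R^d}K_s(x,y)f(y)\,dy$ (equal to $0$ if $t_1\ge t_2$), and $T_\star[K]f(x)=\sup_{t_1\le t_2}|T[K]f(x,t_1,t_2)|$; $\|T_\star[K]\|_{L^r(\mathbb R^d)}$ is the $L^r\to L^r$ operator norm. For bounded measurable $t_1,t_2:\mathbb R^d\to\mathbb Z$, $T[K]_{t_1}^{t_2}f(x)=T[K]f(x,t_1(x),t_2(x))$; integers are identified with constant functions and $t\wedge s=\min\{t,s\}$ pointwise. Cubes: dyadic cubes are taken from one of the canonical $3^d$ (shifted) dyadic systems; the scale $s_Q$ of $Q$ is defined by $|Q|=2^{s_Qd}$; $aQ$ is the concentric $a$-fold dilate; $\widehat L=2^5L$. Stopping collections: a stopping collection $\mathcal Q$ with top the dyadic cube $Q$ is a collection of pairwise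 disjoint dyadic cubes contained in $3Q$ such that, with $\mathsf{sh}\mathcal Q=\bigcup_{L\in\mathcal Q}L$, $\mathsf c\mathcal Q=\{L\in\mathcal Q:3L\cap2Q\ne\emptyset\}$ and $N(L)=\{L'\in\mathcal Q:3L\cap3L'\ne\emptyset\}$, one has $\bigcup_{L\in\mathsf c\mathcal Q}9L\subset\mathsf{sh}\mathcal Q\subset3Q$, and $|s_L-s_{L'}|\le8$ whenever $L\in\mathcal Q$, $L'\in N(L)$. Spaces: with $\mathrm M_pf(x)=\sup_{R\ni x}\langle f\rangle_{p,R}$ (supremum over cubes $R$), $\mathcal Y_p(\mathcal Q)$ is the space of $f\in L^p(\mathbb R^d)$ with $\mathrm{supp} f\subset3Q$ and finite norm $\|f\|_{\mathcal Y_p(\mathcal Q)}=\max\{\|f\mathbf 1_{\mathbb R^d\setminus\mathsf{sh}\mathcal Q}\|_\infty,\sup_{L\in\mathcal Q}\inf_{x\in\widehat L}\mathrm M_pf(x)\}$ if $p<\infty$, $\|f\|_{\mathcal Y_\infty(\mathcal Q)}=\|f\|_\infty$. $\mathcal X_p(\mathcal Q)$ is the subspace (same norm) of $b=\sum_{L\in\mathcal Q}b_L$ with $\mathrm{supp}\,b_L\subset L$; $\dot{\mathcal X}_p(\mathcal Q)$ is the subspace of those $b\in\mathcal X_p(\mathcal Q)$ with each $b_L$ of mean zero (same norm). Localized forms: for a stopping collection $\mathcal Q$ with top $Q$, $$\mathcal Q[K]_{t_1}^{t_2}(f_1,f_2)=\frac1{|Q|}\Big[\big\langle T[K]_{t_1}^{t_2\wedge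 s_Q}(f_1\mathbf 1_Q),f_2\big\rangle-\sum_{L\in\mathcal Q,\,L\subset Q}\big\langle T[K]_{t_1}^{t_2\wedge s_L}(f_1\mathbf 1_L),f_2\big\rangle\Big].$$ *)

(* Defs.v *)
From HB Require Import structures.
From mathcomp Require Import all_boot all_order all_algebra.
From mathcomp Require Import all_classical all_reals all_analysis.
From mathcomp Require Import complex.

Set Implicit Arguments.
Unset Strict Implicit.
Unset Printing Implicit Defensive.

Import Order.TTheory GRing.Theory Num.Theory.
Import numFieldNormedType.Exports.

Local Open Scope classical_set_scope.
Local Open Scope ring_scope.

Section lebesgue.
Context (R : realType) (d : nat).
Implicit Types (a b : 'rV[R]_d) (A : set 'rV[R]_d).

Definition box a b : set 'rV[R]_d :=
  [set x | forall i, a 0 i <= x 0 i < b 0 i].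

Definition box_volume a b : R := \prod_(i < d) Num.max 0 (b 0 i - a 0 i).

(* The covers are countable families of boxes indexed by a subset [D] of [nat],
   so that finite covers are allowed. *)
Definition lebesgue_outer A : \bar R :=
  ereal_inf [set \esum_(k in D.1) (box_volume (D.2 k).1 (D.2 k).2)%:E
    | D in [set D : set nat * (nat -> 'rV[R]_d * 'rV[R]_d) |
            A `<=` \bigcup_(k in D.1) box (D.2 k).1 (D.2 k).2]].

Lemma box_volume_ge0 a b : 0 <= box_volume a b.
Proof. by apply: prodr_ge0 => i _; rewrite le_max lexx. Qed.

Local Open Scope ereal_scope.

Lemma lebesgue_outer_ge0 A : 0 <= lebesgue_outer A.
Proof.
apply: le_ereal_inf_tmp => _ [D _ <-].
by apply: esum_ge0 => k _; rewrite lee_fin box_volume_ge0.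
Qed.

Lemma lebesgue_outer0 : lebesgue_outer set0 = 0.
Proof.
apply/eqP; rewrite eq_le lebesgue_outer_ge0 andbT.
apply: ereal_inf_lbound; exists (set0, fun=> (0%R, 0%R)) => //=.
by rewrite esum_set0.
Qed.

Lemma le_lebesgue_outer :
  {homo lebesgue_outer : A B / A `<=` B >-> A <= B}.
Proof.
move=> A B AB; apply: ereal_inf_le_tmp => _ [D /= BD <-].
by exists D => //=; exact: subset_trans BD.
Qed.

Lemma lebesgue_outer_sigma_subadditive : sigma_subadditive lebesgue_outer.
Proof.
move=> F; have [[i ioo]|] := pselect (exists i, lebesgue_outer (F i) = +oo).
  rewrite (eseries_pinfty _ _ ioo) ?leey// => n _.
  by rewrite -ltNye (lt_le_trans _ (lebesgue_outer_ge0 _)).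
rewrite -forallNE => Foo.
suff add2e (e : {posnum R}) : lebesgue_outer (\bigcup_n F n) <=
    \sum_(i <oo) lebesgue_outer (F i) + e%:num%:E.
  by apply/lee_addgt0Pr => _/posnumP[].
rewrite (le_trans _ (epsilon_trick _ _ _))//; last first.
  by move=> n; exact: lebesgue_outer_ge0.
pose v (D : set nat * (nat -> 'rV[R]_d * 'rV[R]_d)) k : \bar R :=
  (box_volume (D.2 k).1 (D.2 k).2)%:E.
have v0 D k : 0 <= v D k by rewrite lee_fin box_volume_ge0.
pose P n (D : set nat * (nat -> 'rV[R]_d * 'rV[R]_d)) :=
  F n `<=` \bigcup_(k in D.1) box (D.2 k).1 (D.2 k).2 /\
  \esum_(k in D.1) v D k <=
    lebesgue_outer (F n) + (e%:num / (2 ^ n.+1)%:R)%:E.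
have [G PG] : {G : nat -> set nat * (nat -> 'rV[R]_d * 'rV[R]_d)
    & forall n, P n (G n)}.
  apply: (@choice _ _ P) => n.
  have en : (0 < e%:num / (2 ^ n.+1)%:R :> R)%R by [].
  have fn : lebesgue_outer (F n) \is a fin_num.
    rewrite ge0_fin_numE ?lebesgue_outer_ge0// ltey.
    by apply/eqP; exact: Foo.
  have [_ [D FD <-] /ltW le] := lb_ereal_inf_adherent en fn.
  by exists D; split.
have /card_esym/ppcard_eqP[f] := card_nat2.
pose D : set nat := [set k | (G (f k).1).1 (f k).2].
pose B k := (G (f k).1).2 (f k).2.
apply: (@le_trans _ _ (\esum_(k in D) v (D, B) k)).
  apply: ereal_inf_lbound; exists (D, B) => //= x [n _ Fnx].
  have [k Gk xk] := (PG n).1 _ Fnx.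
  exists (f^-1%FUN (n, k)); rewrite /D /B /= invK ?inE//.
have -> : \esum_(k in D) v (D, B) k =
    \esum_(i in setT) \esum_(j in (G i).1) v (G i) j.
  rewrite esum_esum//.
  rewrite (reindex_esum D _ f)//; split; first by move=> k /= Dk; split.
    by move=> x y _ _; apply: (@inj _ _ setT f); rewrite ?inE.
  by move=> [n k] /= [_ Gk]; exists (f^-1%FUN (n, k)); rewrite /D /= invK ?inE.
rewrite -nneseries_esumT; last by move=> n; exact: esum_ge0.
apply: lee_nneseries => n *; first exact: esum_ge0.
exact: (PG n).2.
Qed.

HB.instance Definition _ := isOuterMeasure.Build R 'rV[R]_d lebesgue_outer
  lebesgue_outer0 lebesgue_outer_ge0 le_lebesgue_outer
  lebesgue_outer_sigma_subadditive.

End lebesgue.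

(* R^d with its sigma-algebra of Lebesgue measurable sets. *)
Definition Rd (R : realType) (d : nat) :=
  caratheodory_type (@lebesgue_outer R d).

HB.instance Definition _ (R : realType) (d : nat) := Measurable.on (Rd R d).

Definition leb (R : realType) (d : nat) : set (Rd R d) -> \bar R :=
  @lebesgue_outer R d.

HB.instance Definition _ (R : realType) (d : nat) :=
  isMeasure.Build _ _ _ (@leb R d)
    (outer_measure0 (@lebesgue_outer R d))
    (outer_measure_ge0 (@lebesgue_outer R d))
    (@caratheodory_measure_sigma_additive _ _ (@lebesgue_outer R d)).

Section complex_functions.
Context (R : realType).

Definition cmodulus (z : R[i]) : R := Normc.normc z.

Definition cmeasurable {dT} {T : measurableType dT} (f : T -> R[i]) : Prop :=
  measurable_fun [set: T] (fun x => complex.Re (f x)) /\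
  measurable_fun [set: T] (fun x => complex.Im (f x)).

Context (d : nat).
Implicit Types (f g : Rd R d -> R[i]) (A : set (Rd R d)).

Definition cintegral f : R[i] :=
  Complex (\int[@leb R d]_x complex.Re (f x))
          (\int[@leb R d]_x complex.Im (f x)).

Definition pairing f g : R[i] := cintegral (fun x => f x * conjc (g x)).

Definition cutoff A f : Rd R d -> R[i] := fun x => ((\1_A x : R)%:C)%C * f x.

Definition supported_in f A : Prop := forall x, f x != 0 -> A x.

(* [p : \bar R]; for [p = +oo] this is the essential supremum of [|f|]. *)
Definition norm_L (p : \bar R) f : \bar R :=
  Lnorm (@leb R d) p (fun x => (cmodulus (f x))%:E).

Definition in_L (p : \bar R) f : Prop := cmeasurable f /\ (norm_L p f < +oo)%E.

Definition euclid_norm (x : 'rV[R]_d) : R := Num.sqrt (\sum_(i < d) x 0 i ^+ 2).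

Definition bounded_compactly_supported f : Prop :=
  [/\ cmeasurable f,
      exists M : R, forall x, cmodulus (f x) <= M &
      exists M : R, supported_in f [set x | euclid_norm x <= M]].

End complex_functions.

Section cubes.
Context (R : realType) (d : nat).
Implicit Types (f : Rd R d -> R[i]) (p : R).

(* The pair [(a, l)] stands for the half-open cube with lower corner [a] and
   side length [l]; it is a genuine cube when [0 < l]. *)
Definition cube := ('rV[R]_d * R)%type.

Implicit Types Q I : cube.

Definition cube_set Q : set (Rd R d) := box Q.1 (Q.1 + const_mx Q.2).

Definition volume Q : R := fine (leb (cube_set Q)).

Definition dilate (a : R) Q : cube :=
  (Q.1 - const_mx ((a - 1) / 2 * Q.2), a * Q.2).

Definition average p f Q : \bar R :=
  ((volume Q `^ (- p^-1))%:E * norm_L p%:E (cutoff (cube_set Q) f))%E.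

Definition maximal p f (x : Rd R d) : \bar R :=
  ereal_sup [set average p f Q | Q in [set Q | 0 < Q.2 /\ cube_set Q x]].

Definition sparse (eta : R) (S : set cube) : Prop :=
  [/\ countable S,
      forall I, S I -> 0 < I.2 &
      exists E : cube -> set (Rd R d),
        [/\ forall I, S I -> measurable (E I),
            forall I, S I -> E I `<=` cube_set I,
            trivIset S E &
            forall I, S I -> (eta%:E * leb (cube_set I) <= leb (E I))%E]].

Definition sparse_norm (p1 p2 : R)
    (T : (Rd R d -> R[i]) -> (Rd R d -> R[i])) : \bar R :=
  ereal_inf [set C%:E | C in [set C : R | 0 < C /\
    forall f1 f2,
      bounded_compactly_supported f1 -> bounded_compactly_supported f2 ->
      exists S : set cube, sparse 2^-1 S /\
        ((cmodulus (pairing (T f1) f2))%:E <=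
         C%:E * \esum_(Q in S)
           ((volume Q)%:E * average p1 f1 Q * average p2 f2 Q))%E]].

End cubes.

Section operators.
Context (R : realType) (d : nat).
Implicit Types (K : int -> Rd R d -> Rd R d -> R[i]) (f : Rd R d -> R[i]).

Definition kernel_norm K : \bar R :=
  ereal_sup [set (((2 : R) ^ (s * d%:Z))%:E *
      ereal_sup [set (norm_L +oo (K s x) + norm_L +oo (fun y => K s y x))%E
                | x in [set: Rd R d]])%E
    | s in [set: int]].

Definition truncation K f (x : Rd R d) (t1 t2 : int) : R[i] :=
  \sum_(s \in [set s : int | t1 < s <= t2]) cintegral (fun y => K s x y * f y).

Definition maximal_truncation K f (x : Rd R d) : \bar R :=
  ereal_sup [set (cmodulus (truncation K f x t.1 t.2))%:E
            | t in [set t : int * int | t.1 <= t.2]].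

(* The same operator as a map between complex functions; when
   [maximal_truncation K] is bounded on some L^r, the value [+oo] discarded by
   [fine] is only taken on a null set. *)
Definition maximal_truncation_fun K f (x : Rd R d) : R[i] :=
  ((fine (maximal_truncation K f x))%:C)%C.

Definition operator_norm (r : R) (T : (Rd R d -> R[i]) -> (Rd R d -> \bar R)) :
    \bar R :=
  ereal_sup [set Lnorm (@leb R d) r%:E (T f)
            | f in [set f | in_L r%:E f /\ (norm_L r%:E f <= 1)%E]].

Definition linearized_truncation K (t1 t2 : Rd R d -> int) f : Rd R d -> R[i] :=
  fun x => truncation K f x (t1 x) (t2 x).

Definition bounded_measurable_time (t : Rd R d -> int) : Prop :=
  (forall n : int, measurable (t @^-1` [set n])) /\
  exists M : int, forall x, `|t x| <= M.

End operators.

Section stopping_collections.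
Context (R : realType) (d : nat).

(* The shift [w] selects one of the 3^d dyadic systems.  In the system [w], the
   index [(k, m)] stands for the cube 2^k ([0, 1)^d + m + (-1)^k w / 3). *)
Definition dyadic_index := (int * 'rV[int]_d)%type.

Definition scale (L : dyadic_index) : int := L.1.

Definition dyadic_cube (w : 'rV['I_3]_d) (L : dyadic_index) : cube R d :=
  (\row_(i < d) (2 ^ L.1 * ((L.2 0 i)%:~R + (-1) ^ L.1 * (w 0 i)%:R / 3)),
   2 ^ L.1).

Context (w : 'rV['I_3]_d).
Implicit Types (Q L : dyadic_index) (q : set dyadic_index).

Definition dset L : set (Rd R d) := cube_set (dyadic_cube w L).

Definition dset_dilate (a : R) L : set (Rd R d) :=
  cube_set (dilate a (dyadic_cube w L)).

Definition shadow q : set (Rd R d) := \bigcup_(L in q) dset L.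

Definition central Q q : set dyadic_index :=
  [set L | q L /\ dset_dilate 3 L `&` dset_dilate 2 Q !=set0].

Definition neighbors q L : set dyadic_index :=
  [set L' | q L' /\ dset_dilate 3 L `&` dset_dilate 3 L' !=set0].

Definition stopping_collection Q q : Prop :=
  [/\ trivIset q dset,
      forall L, q L -> dset L `<=` dset_dilate 3 Q,
      \bigcup_(L in central Q q) dset_dilate 9 L `<=` shadow q,
      shadow q `<=` dset_dilate 3 Q &
      forall L L', q L -> neighbors q L L' -> `|scale L - scale L'| <= 8].

Implicit Types (f b : Rd R d -> R[i]) (p : \bar R).

(* The meaningful exponents are [1 <= p <= +oo]. *)
Definition Ynorm p q f : \bar R :=
  if p is p'%:E then
    maxe (norm_L +oo (cutoff (~` shadow q) f))
      (ereal_sup [set ereal_inf [set maximal p' f x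
                                | x in dset_dilate (2 ^+ 5) L] | L in q])
  else norm_L +oo f.

Definition in_Y p Q q f : Prop :=
  [/\ in_L p f, supported_in f (dset_dilate 3 Q) & (Ynorm p q f < +oo)%E].

(* As the cubes of [q] are pairwise disjoint, the sum over [q] has at most one
   nonzero term at each point. *)
Definition in_Xdot p Q q b : Prop :=
  in_Y p Q q b /\
  exists b_ : dyadic_index -> Rd R d -> R[i],
    [/\ forall L, q L -> supported_in (b_ L) (dset L),
        forall L, q L -> cintegral (b_ L) = 0 &
        b = (fun x => \sum_(L \in q) b_ L x)].

Definition localized_form (K : int -> Rd R d -> Rd R d -> R[i])
    (t1 t2 : Rd R d -> int) Q q f1 f2 : R[i] :=
  (((volume (dyadic_cube w Q))^-1)%:C)%C *
  (pairing (linearized_truncation K t1 (fun x => Num.min (t2 x) (scale Q))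
              (cutoff (dset Q) f1)) f2
   - \sum_(L \in [set L | q L /\ dset L `<=` dset Q])
       pairing (linearized_truncation K t1 (fun x => Num.min (t2 x) (scale L))
                  (cutoff (dset L) f1)) f2).

End stopping_collections.

(* The quantities are nonnegative, so the supremum over an empty family is 0
   instead of -oo. *)
Definition nonneg_sup (R : realType) (A : set (\bar R)) : \bar R :=
  maxe 0%E (ereal_sup A).

Section localized_constant.
Context (R : realType) (d : nat).

Definition localized_constant (K : int -> Rd R d -> Rd R d -> R[i])
    (p1 p2 : R) : \bar R :=
  nonneg_sup [set C | exists (w : 'rV['I_3]_d) (Q : dyadic_index d)
                             (q : set (dyadic_index d))
                             (t1 t2 : Rd R d -> int),
    [/\ stopping_collection R w Q q,
        bounded_measurable_time t1, bounded_measurable_time t2 &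
        C = (nonneg_sup
               [set (cmodulus (localized_form w K t1 t2 Q q z.1 z.2))%:E
               | z in [set z : (Rd R d -> R[i]) * (Rd R d -> R[i]) |
                   [/\ in_Xdot w p1%:E Q q z.1, Ynorm w p1%:E q z.1 = 1%E,
                       in_Y w p2%:E Q q z.2 & Ynorm w p2%:E q z.2 = 1%E]]]
           + nonneg_sup
               [set (cmodulus (localized_form w K t1 t2 Q q z.1 z.2))%:E
               | z in [set z : (Rd R d -> R[i]) * (Rd R d -> R[i]) |
                   [/\ in_Y w +oo Q q z.1, Ynorm w +oo q z.1 = 1%E,
                       in_Xdot w p2%:E Q q z.2 & Ynorm w p2%:E q z.2 = 1%E]]])%E]].

End localized_constant.

(* Main.v *)
(* By monotone convergence the maximal truncation is linearized: for bounded
   integer valued times t1, t2 and a function h with |h| <= |f2|, the form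
   <T_{t1}^{t2} f1, h> captures a third of |<T_* f1, f2>|.

   Let Q be a dyadic cube and a_j the L^{p_j} average of f_j over 3Q.  By the
   weak type inequality the open set E where M_{p_j}(f_j 1_{3Q}) exceeds a large
   multiple of a_j, for j = 1 or 2, is small in Q, and the maximal dyadic cubes L
   in 3Q with 9L inside the union of E and the complement of 3Q form a stopping
   collection.  With the Calderon-Zygmund decompositions f_j = g_j + b_j along
   these cubes, the localized form splits as (b1, f2) + (g1, b2) + (g1, g2); the
   first two terms are controlled by the localized constant and the last one by
   the L^r bound.  So the form at Q is at most C |Q| a_1 a_2 plus the forms at the
   L inside Q.  Iterating until the scale drops below t1 yields a Carleson family
   of tripled cubes.

   A tripled cube lies in a dyadic cube of comparable size of one of the shifted
   lattices, and a Carleson family in a single lattice is a union of boundedly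
   many 1/2-sparse families: sort its members by the number of their ancestors
   modulo twice the Carleson constant. *)

Require Import Defs.
From HB Require Import structures.
From mathcomp Require Import all_boot all_order all_algebra.
From mathcomp Require Import all_classical all_reals all_analysis.
From mathcomp Require Import measurable_realfun ess_sup_inf complex ring lra zify.

Set Implicit Arguments.
Unset Strict Implicit.
Unset Printing Implicit Defensive.

Import Order.TTheory GRing.Theory Num.Theory.
Import numFieldNormedType.Exports.

Local Open Scope classical_set_scope.
Local Open Scope ring_scope.

(** * Lebesgue measure of boxes *)

(** The splitting of the forms is asymmetric because the hypothesis is: a cancellative first
    argument may be paired with [f2] itself, known only through [Y_p2], while a cancellative second
    argument asks for a first argument in [Y_oo]. So [f1] is split first, and [f2] only against the
    bounded [g1]. Mean zero serves nowhere else: the kernels enter through their supports and, for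
    integrability alone, through their boundedness. The constant has to depend on [d] alone although
    [p1], [p2] and [r] vary. Exponents are therefore removed by inequalities like [C <= C ^ p] for
    [C, p >= 1], and an [L^1] norm is bounded by a [p]-th power integral at a level [c] equal to the
    size that the answer should have. One number [A > 0] majorizes both the [L^r] norm and the
    localized constant throughout. Both are defined through normalized functions, so arguments are
    rescaled before these bounds apply; the localized constant tests norm exactly 1, so functions of
    norm 0 are treated apart, and on them every form vanishes. *)

Section box_volume.
Context (R : realType).

Definition row_cons d (t : R) (y : 'rV[R]_d) : 'rV[R]_d.+1 :=
  \row_i (if unlift ord0 i is Some j then y 0 j else t).

Definition row_tail d (x : 'rV[R]_d.+1) : 'rV[R]_d :=
  \row_j x 0 (lift ord0 j).

Lemma box_row_cons d (a b : 'rV[R]_d.+1) t y :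
  box a b (row_cons t y) <->
  a 0 ord0 <= t < b 0 ord0 /\ box (row_tail a) (row_tail b) y.
Proof.
split=> [ab|[tab yab] i].
  split; first by have := ab ord0; rewrite mxE unlift_none.
  by move=> j; have := ab (lift ord0 j); rewrite !mxE liftK.
rewrite mxE; case: unliftP => [j ->|-> //].
by have := yab j; rewrite !mxE.
Qed.

Lemma box_volume_recl d (a b : 'rV[R]_d.+1) : box_volume a b =
  Num.max 0 (b 0 ord0 - a 0 ord0) * box_volume (row_tail a) (row_tail b).
Proof.
rewrite /box_volume big_ord_recl; congr (_ * _).
by apply: eq_bigr => i _; rewrite !mxE.
Qed.

Local Open Scope ereal_scope.

(* Induction on the dimension, integrating the inequality for the slices with
   prescribed first coordinate. *)
Lemma box_volume_cover d (a b : 'rV[R]_d) (D : set nat)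
    (B : nat -> 'rV[R]_d * 'rV[R]_d) :
  box a b `<=` \bigcup_(k in D) box (B k).1 (B k).2 ->
  (box_volume a b)%:E <=
  \sum_(k <oo) if k \in D then (box_volume (B k).1 (B k).2)%:E else 0.
Proof.
have t0 (n : nat) (C : nat -> 'rV[R]_n * 'rV[R]_n) (X : set nat) k :
    0 <= (if k \in X then (box_volume (C k).1 (C k).2)%:E else 0).
  by case: ifP => // _; rewrite lee_fin box_volume_ge0.
elim: d a b D B => [|d IH] a b D B abB.
  (* In dimension 0 a box is a single point of volume 1, so one covering box is enough. *)
  have [k Dk _] : (\bigcup_(k in D) box (B k).1 (B k).2) 0%R.
    by apply: abB => -[].
  apply: le_trans (nneseries_lim_ge k.+1 _); last by move=> *; exact: t0.
  rewrite big_nat_recr//= mem_set//.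
  rewrite /box_volume !big_ord0; rewrite leeDr//.
  by apply: sume_ge0 => i _; exact: t0.
pose I (u v : R) : set R := `[u, v[%classic.
pose a' := row_tail a; pose b' := row_tail b.
pose c k : \bar R :=
  if k \in D then (box_volume (row_tail (B k).1) (row_tail (B k).2))%:E else 0.
have c0 k : 0 <= c k by rewrite /c; case: ifP => // _; rewrite lee_fin box_volume_ge0.
have cfin k : c k \is a fin_num by rewrite /c; case: ifP.
(* For fixed [t] only the boxes whose first side contains [t] are kept; their tails cover the tail
   of the box, which is the induction hypothesis. *)
have slice t : I (a 0 ord0)%R (b 0 ord0)%R t ->
    (box_volume a' b')%:E <=
    \sum_(k <oo) c k * (\1_(I ((B k).1 0 ord0) ((B k).2 0 ord0))%R t)%:E.
  rewrite /I /= in_itv /= => tab.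
  pose D' := D `&` [set k | I ((B k).1 0 ord0)%R ((B k).2 0 ord0)%R t].
  pose B' k := (row_tail (B k).1, row_tail (B k).2).
  have /IH/le_trans-> // : box a' b' `<=` \bigcup_(k in D') box (B' k).1 (B' k).2.
    move=> y yab.
    have [k Dk /box_row_cons[tk yk]] := abB _ ((box_row_cons a b t y).2 (conj tab yab)).
    by exists k => //; split=> //=; rewrite /I/= in_itv.
  apply: lee_nneseries => [k _ _|k _]; first exact: t0.
  rewrite /c indicE /D' in_setI; case: (k \in D) => /=; last by rewrite mul0e.
  rewrite [_ \in [set _ | _]](_ : _ = (t \in I ((B k).1 0 ord0)%R ((B k).2 0 ord0)%R)).
    by case: (_ \in _); rewrite ?mule1 ?mule0.
  by apply/idP/idP; rewrite !inE.
have volE (u v : R) : lebesgue_measure (I u v) = (Num.max 0 (v - u))%:E.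
  rewrite /I lebesgue_measure_itv/= lte_fin; case: ltP => uv.
    by rewrite -EFinD /Num.max subr_gt0 uv.
  by rewrite /Num.max subr_gt0 ltNge uv.
have mI u v : measurable (I u v : set (measurableTypeR R)) by exact: measurable_itv.
rewrite box_volume_recl mulrC EFinM -volE -integral_cst//.
apply: (@le_trans _ _ (\int[lebesgue_measure]_(t in I (a 0 ord0)%R (b 0 ord0)%R)
   \sum_(k <oo) c k * (\1_(I ((B k).1 0 ord0) ((B k).2 0 ord0))%R t)%:E)).
  apply: ge0_le_integral => //.
  - by move=> x _ /=; rewrite lee_fin box_volume_ge0.
  - apply: ge0_emeasurable_sum => //.
      by move=> k x _ _; apply: mule_ge0; rewrite ?lee_fin.
    move=> k _; apply: emeasurable_funM => //.
    by apply/measurable_EFinP; exact: measurable_indic.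
rewrite integral_nneseries//; last 2 first.
- move=> k; apply: emeasurable_funM => //.
  by apply/measurable_EFinP; exact: measurable_indic.
- by move=> k x _; apply: mule_ge0; rewrite ?lee_fin.
apply: lee_nneseries => [k _ _|k _].
  by apply: integral_ge0 => x _; apply: mule_ge0; rewrite ?lee_fin.
under eq_integral do rewrite muleC.
rewrite ge0_integralZr//; last first.
- by apply/measurable_EFinP; exact: measurable_indic.
rewrite integral_indic// muleC /c; case: ifPn => _; last by rewrite mul0e.
rewrite box_volume_recl [in leRHS]mulrC EFinM lee_wpmul2l ?lee_fin ?box_volume_ge0//.
by rewrite -volE; apply: le_measure; rewrite ?inE//; exact: measurableI.
Qed.

End box_volume.

Section lebesgue_box.
Context (R : realType) (d : nat).
Implicit Types (a b : 'rV[R]_d) (c : R).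

Lemma leb_box a b : leb (box a b : set (Rd R d)) = (box_volume a b)%:E.
Proof.
apply/eqP; rewrite eq_le; apply/andP; split.
  apply: ereal_inf_lbound; exists ([set 0%N], fun=> (a, b)) => /=.
    by move=> x xab; exists 0%N.
  by rewrite esum_set1// lee_fin box_volume_ge0.
apply: le_ereal_inf_tmp => _ [[D B] /= abB <-].
rewrite esum_mkcond -nneseries_esumT; last first.
  by move=> k; case: ifP => // _; rewrite lee_fin box_volume_ge0.
exact: box_volume_cover.
Qed.

Definition row_set a (i : 'I_d) c : 'rV[R]_d :=
  \row_j if j == i then c else a 0 j.

(** Cuts the box along the hyperplane [x_i = c]. With [min] and [max] the hyperplane may also miss
    the box, and then one of the two pieces is empty. *)
Lemma box_volume_split a b i c : box_volume a b =
  box_volume a (row_set b i (Num.min (b 0 i) c)) +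
  box_volume (row_set a i (Num.max (a 0 i) c)) b.
Proof.
pose F (u v : 'rV[R]_d) j : R := Num.max 0 (v 0 j - u 0 j).
rewrite /box_volume -[LHS]/(\prod_j F a b j).
rewrite -[X in X + _]/(\prod_j F a (row_set b i (Num.min (b 0 i) c)) j).
rewrite -[X in _ + X]/(\prod_j F (row_set a i (Num.max (a 0 i) c)) b j).
rewrite !(bigD1 (P := xpredT) i)//=.
rewrite [X in _ = _ * X + _](eq_bigr (F a b)); last first.
  by move=> j /negbTE ji; rewrite /F mxE ji.
rewrite [X in _ = _ + _ * X](eq_bigr (F a b)); last first.
  by move=> j /negbTE ji; rewrite /F mxE ji.
rewrite /F !mxE eqxx.
rewrite -mulrDl; congr (_ * _).
rewrite /Num.max /Num.min.
case: (ltP (b 0 i) c) => ?; case: (ltP (a 0 i) c) => ?;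
  by repeat (case: ltP => ?); lra.
Qed.

(** Cutting every box of a cover of [X] along the hyperplane gives covers of the two parts of [X]
    with the same total volume, which is the Caratheodory condition. *)
Lemma measurable_halfspace i c : measurable ([set x | x 0 i < c] : set (Rd R d)).
Proof.
apply: le_caratheodory_measurable => X /=.
apply: le_ereal_inf_tmp => _ [[D B] /= XB <-].
pose B1 k := ((B k).1, row_set (B k).2 i (Num.min ((B k).2 0 i) c)).
pose B2 k := (row_set (B k).1 i (Num.max ((B k).1 0 i) c), (B k).2).
rewrite (eq_esum (b := fun k => (box_volume (B1 k).1 (B1 k).2)%:E +
                                (box_volume (B2 k).1 (B2 k).2)%:E)%E); last first.
  by move=> k _; rewrite (box_volume_split _ _ i c) EFinD.
rewrite esumD; try by move=> *; rewrite lee_fin box_volume_ge0.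
apply: leeD.
  apply: ereal_inf_lbound; exists (D, B1) => //= x [/XB[k Dk xk] xc].
  exists k => // j; have := xk j; rewrite !mxE.
  by case: eqP => // ->; rewrite lt_min xc andbT.
apply: ereal_inf_lbound; exists (D, B2) => //= x [/XB[k Dk xk] /negP xc].
exists k => // j; have := xk j; rewrite !mxE.
by case: eqP => // ->; rewrite ge_max => /andP[-> ->]; rewrite leNgt xc.
Qed.

Lemma measurable_box a b : measurable (box a b : set (Rd R d)).
Proof.
have -> : (box a b : set (Rd R d)) = \bigcap_(i in [set: 'I_d])
    (~` [set x : Rd R d | x 0 i < a 0 i] `&` [set x : Rd R d | x 0 i < b 0 i]).
  apply/seteqP; split=> [x xab i _|x xab i].
    by have /andP[ax xb] := xab i; split => //; apply/negP; rewrite -leNgt.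
  by have [/negP] := xab i I; rewrite -leNgt => -> ->.
apply: fin_bigcap_measurable => // i _.
by apply: measurableI; [apply: measurableC|]; exact: measurable_halfspace.
Qed.

(** Needed for Tonelli, through which integrals against the kernels become measurable in the
    remaining variable. *)
Lemma leb_sigma_finite : sigma_finite [set: Rd R d] (@leb R d).
Proof.
exists (fun n => box (- const_mx n%:R) (const_mx n%:R)).
  apply/seteqP; split=> // x _.
  pose M := \sum_(i < d) `|x 0 i|.
  exists (Num.bound M).+1 => // i; rewrite !mxE.
  have xM : `|x 0 i| <= M.
    rewrite /M (bigD1 i)//= lerDl; exact: sumr_ge0.
  have : M < (Num.bound M)%:R by apply: archi_boundP; exact: sumr_ge0.
  move: xM; rewrite -natr1; case: ler0P; lra.
move=> n; split; first exact: measurable_box.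
by rewrite leb_box ltry.
Qed.

End lebesgue_box.

HB.instance Definition _ (R : realType) (d : nat) :=
  Measure_isSigmaFinite.Build _ _ _ (@leb R d) (leb_sigma_finite R d).

(** * Complex-valued functions *)

Section modulus.
Context (R : realType).
Implicit Types z : R[i].

Lemma ReD z1 z2 : complex.Re (z1 + z2) = complex.Re z1 + complex.Re z2.
Proof. by case: z1 z2 => [? ?] [? ?]. Qed.

Lemma ImD z1 z2 : complex.Im (z1 + z2) = complex.Im z1 + complex.Im z2.
Proof. by case: z1 z2 => [? ?] [? ?]. Qed.

Lemma ReM z1 z2 : complex.Re (z1 * z2) =
  complex.Re z1 * complex.Re z2 - complex.Im z1 * complex.Im z2.
Proof. by case: z1 z2 => [? ?] [? ?]. Qed.

Lemma ImM z1 z2 : complex.Im (z1 * z2) =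
  complex.Re z1 * complex.Im z2 + complex.Im z1 * complex.Re z2.
Proof. by case: z1 z2 => [? ?] [? ?]. Qed.

Lemma realMz (c : R) z :
  (c%:C)%C * z = Complex (c * complex.Re z) (c * complex.Im z).
Proof. by case: z => a b; simpc. Qed.

Lemma cmodulusE z : ((cmodulus z)%:C)%C = `|z|.
Proof. by []. Qed.

Lemma cmodulus_ge0 z : 0 <= cmodulus z.
Proof. by case: z => a b; exact: sqrtr_ge0. Qed.

Lemma cmodulus0 : cmodulus (0 : R[i]) = 0.
Proof. exact: Normc.normc0. Qed.

Lemma cmodulus_eq0 z : cmodulus z = 0 -> z = 0.
Proof. exact: Normc.eq0_normc. Qed.

Lemma cmodulusM z1 z2 : cmodulus (z1 * z2) = cmodulus z1 * cmodulus z2.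
Proof. exact: Normc.normcM. Qed.

Lemma cmodulusD z1 z2 : cmodulus (z1 + z2) <= cmodulus z1 + cmodulus z2.
Proof. by rewrite -lecR rmorphD/= !cmodulusE ler_normD. Qed.

Lemma cmodulusN z : cmodulus (- z) = cmodulus z.
Proof. by apply: (@complexI R); rewrite !cmodulusE normrN. Qed.

Lemma cmodulusB z1 z2 : cmodulus (z1 - z2) <= cmodulus z1 + cmodulus z2.
Proof. by rewrite (le_trans (cmodulusD _ _))// cmodulusN. Qed.

Lemma cmodulus_sum I (s : seq I) (P : pred I) (F : I -> R[i]) :
  cmodulus (\sum_(i <- s | P i) F i) <= \sum_(i <- s | P i) cmodulus (F i).
Proof.
elim/big_ind2 : _ => //; first by rewrite cmodulus0.
by move=> x1 x2 y1 y2 h1 h2; rewrite (le_trans (cmodulusD _ _))// lerD.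
Qed.

Lemma cmodulusC (x : R) : cmodulus (x%:C)%C = `|x|.
Proof. by rewrite /cmodulus /= expr0n addr0 sqrtr_sqr. Qed.

Lemma cmodulus_conj z : cmodulus (conjc z) = cmodulus z.
Proof. by case: z => a b; rewrite /cmodulus /= sqrrN. Qed.

Lemma normr_Re_le z : `|complex.Re z| <= cmodulus z.
Proof.
by case: z => a b; rewrite /= -sqrtr_sqr; apply: ler_wsqrtr; rewrite lerDl sqr_ge0.
Qed.

Lemma normr_Im_le z : `|complex.Im z| <= cmodulus z.
Proof.
by case: z => a b; rewrite /= -sqrtr_sqr; apply: ler_wsqrtr; rewrite lerDr sqr_ge0.
Qed.

Lemma cmodulus_le_ReIm z : cmodulus z <= `|complex.Re z| + `|complex.Im z|.
Proof.
have zE : z = ((complex.Re z)%:C + (0 +i* complex.Im z))%C.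
  by case: z => a b; rewrite /GRing.add /= addr0 add0r.
rewrite {1}zE (le_trans (cmodulusD _ _))// cmodulusC lerD2l /cmodulus /=.
by rewrite expr0n add0r sqrtr_sqr.
Qed.

End modulus.

Section cmeasurable.
Context (R : realType) dT (T : measurableType dT).
Implicit Types f g : T -> R[i].

Lemma cmeasurableD f g : cmeasurable f -> cmeasurable g ->
  cmeasurable (fun x => f x + g x).
Proof.
move=> [f1 f2] [g1 g2]; split.
  by under eq_fun do rewrite ReD; exact: measurable_funD.
by under eq_fun do rewrite ImD; exact: measurable_funD.
Qed.

Lemma cmeasurableM f g : cmeasurable f -> cmeasurable g ->
  cmeasurable (fun x => f x * g x).
Proof.
move=> [f1 f2] [g1 g2]; split.
  by under eq_fun do rewrite ReM; apply: measurable_funB; exact: measurable_funM.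
by under eq_fun do rewrite ImM; apply: measurable_funD; exact: measurable_funM.
Qed.

Lemma cmeasurable_cst (z : R[i]) : cmeasurable (fun _ : T => z).
Proof. by split; exact: measurable_cst. Qed.

Lemma cmeasurable_real (h : T -> R) : measurable_fun [set: T] h ->
  cmeasurable (fun x => ((h x)%:C)%C).
Proof. by move=> mh; split=> //=; exact: measurable_cst. Qed.

Lemma cmeasurable_conj f : cmeasurable f -> cmeasurable (fun x => conjc (f x)).
Proof.
move=> [f1 f2]; split.
  by rewrite (_ : (fun _ => _) = (fun x => complex.Re (f x)))//; apply/funext => x; case: (f x).
rewrite (_ : (fun _ => _) = (fun x => - complex.Im (f x))); last first.
  by apply/funext => x; case: (f x).
exact: measurable_funN.
Qed.

Lemma cmeasurableN f : cmeasurable f -> cmeasurable (fun x => - f x).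
Proof.
move=> mf; under eq_fun do rewrite -mulN1r.
by apply: cmeasurableM => //; exact: cmeasurable_cst.
Qed.

Lemma cmeasurableB f g : cmeasurable f -> cmeasurable g ->
  cmeasurable (fun x => f x - g x).
Proof. by move=> mf mg; apply: cmeasurableD => //; exact: cmeasurableN. Qed.

Lemma measurable_cmodulus f : cmeasurable f ->
  measurable_fun [set: T] (fun x => cmodulus (f x)).
Proof.
move=> [f1 f2]; rewrite (_ : (fun _ => _) =
  (fun x => (complex.Re (f x) ^+ 2 + complex.Im (f x) ^+ 2) `^ 2^-1)).
  apply: (measurableT_comp (measurable_powR _)).
  by apply: measurable_funD; exact: measurable_funX.
apply/funext => x; rewrite /cmodulus; case: (f x) => a b /=.
by rewrite powR12_sqrt// addr_ge0 ?sqr_ge0.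
Qed.

Lemma measurable_cmodulus_pow (p : R) f : cmeasurable f ->
  measurable_fun [set: T] (fun x => (cmodulus (f x) `^ p)%:E).
Proof.
move=> mf; apply/measurable_EFinP.
by apply: (measurableT_comp (measurable_powR _)); exact: measurable_cmodulus.
Qed.

Lemma measurable_cmodulusE f : cmeasurable f ->
  measurable_fun [set: T] (fun x => (cmodulus (f x))%:E).
Proof. by move=> mf; apply/measurable_EFinP; exact: measurable_cmodulus. Qed.

End cmeasurable.

Section cintegral.
Context (R : realType) dT (T : measurableType dT).
Variable mu : {measure set T -> \bar R}.
Implicit Types (f g : T -> R[i]).

(** [cintegral] is convertible to the instance at [leb]; the general measure keeps the Caratheodory
    structure out of the proofs. *)
Definition cint f : R[i] :=
  Complex (\int[mu]_x complex.Re (f x)) (\int[mu]_x complex.Im (f x)).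

Local Open Scope ereal_scope.

Definition norm1 f : \bar R := \int[mu]_x (cmodulus (f x))%:E.

Definition cintegrable f := cmeasurable f /\ norm1 f < +oo.

Lemma norm1_ge0 f : 0 <= norm1 f.
Proof. by apply: integral_ge0 => x _; rewrite lee_fin cmodulus_ge0. Qed.

Lemma cintegrableP f : cintegrable f ->
  mu.-integrable setT (fun x => (complex.Re (f x))%:E) /\
  mu.-integrable setT (fun x => (complex.Im (f x))%:E).
Proof.
move=> [[f1 f2] foo].
have fi : mu.-integrable setT (fun x => (cmodulus (f x))%:E).
  apply/integrableP; split; first exact: measurable_cmodulusE.
  by under eq_integral do rewrite gee0_abs ?lee_fin ?cmodulus_ge0//.
split.
  apply: (@le_integrable _ _ _ mu setT measurableT _ _ _ _ fi); first exact/measurable_EFinP.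
  by move=> x _ /=; rewrite lee_fin (ger0_norm (cmodulus_ge0 _)) normr_Re_le.
apply: (@le_integrable _ _ _ mu setT measurableT _ _ _ _ fi); first exact/measurable_EFinP.
by move=> x _ /=; rewrite lee_fin (ger0_norm (cmodulus_ge0 _)) normr_Im_le.
Qed.

Lemma norm1_le f g : cmeasurable f -> cmeasurable g ->
  (forall x, cmodulus (f x) <= cmodulus (g x))%R -> norm1 f <= norm1 g.
Proof.
move=> mf mg fg; apply: ge0_le_integral => //; try exact: measurable_cmodulusE.
- by move=> x _; rewrite lee_fin cmodulus_ge0.
- by move=> x _; rewrite lee_fin.
Qed.

Lemma norm1D f g : cmeasurable f -> cmeasurable g ->
  norm1 (fun x => f x + g x)%R <= norm1 f + norm1 g.
Proof.
move=> mf mg; rewrite /norm1 -ge0_integralD//; try exact: measurable_cmodulusE.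
- apply: ge0_le_integral => //.
  + by move=> x _; rewrite lee_fin cmodulus_ge0.
  + by apply: measurable_cmodulusE; exact: cmeasurableD.
  + by apply: emeasurable_funD; exact: measurable_cmodulusE.
  + by move=> x _; rewrite -EFinD lee_fin cmodulusD.
- by move=> x _; rewrite lee_fin cmodulus_ge0.
- by move=> x _; rewrite lee_fin cmodulus_ge0.
Qed.

Lemma norm1Z (c : R) f : cmeasurable f ->
  norm1 (fun x => (c%:C)%C * f x)%R = `|c|%:E * norm1 f.
Proof.
move=> mf; rewrite /norm1 -ge0_integralZl_EFin//.
- by apply: eq_integral => x _; rewrite -EFinM cmodulusM cmodulusC.
- by move=> x _; rewrite lee_fin cmodulus_ge0.
- exact: measurable_cmodulusE.
Qed.

Lemma cintegrableZ (c : R) f : cintegrable f ->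
  cintegrable (fun x => (c%:C)%C * f x)%R.
Proof.
move=> [mf fo]; split; first by apply: cmeasurableM => //; exact: cmeasurable_cst.
by rewrite norm1Z// lte_mul_pinfty// lee_fin.
Qed.

Lemma cintegrable_bounded_mul f g (M : R) : cintegrable f -> cmeasurable g ->
  (forall x, cmodulus (g x) <= M)%R -> cintegrable (fun x => g x * f x)%R.
Proof.
move=> fi mg gM; split; first by apply: cmeasurableM => //; exact: fi.1.
have /le_lt_trans : norm1 (fun x => g x * f x)%R <= norm1 (fun x => (M%:C)%C * f x)%R.
  apply: norm1_le.
  - by apply: cmeasurableM => //; exact: fi.1.
  - by apply: cmeasurableM; [exact: cmeasurable_cst|exact: fi.1].
  move=> x; rewrite !cmodulusM ler_wpM2r ?cmodulus_ge0// cmodulusC.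
  by rewrite (le_trans (gM x))// ler_norm.
by apply; exact: (cintegrableZ _ fi).2.
Qed.

Lemma cintD f g : cintegrable f -> cintegrable g ->
  cint (fun x => f x + g x)%R = (cint f + cint g)%R.
Proof.
move=> /cintegrableP[f1 f2] /cintegrableP[g1 g2].
rewrite /cint {3}/GRing.add /= -!RintegralD//.
by congr Complex; apply: eq_Rintegral => x _; rewrite ?ReD ?ImD.
Qed.

Lemma cintZ (c : R) f : cintegrable f ->
  cint (fun x => (c%:C)%C * f x)%R = ((c%:C)%C * cint f)%R.
Proof.
move=> /cintegrableP[f1 f2].
rewrite realMz /cint /= -!RintegralZl//.
by congr Complex; apply: eq_Rintegral => x _; rewrite realMz.
Qed.

Lemma cint0 : cint (fun _ : T => 0%R) = 0%R :> R[i].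
Proof. by rewrite /cint /Rintegral !integral0_eq. Qed.

Lemma cintB f g : cintegrable f -> cintegrable g ->
  cint (fun x => f x - g x)%R = (cint f - cint g)%R.
Proof.
move=> fi gi; have -> : (fun x => f x - g x)%R = (fun x => f x + ((-1)%:C)%C * g x)%R.
  by apply/funext => x; rewrite rmorphN rmorph1 mulN1r.
rewrite cintD//; last exact: cintegrableZ.
by rewrite cintZ// rmorphN rmorph1 mulN1r.
Qed.

(* The factor 2 is lost by treating real and imaginary parts separately. *)
Lemma cmodulus_cint_le f : cmeasurable f ->
  (cmodulus (cint f))%:E <= 2%:E * norm1 f.
Proof.
move=> mf; have aux (h : T -> R) : measurable_fun setT h ->
    (forall x, `|h x| <= cmodulus (f x))%R -> `|\int[mu]_x h x|%R%:E <= norm1 f.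
  move=> mh hf; rewrite /Rintegral.
  apply: (@le_trans _ _ `|\int[mu]_x (h x)%:E|).
    by case: (\int[mu]_x (h x)%:E) => [r| |] //=; rewrite normr0 leey.
  apply: le_trans (le_abse_integral _ _ _) _ => //; first exact/measurable_EFinP.
  apply: ge0_le_integral => //.
  - by apply/measurable_EFinP; exact: measurableT_comp.
  - exact: measurable_cmodulusE.
  - by move=> x _; rewrite lee_fin.
have h1 := aux _ mf.1 (fun x => normr_Re_le (f x)).
have h2 := aux _ mf.2 (fun x => normr_Im_le (f x)).
apply: (@le_trans _ _ (`|\int[mu]_x complex.Re (f x)| + `|\int[mu]_x complex.Im (f x)|)%R%:E).
  by rewrite lee_fin (le_trans (cmodulus_le_ReIm _)).
by rewrite EFinD -[2%R]/(1 + 1)%R EFinD ge0_muleDl// !mul1e leeD.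
Qed.

Lemma norm1_eq0_cint f : cmeasurable f -> norm1 f = 0 -> cint f = 0%R.
Proof.
move=> mf f0; apply: cmodulus_eq0; apply/eqP; rewrite eq_le cmodulus_ge0 andbT.
by rewrite -lee_fin (le_trans (cmodulus_cint_le mf))// f0 mule0.
Qed.

End cintegral.

Lemma eqW disp (T : porderType disp) (x y : T) : x = y -> (x <= y)%O.
Proof. by move=> ->. Qed.

(** * Integrals of [p]-th powers *)

Section power_integral.
Context (R : realType) dT (T : measurableType dT).
Variable mu : {measure set T -> \bar R}.
Implicit Types (f g : T -> R[i]) (p : R) (A B : set T).
Local Open Scope ereal_scope.

Definition pint p f A : \bar R := \int[mu]_(x in A) ((cmodulus (f x) `^ p)%:E).

Lemma pint_ge0 p f A : 0 <= pint p f A.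
Proof. by apply: integral_ge0 => x _; rewrite lee_fin powR_ge0. Qed.

Lemma measurable_cmodulus_powS p f A : cmeasurable f ->
  measurable_fun A (fun x => (cmodulus (f x) `^ p)%:E).
Proof. by move=> mf; apply: measurable_funTS; exact: measurable_cmodulus_pow. Qed.

Lemma pint_subset p f A B : measurable A -> measurable B -> cmeasurable f ->
  A `<=` B -> pint p f A <= pint p f B.
Proof.
move=> mA mB mf AB; apply: ge0_subset_integral => //.
  exact: measurable_cmodulus_powS.
by move=> x _; rewrite lee_fin powR_ge0.
Qed.

Lemma pint_le p f g A : measurable A -> cmeasurable f -> cmeasurable g ->
  (0 <= p)%R -> (forall x, A x -> cmodulus (f x) <= cmodulus (g x))%R ->
  pint p f A <= pint p g A.
Proof.
move=> mA mf mg p0 fg; apply: ge0_le_integral => //.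
- by move=> x _; rewrite lee_fin powR_ge0.
- exact: measurable_cmodulus_powS.
- exact: measurable_cmodulus_powS.
- by move=> x Ax; rewrite lee_fin ge0_ler_powR ?nnegrE ?cmodulus_ge0// fg.
Qed.

Lemma pint_bound p f A (M : R) : measurable A -> cmeasurable f ->
  (0 <= p)%R -> (forall x, A x -> cmodulus (f x) <= M)%R ->
  pint p f A <= (M `^ p)%:E * mu A.
Proof.
move=> mA mf p0 fM; rewrite -integral_cst//; apply: ge0_le_integral => //.
- by move=> x _; rewrite lee_fin powR_ge0.
- exact: measurable_cmodulus_powS.
- move=> x Ax /=; rewrite lee_fin ge0_ler_powR ?nnegrE ?cmodulus_ge0 ?fM//.
  by rewrite (le_trans (cmodulus_ge0 (f x)))// fM.
Qed.

(** Where [|h| <= G] one has [|b| <= 2G], elsewhere [|b| <= 2|h|]; hence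
    [|b|^p <= (2|h|)^p + (2G)^p] pointwise. The integral is then at most [2 (2G)^p |A|], and
    [2 <= 2^p] absorbs the factor into [4G]. *)
Lemma pint_perturb p h b A (l G : R) : measurable A -> cmeasurable h ->
  cmeasurable b -> (1 <= p)%R -> (0 <= l <= G)%R ->
  (forall x, A x -> cmodulus (b x) <= cmodulus (h x) + G)%R ->
  pint p h A <= (l `^ p)%:E * mu A -> pint p b A <= ((4 * G) `^ p)%:E * mu A.
Proof.
move=> mA mh mb p1 /andP[l0 lG] bh hl.
have p0 : (0 <= p)%R by lra.
have G0 : (0 <= G)%R by lra.
apply: (@le_trans _ _ (\int[mu]_(x in A)
    ((2 `^ p)%:E * (cmodulus (h x) `^ p)%:E + ((2 * G) `^ p)%:E))).
  apply: ge0_le_integral => //.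
  - by move=> x _; rewrite lee_fin powR_ge0.
  - exact: measurable_cmodulus_powS.
  - apply: emeasurable_funD; last exact: measurable_cst.
    by apply: emeasurable_funM; [exact: measurable_cst|exact: measurable_cmodulus_powS].
  - move=> x Ax; rewrite -EFinM -EFinD lee_fin -powRM ?cmodulus_ge0//.
    have [hG|hG] := leP (cmodulus (h x)) G.
      rewrite (@le_trans _ _ ((2 * G) `^ p))%R ?lerDr ?powR_ge0//.
      rewrite ge0_ler_powR ?nnegrE ?cmodulus_ge0//; last by have := bh _ Ax; lra.
      by rewrite mulr_ge0.
    rewrite (@le_trans _ _ ((2 * cmodulus (h x)) `^ p))%R ?lerDl ?powR_ge0//.
    rewrite ge0_ler_powR ?nnegrE ?cmodulus_ge0//; last by have := bh _ Ax; lra.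
    by rewrite mulr_ge0// cmodulus_ge0.
rewrite ge0_integralD//; last 3 first.
- by move=> x _; rewrite -EFinM lee_fin mulr_ge0 ?powR_ge0.
- by apply: emeasurable_funM; [exact: measurable_cst|exact: measurable_cmodulus_powS].
- by move=> x _; rewrite lee_fin powR_ge0.
rewrite ge0_integralZl_EFin ?powR_ge0//; last 2 first.
- by move=> x _; rewrite lee_fin powR_ge0.
- exact: measurable_cmodulus_powS.
rewrite integral_cst//.
apply: (@le_trans _ _ ((2 `^ p)%:E * ((l `^ p)%:E * mu A) + ((2 * G) `^ p)%:E * mu A)).
  by rewrite leeD2r// lee_wpmul2l// lee_fin powR_ge0.
rewrite muleA -EFinM -ge0_muleDl ?lee_fin ?mulr_ge0 ?powR_ge0//.
apply: lee_wpmul2r => //; rewrite -EFinD lee_fin -powRM//.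
have : ((2 * l) `^ p <= (2 * G) `^ p)%R.
  by rewrite ge0_ler_powR ?nnegrE ?mulr_ge0// ler_wpM2l.
have -> : (4 * G = 2 * (2 * G))%R by ring.
rewrite (@powRM _ 2 (2 * G))%R ?mulr_ge0//.
have : (2 <= 2 `^ p)%R by rewrite -[leLHS]powRr1// ler_powR// ler1n.
have := powR_ge0 (2 * G)%R p; nra.
Qed.

(* Pointwise [t <= c + c^(1-p) t^p], a substitute for Jensen's inequality. *)
Lemma pint1_le p f A (c : R) : measurable A -> cmeasurable f -> (1 <= p)%R ->
  (0 < c)%R -> \int[mu]_(x in A) (cmodulus (f x))%:E <=
  c%:E * mu A + (c `^ (1 - p))%:E * pint p f A.
Proof.
move=> mA mf p1 c0.
rewrite -integral_cst// -ge0_integralZl_EFin ?powR_ge0//; last 2 first.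
- by move=> x _; rewrite lee_fin powR_ge0.
- exact: measurable_cmodulus_powS.
rewrite -ge0_integralD//; last 3 first.
- by move=> x _; rewrite lee_fin ltW.
- by move=> x _; rewrite -EFinM lee_fin mulr_ge0 ?powR_ge0.
- by apply: emeasurable_funM; [exact: measurable_cst|exact: measurable_cmodulus_powS].
apply: ge0_le_integral => //.
- by move=> x _; rewrite lee_fin cmodulus_ge0.
- by apply: measurable_funTS; exact: measurable_cmodulusE.
- apply: emeasurable_funD; first exact: measurable_cst.
  by apply: emeasurable_funM; [exact: measurable_cst|exact: measurable_cmodulus_powS].
move=> x _; rewrite -EFinM -EFinD lee_fin.
set t := cmodulus (f x); have t0 : (0 <= t)%R by exact: cmodulus_ge0.
have cp := powR_ge0 c (1 - p)%R; have tp := powR_ge0 t p.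
have [tc|ct] := leP t c.
  by rewrite /= (le_trans tc)// lerDl mulr_ge0.
have tpos : (0 < t)%R by lra.
rewrite /=.
suff : (t <= c `^ (1 - p) * t `^ p)%R by lra.
have -> : (t `^ p = t * t `^ (p - 1))%R by rewrite mulr_powRB1//; lra.
rewrite mulrCA -[leLHS]mulr1 ler_pM2l// -(opprB p 1%R) powRN mulrC ler_pdivlMr ?powR_gt0//.
by rewrite mul1r ge0_ler_powR ?nnegrE//; lra.
Qed.

Lemma Lnorm_pint p f : (p != 0)%R ->
  Lnorm mu p%:E (fun x => (cmodulus (f x))%:E) = (pint p f setT) `^ p^-1.
Proof.
move=> p0; rewrite Lnorm.unlock /=; congr (_ `^ _); apply: eq_integral => x _.
by rewrite /= ger0_norm ?cmodulus_ge0.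
Qed.

Lemma pint_setT p f A : (p != 0)%R -> (forall x, ~ A x -> f x = 0%R) ->
  pint p f setT = pint p f A.
Proof.
move=> p0 fA; rewrite /pint [RHS]integral_mkcond; apply: eq_integral => x _.
rewrite patchE; case: ifPn => // /negP; rewrite inE => /fA ->.
by rewrite cmodulus0 powR0.
Qed.

End power_integral.

Section countable_union.
Context (R : realType) dT (T : measurableType dT).
Variable mu : {measure set T -> \bar R}.
Context (I : countType) (q : set I) (F : I -> set T).
Hypothesis mF : forall i, q i -> measurable (F i).
Local Open Scope ereal_scope.

Let G (n : nat) : set T :=
  if pickle_inv n is Some i then (if i \in q then F i else set0) else set0.

Let mG n : measurable (G n).
Proof.
rewrite /G; case: (pickle_inv (T := I) n) => [i|//].
by case: ifPn => // /set_mem; exact: mF.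
Qed.

Let bigcupG : \bigcup_(i in q) F i = \bigcup_n G n.
Proof.
apply/seteqP; split=> [x [i qi Fi]|x [n _]].
  by exists (pickle i) => //; rewrite /G pickleK_inv mem_set.
rewrite /G; case: (pickle_inv (T := I) n) => // i; case: ifPn => // /set_mem qi Fi.
by exists i.
Qed.

Lemma measurable_countable_bigcup : measurable (\bigcup_(i in q) F i).
Proof. by rewrite bigcupG; exact: bigcupT_measurable. Qed.

Hypothesis tF : trivIset q F.

(** For inequalities that hold on average over each piece but not pointwise, such as the selection
    rule of maximal dyadic cubes. *)
Lemma le_integral_countable_bigcup (phi psi : T -> \bar R) :
  measurable_fun setT phi -> measurable_fun setT psi ->
  (forall x, 0 <= phi x) -> (forall x, 0 <= psi x) ->
  (forall i, q i -> \int[mu]_(x in F i) phi x <= \int[mu]_(x in F i) psi x) ->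
  \int[mu]_(x in \bigcup_(i in q) F i) phi x <=
  \int[mu]_(x in \bigcup_(i in q) F i) psi x.
Proof.
move=> mphi mpsi phi0 psi0 le; rewrite bigcupG.
have tG : trivIset setT G.
  apply/trivIsetP => m n _ _ mn; apply/seteqP; split=> // x.
  rewrite /G; case um: (pickle_inv (T := I) m) => [i|]; last by case.
  case: ifPn => [/set_mem qi|]; last by move=> _ [].
  case un: (pickle_inv (T := I) n) => [j|]; last by case.
  case: ifPn => [/set_mem qj|]; last by move=> _ [].
  move=> [Fi Fj]; have ij : i = j by apply: tF => //; exists x.
  have := pickle_invK (T := I) m; have := pickle_invK (T := I) n.
  rewrite um un /= ij => nE mE; move: mn; rewrite -nE -mE.
  by rewrite eqxx.
rewrite !ge0_integral_bigcup//; try exact: measurable_funTS.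
apply: lee_nneseries => [n _ _|n _]; first exact: integral_ge0.
rewrite /G; case: (pickle_inv (T := I) n) => [i|]; last by rewrite !integral_set0.
by case: ifPn => [/set_mem/le//|_]; rewrite !integral_set0.
Qed.

End countable_union.

Section piecewise.
Context (R : realType) dT (T : measurableType dT).
Context (I : countType) (q : set I) (F : I -> set T).
Hypothesis mF : forall i, q i -> measurable (F i).

Lemma measurable_piecewise (f : T -> R) (g : I -> T -> R) :
  (forall i, measurable_fun [set: T] (g i)) ->
  (forall i x, q i -> F i x -> f x = g i x) ->
  (forall x, ~ (\bigcup_(i in q) F i) x -> f x = 0%R) ->
  measurable_fun [set: T] f.
Proof.
move=> mg fg f0 _ Y mY; rewrite setTI.
have -> : f @^-1` Y = \bigcup_(i in q) (F i `&` g i @^-1` Y) `|`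
    (if pselect (Y 0%R) then ~` \bigcup_(i in q) F i else set0).
  apply/seteqP; split=> [x Yx|x [[i qi [Fi /= gY]]|]].
  - have [[i qi Fi]|nx] := pselect ((\bigcup_(i in q) F i) x).
      by left; exists i => //; split=> //=; rewrite -(fg i).
    right; case: pselect => // nY; exfalso; apply: nY.
    by rewrite -(f0 x nx).
  - by rewrite /= (fg i).
  - by case: pselect => // Y0 nx; rewrite /= (f0 x nx).
apply: measurableU.
  apply: measurable_countable_bigcup => i qi; apply: measurableI; first exact: mF.
  by rewrite -[X in measurable X]setTI; exact: mg.
by case: (pselect _) => ?; [exact: measurableC (measurable_countable_bigcup mF)|exact: measurable0].
Qed.

End piecewise.

Lemma cmeasurable_piecewise (R : realType) dT (T : measurableType dT)
    (I : countType) (q : set I) (F : I -> set T) (f : T -> R[i]) (g : I -> T -> R[i]) :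
  (forall i, q i -> measurable (F i)) -> (forall i, cmeasurable (g i)) ->
  (forall i x, q i -> F i x -> f x = g i x) ->
  (forall x, ~ (\bigcup_(i in q) F i) x -> f x = 0) -> cmeasurable f.
Proof.
move=> mF mg fg f0; split.
  apply: (measurable_piecewise mF (g := fun i x => complex.Re (g i x))).
  - by move=> i; exact: (mg i).1.
  - by move=> i x qi Fi; rewrite (fg i).
  - by move=> x /f0 ->.
apply: (measurable_piecewise mF (g := fun i x => complex.Im (g i x))).
- by move=> i; exact: (mg i).2.
- by move=> i x qi Fi; rewrite (fg i).
- by move=> x /f0 ->.
Qed.

(** * Cubes and averages *)

Section cubes.
Context (R : realType) (d : nat).
Implicit Types (Q : cube R d) (x : Rd R d).

Lemma cube_setE Q x : cube_set Q x <->
  forall i, Q.1 0 i <= (x : 'rV[R]_d) 0 i < Q.1 0 i + Q.2.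
Proof. by split=> h i; have := h i; rewrite !mxE. Qed.

Lemma measurable_cube Q : measurable (cube_set Q).
Proof. exact: measurable_box. Qed.

Lemma leb_cube Q : 0 <= Q.2 -> leb (cube_set Q) = (Q.2 ^+ d)%:E.
Proof.
move=> Q0; rewrite /cube_set leb_box; congr EFin; rewrite /box_volume.
rewrite (eq_bigr (fun=> Q.2)); last first.
  by move=> i _; rewrite !mxE addrAC subrr add0r; apply/max_idPr.
by rewrite prodr_const card_ord.
Qed.

Lemma measure_cube Q : 0 <= Q.2 ->
  (@leb R d : {measure set (Rd R d) -> \bar R}) (cube_set Q) = (Q.2 ^+ d)%:E.
Proof. exact: leb_cube. Qed.

Lemma volumeE Q : 0 <= Q.2 -> volume Q = Q.2 ^+ d.
Proof. by move=> Q0; rewrite /volume leb_cube. Qed.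

Lemma normr_coord_le_euclid (x : 'rV[R]_d) i : `|x 0 i| <= euclid_norm x.
Proof.
rewrite /euclid_norm -sqrtr_sqr ler_wsqrtr// (bigD1 i)//= lerDl.
by apply: sumr_ge0 => j _; exact: sqr_ge0.
Qed.

Lemma euclid_norm_le (x : 'rV[R]_d) N : (forall i, `|x 0 i| <= N) ->
  euclid_norm x <= Num.sqrt (\sum_(i < d) N ^+ 2).
Proof.
move=> xN; rewrite /euclid_norm ler_wsqrtr// ler_sum// => i _.
by rewrite -real_normK ?num_real// lerXn2r ?nnegrE// (le_trans _ (xN i)).
Qed.

End cubes.

Lemma ler_pow2R (R : realType) (p x y : R) : 0 < p -> 0 <= x -> 0 <= y ->
  (x `^ p <= y `^ p) = (x <= y).
Proof.
move=> p0 x0 y0; apply/idP/idP => [|xy].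
  by apply: contraTT; rewrite -!ltNge => yx; apply: gt0_ltr_powR; rewrite ?nnegrE.
by apply: ge0_ler_powR; rewrite ?nnegrE// ltW.
Qed.

Section averages.
Context (R : realType) (d : nat).
Implicit Types (f : Rd R d -> R[i]) (Q : cube R d) (p : R).
Local Notation mu := (@leb R d).

Lemma cutoff_in (A : set (Rd R d)) f x : A x -> cutoff A f x = f x.
Proof. by move=> Ax; rewrite /cutoff indicE mem_set// mul1r. Qed.

Lemma cutoff_out (A : set (Rd R d)) f x : ~ A x -> cutoff A f x = 0.
Proof. by move=> Ax; rewrite /cutoff indicE memNset// mul0r. Qed.

Lemma cmeasurable_cutoff (A : set (Rd R d)) f : measurable A ->
  cmeasurable f -> cmeasurable (cutoff A f).
Proof.
move=> mA mf; apply: cmeasurableM; last exact: mf.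
by apply: cmeasurable_real; exact: measurable_indic.
Qed.

Lemma cmodulus_cutoff_le (A : set (Rd R d)) f x :
  cmodulus (cutoff A f x) <= cmodulus (f x).
Proof.
have [Ax|Ax] := pselect (A x); first by rewrite cutoff_in.
by rewrite cutoff_out// cmodulus0 cmodulus_ge0.
Qed.

Lemma pint_cutoff p f (A : set (Rd R d)) : p != 0 ->
  pint mu p (cutoff A f) setT = pint mu p f A.
Proof.
move=> p0; rewrite (@pint_setT _ _ _ mu p _ A p0 (@cutoff_out A f)).
by apply: eq_integral => x /set_mem Ax; rewrite cutoff_in.
Qed.

Lemma average_le p f Q (l : R) : 1 <= p -> 0 < Q.2 -> 0 <= l ->
  (average p f Q <= l%:E)%E =
  (pint mu p f (cube_set Q) <= (l `^ p * Q.2 ^+ d)%:E)%E.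
Proof.
move=> p1 Q0 l0; have p0 : 0 < p by lra.
have pn0 : p != 0 by rewrite gt_eqF.
rewrite /average /norm_L Lnorm_pint// pint_cutoff// (volumeE (ltW Q0)).
have v0 : 0 < Q.2 ^+ d by rewrite exprn_gt0.
set v := Q.2 ^+ d in v0 *.
have := pint_ge0 mu p f (cube_set Q).
case: (pint mu p f (cube_set Q)) => [r| |]// r0; last first.
  rewrite poweRyr ?invr_neq0// gt0_muley ?lte_fin ?powR_gt0//.
rewrite lee_fin in r0.
rewrite poweR_EFin -EFinM !lee_fin powRN mulrC ler_pdivrMr ?powR_gt0//.
rewrite -(ler_pow2R p0) ?powR_ge0 ?mulr_ge0 ?powR_ge0//.
by rewrite powRM ?powR_ge0// -!powRrM mulVf// !powRr1// ltW.
Qed.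

Lemma maximal_le p f x (l : R) : 1 <= p -> 0 <= l ->
  (maximal p f x <= l%:E)%E <->
  forall Q, 0 < Q.2 -> cube_set Q x ->
    (pint mu p f (cube_set Q) <= (l `^ p * Q.2 ^+ d)%:E)%E.
Proof.
move=> p1 l0; split=> [h Q Q0 Qx|h].
  rewrite -average_le//; apply: le_trans h; apply: ereal_sup_ubound.
  by exists Q.
by apply: ge_ereal_sup => _ [Q [Q0 Qx] <-]; rewrite average_le//; exact: h.
Qed.

Lemma average_ge0 p f Q : (0 <= average p f Q)%E.
Proof. by rewrite mule_ge0 ?lee_fin ?powR_ge0// Lnorm_ge0. Qed.

End averages.

Fact bcs_key : unit. Proof. exact: tt. Qed.

(* Locked so that [done] does not unfold goals [bcs f] down to the
   Caratheodory condition, on which unification is very slow. *)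
Definition bcs (R : realType) (d : nat) (f : Rd R d -> R[i]) : Prop :=
  locked_with bcs_key (bounded_compactly_supported f).

Lemma bcsE (R : realType) (d : nat) (f : Rd R d -> R[i]) :
  bcs f = bounded_compactly_supported f.
Proof. by rewrite /bcs unlock. Qed.

(** * Bounded measurable functions of compact support *)

Section bcs.
Context (R : realType) (d : nat).
Implicit Types (f g : Rd R d -> R[i]) (Q : cube R d) (p : R).
Local Notation mu := (@leb R d).

Lemma bcsP f : bcs f <->
  [/\ cmeasurable f, exists M, forall x, cmodulus (f x) <= M &
      exists N : R, forall x, f x != 0 -> forall i, `|(x : 'rV[R]_d) 0 i| <= N].
Proof.
rewrite bcsE; split=> [[mf fM [N fN]]|[mf fM [N fN]]].
  split=> //; exists N => x fx i.
  exact: le_trans (normr_coord_le_euclid _ _) (fN x fx).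
split=> //; exists (Num.sqrt (\sum_(i < d) N ^+ 2)) => x fx /=.
by apply: euclid_norm_le => i; exact: fN.
Qed.

Lemma bcs_cmeasurable f : bcs f -> cmeasurable f.
Proof. by rewrite bcsE; case. Qed.

Lemma bcs_bounded f : bcs f ->
  exists2 M, 0 <= M & forall x, cmodulus (f x) <= M.
Proof.
rewrite bcsE => -[_ [M fM] _]; exists M => //.
by rewrite (le_trans (cmodulus_ge0 (f point))).
Qed.

Lemma bcs_sub f g : cmeasurable g -> bcs f ->
  (exists M, forall x, cmodulus (g x) <= M) ->
  (forall x, g x != 0 -> f x != 0) -> bcs g.
Proof.
move=> mg /bcsP[mf fM [N fN]] gM gf; apply/bcsP; split => //.
by exists N => x /gf; exact: fN.
Qed.

Lemma bcs0 : bcs (fun _ : Rd R d => 0 : R[i]).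
Proof.
apply/bcsP; split; [exact: cmeasurable_cst|by exists 0 => x; rewrite cmodulus0|].
by exists 0 => x; rewrite eqxx.
Qed.

Lemma bcsD f g : bcs f ->
  bcs g -> bcs (fun x => f x + g x).
Proof.
move=> /bcsP[mf [M fM] [N fN]] /bcsP[mg [M' gM] [N' gN]]; apply/bcsP; split.
- exact: cmeasurableD.
- by exists (M + M') => x; rewrite (le_trans (cmodulusD _ _))// lerD.
- exists (Num.max N N') => x fgx i; rewrite le_max.
  have [fx|fx] := eqVneq (f x) 0; last by rewrite (fN _ fx).
  have [gx|gx] := eqVneq (g x) 0; last by rewrite (gN _ gx) orbT.
  by move: fgx; rewrite fx gx addr0 eqxx.
Qed.

Lemma bcsM f g (M : R) : bcs f -> cmeasurable g ->
  (forall x, cmodulus (g x) <= M) ->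
  bcs (fun x => g x * f x).
Proof.
move=> /[dup] bf /bcsP[mf [M' fM'] _] mg gM; apply: bcs_sub bf _ _.
- exact: cmeasurableM.
- exists (M * M') => x; rewrite cmodulusM.
  exact: (ler_pM (cmodulus_ge0 _) (cmodulus_ge0 _) (gM x) (fM' x)).
- by move=> x; rewrite mulf_eq0 negb_or => /andP[].
Qed.

Lemma bcsZ f (c : R[i]) : bcs f ->
  bcs (fun x => c * f x).
Proof.
by move=> bf; apply: (bcsM (M := cmodulus c) bf (cmeasurable_cst _ c)) => x.
Qed.

Lemma bcsB f g : bcs f ->
  bcs g -> bcs (fun x => f x - g x).
Proof.
move=> bf bg; have -> : (fun x => f x - g x) = (fun x => f x + (-1) * g x).
  by apply/funext => x; rewrite mulN1r.
exact: (bcsD bf (bcsZ (-1) bg)).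
Qed.

Lemma bcs_cutoff f (A : set (Rd R d)) : measurable A ->
  bcs f -> bcs (cutoff A f).
Proof.
move=> mA bf; apply: (@bcsM _ _ 1 bf).
  by apply: cmeasurable_real; exact: measurable_indic.
by move=> x; rewrite cmodulusC indicE; case: (x \in A); rewrite ?normr1 ?normr0//.
Qed.

Lemma bcs_support f : bcs f ->
  exists2 Q : cube R d, 0 < Q.2 & forall x, ~ cube_set Q x -> f x = 0.
Proof.
move=> /bcsP[_ _ [N fN]].
exists (const_mx (- (`|N| + 1)), 2 * (`|N| + 1) + 1) => /=.
  by have := normr_ge0 N; lra.
move=> x Qx; apply/eqP/negPn/negP => /fN fx; apply: Qx.
apply/cube_setE => i /=; rewrite mxE; have := fx i.
rewrite ler_norml => /andP[]; have := ler_norm N; lra.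
Qed.

Lemma bcs_pint_lty f p : bcs f -> 0 < p ->
  (pint mu p f setT < +oo)%E.
Proof.
move=> bf p0; have [Q Q0 fQ] := bcs_support bf.
have [mf [M fM] _] := (bcsP f).1 bf.
have pn0 : p != 0 by rewrite gt_eqF.
rewrite (@pint_setT _ _ _ mu p f (cube_set Q) pn0 fQ).
apply: le_lt_trans (pint_bound mu (measurable_cube Q) mf (ltW p0) (fun x _ => fM x)) _.
by rewrite (measure_cube (ltW Q0)) -EFinM ltry.
Qed.

Lemma norm1_pint f : norm1 mu f = pint mu 1 f setT.
Proof. by apply: eq_integral => x _; rewrite powRr1// cmodulus_ge0. Qed.

Lemma bcs_cintegrable f : bcs f -> cintegrable mu f.
Proof.
by move=> bf; split; [exact: bcs_cmeasurable|rewrite norm1_pint bcs_pint_lty].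
Qed.

Lemma bcs_in_L f p : 1 <= p -> bcs f -> in_L p%:E f.
Proof.
move=> p1 bf; split; first exact: bcs_cmeasurable.
have p0 : 0 < p by lra.
by rewrite /norm_L Lnorm_pint ?gt_eqF//; apply: poweR_lty; exact: bcs_pint_lty.
Qed.

Lemma norm_Loo_le f (l : R) : 0 <= l ->
  {ae mu, forall x, cmodulus (f x) <= l} -> (norm_L +oo f <= l%:E)%E.
Proof.
move=> l0 fl; rewrite /norm_L Lnorm.unlock /=; case: ifPn => _; last by rewrite lee_fin.
apply/ess_supP; apply: filterS fl => x /= fx.
by rewrite lee_fin ger0_norm// cmodulus_ge0.
Qed.

Lemma bcs_in_Loo f : bcs f -> in_L +oo f.
Proof.
move=> /[dup] bf /bcs_bounded[M M0 fM]; split; first exact: bcs_cmeasurable.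
apply: le_lt_trans (norm_Loo_le M0 _) _; rewrite ?ltry//.
by apply: nearW => x; exact: fM.
Qed.

End bcs.

(** * Shifted dyadic lattices *)

Section dyadic_grid.
Context (R : realType).
Implicit Types (k : int) (u v h x : R).

Lemma pow2_gt0 k : 0 < (2 : R) ^ k. Proof. by rewrite exprz_gt0. Qed.

Lemma pow2D k (n : nat) : (2 : R) ^ (k + n%:Z) = 2 ^ k * (2 ^+ n).
Proof. by rewrite expfzDr. Qed.

Lemma ler_pow2 k k' : ((2 : R) ^ k <= 2 ^ k') = (k <= k').
Proof. by rewrite ler_eXz2l// ltr1n. Qed.

Lemma ltr_pow2 k k' : ((2 : R) ^ k < 2 ^ k') = (k < k').
Proof. by rewrite ltr_eXz2l// ltr1n. Qed.

Lemma pow2_add_le k k' (n : nat) : k + n%:Z <= k' -> 2 ^+ n * (2 : R) ^ k <= 2 ^ k'.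
Proof. by move=> kk'; rewrite mulrC -pow2D ler_pow2. Qed.

Lemma signz k : ((-1 : R) ^ k = 1) \/ ((-1 : R) ^ k = -1).
Proof.
case: k => n /=.
  by rewrite -[_ ^ _]/(_ ^+ _) -signr_odd; case: odd; [right|left]; rewrite ?expr1 ?expr0.
rewrite -[_ ^ _]/((-1) ^- n.+1) -signr_odd; case: odd; [right|left].
  by rewrite expr1 invrN1.
by rewrite expr0 invr1.
Qed.

Lemma signz_int k : exists e : int, (-1 : R) ^ k = e%:~R.
Proof. by case: (signz k) => ->; [exists 1|exists (-1)]; rewrite ?mulrNz. Qed.

(** Both endpoints of the long interval lie on the grid [u + h Z], so a cell that meets the interval
    cannot cross one of them. *)
Lemma subset_grid u v h (z n : int) x : 0 < h -> v - u = h * z%:~R ->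
  u <= x < u + h -> v <= x < v + h * n%:~R ->
  v <= u /\ u + h <= v + h * n%:~R.
Proof.
move=> h0 vu /andP[ux xu] /andP[vx xv].
have z0 : z <= 0.
  rewrite -ltzD1 add0r -(ltr_int R) -(ltr_pM2l h0) -vu mulr1; lra.
have nz : 0 < z + n.
  rewrite -(ltr_int R) -(ltr_pM2l h0) mulr0 rmorphD/= mulrDr -vu; lra.
have {}nz : 1 <= z + n by lia.
move: z0 nz; rewrite -(ler_int R) -(ler_pM2l h0) -vu mulr0 => z0.
rewrite -(ler_int R) -(ler_pM2l h0) mulr1 rmorphD/= mulrDr -vu; lra.
Qed.

Lemma dyadic_scale (l : R) : 0 < l -> exists k, 2 ^ (k - 1) < l <= 2 ^ k.
Proof.
move=> l0.
have up (t : R) : 0 < t -> exists n : nat, t < 2 ^ (n%:Z).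
  move=> t0; exists (Num.bound t); apply: (lt_le_trans (archi_boundP (ltW t0))).
  by rewrite -[_ ^ _]/(2 ^+ _) -natrX ler_nat ltnW// ltn_expl.
have [n1 ln1] := up _ l0.
have [n2] := up l^-1 (eqbRL (invr_gt0 l) l0); rewrite invf_plt ?posrE ?pow2_gt0// => ln2.
pose P (j : nat) := l <= 2 ^ (j%:Z - n2%:Z).
have exP : exists j, P j.
  by exists (n1 + n2)%N; rewrite /P PoszD addrK ltW.
case: (ex_minnP exP) => j Pj minj; exists (j%:Z - n2%:Z); apply/andP; split=> //.
case: j Pj minj => [P0 _|j _ minj].
  by move: P0; rewrite /P sub0r leNgt -invr_expz ln2.
rewrite ltNge; apply/negP; have -> : j.+1%:Z - n2%:Z - 1 = j%:Z - n2%:Z by lia.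
by move=> /minj; rewrite ltnn.
Qed.

(* The endpoints at level [k] of the three shifted grids together form
   [(2 ^ k / 3) Z]. *)
Lemma one_third_trick (a l : R) k : 0 < l -> 3 * l <= 2 ^ k ->
  exists (wi : 'I_3) (m : int),
    2 ^ k * (m%:~R + (-1) ^ k * wi%:R / 3) <= a /\
    a + l <= 2 ^ k * (m%:~R + (-1) ^ k * wi%:R / 3) + 2 ^ k.
Proof.
move=> l0 lk; have k0 := pow2_gt0 k.
pose y := a / 2 ^ k; have ay : a = 2 ^ k * y by rewrite mulrC divfK ?gt_eqF.
(* [2 ^ k * t / 3] is the last point of the common grid that is at most [a]. Its distance to [a] is
   less than a third of [2 ^ k], and [l] adds at most another third. *)
pose t := Num.floor (3 * y).
have /andP[ty yt] : t%:~R <= 3 * y < (t + 1)%:~R by exact: floor_itv.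
suff [wi [m tE]] : exists (wi : 'I_3) (m : int), t%:~R = 3 * m%:~R + (-1) ^ k * wi%:R :> R.
  exists wi, m; rewrite (_ : m%:~R + _ = t%:~R / 3); last by rewrite tE; field.
  rewrite ay; rewrite rmorphD/= in yt; nra.
have rem (u : int) : exists wi : 'I_3, u = 3 * (u %/ 3)%Z + (wi : nat)%:Z.
  have u0 := modz_ge0 u (isT : (3 : int) != 0).
  have u3 := ltz_pmod u (isT : (0 : int) < 3).
  have wi3 : (absz (u %% 3)%Z < 3)%N by lia.
  by exists (Ordinal wi3) => /=; have := divz_eq u 3; lia.
have natZ (n : nat) : (n%:Z)%:~R = n%:R :> R by [].
(* The shift changes sign with the parity of [k], so for odd [k] the remainder of [- t] modulo 3 is
   taken. *)
case: (signz k) => ->.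
  have [wi tE] := rem t; exists wi, (t %/ 3)%Z.
  by rewrite {1}tE rmorphD/= rmorphM/= natZ mul1r.
have [wi tE] := rem (- t); exists wi, (- ((- t) %/ 3)%Z).
have {1}-> : t = 3 * - ((- t) %/ 3)%Z - (wi : nat)%:Z by lia.
by rewrite rmorphB/= rmorphM/= natZ mulN1r.
Qed.

End dyadic_grid.

(** * Dyadic cubes of one shifted lattice *)

Section dyadic_cubes.
Context (R : realType) (d : nat) (w : 'rV['I_3]_d).
Implicit Types (L Q P : dyadic_index d) (x : Rd R d) (q : set (dyadic_index d)).

Definition corner L (i : 'I_d) : R := (dyadic_cube R w L).1 0 i.

Definition side L : R := 2 ^ scale L.

Lemma side_gt0 L : 0 < side L. Proof. exact: pow2_gt0. Qed.

Lemma dyadic_cube2 L : (dyadic_cube R w L).2 = side L. Proof. by []. Qed.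

Lemma dsetE L x : dset w L x <-> forall i,
  corner L i <= (x : 'rV[R]_d) 0 i < corner L i + side L.
Proof. exact: cube_setE. Qed.

Lemma dset_dilateE a L x : dset_dilate w a L x <-> forall i,
  corner L i - (a - 1) / 2 * side L <= (x : 'rV[R]_d) 0 i <
  corner L i - (a - 1) / 2 * side L + a * side L.
Proof.
have E i : (dilate a (dyadic_cube R w L)).1 0 i = corner L i - (a - 1) / 2 * side L.
  by rewrite [LHS]mxE [in X in _ + X]mxE [in X in _ - X]mxE.
rewrite /dset_dilate; split=> [/cube_setE h i|h].
  by rewrite -E; exact: h.
by apply/cube_setE => i; rewrite E; exact: h.
Qed.

Lemma measurable_dset L : measurable (dset (R := R) w L).
Proof. exact: measurable_cube. Qed.

Lemma measurable_dset_dilate a L : measurable (dset_dilate (R := R) w a L).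
Proof. exact: measurable_cube. Qed.

Lemma leb_dset L : leb (dset w L) = (side L ^+ d)%:E.
Proof. by rewrite /dset leb_cube// dyadic_cube2 ltW// side_gt0. Qed.

(** The alternating sign of the shift makes the grids nested: over [n] levels the shifts differ by
    [w ((-2)^n - 1) / 3] fine side lengths, up to sign, and [(-2)^n] is 1 modulo 3. *)
Lemma corner_diff L L' i : scale L <= scale L' ->
  exists z : int, corner L' i - corner L i = side L * z%:~R.
Proof.
move=> LL'.
pose n := absz (scale L' - scale L).
have kn : scale L' = scale L + n%:Z by rewrite /n; lia.
have [e eE] := signz_int R (scale L).
have [t tE] : exists t : int, (-2) ^+ n = 1 + 3 * t.
  elim: n {kn} => [|n [t tE]]; first by exists 0; rewrite expr0; lia.
  by exists (-1 - 2 * t); rewrite exprS tE; lia.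
exists (2 ^+ n * L'.2 0 i - L.2 0 i + e * t * (w 0 i : nat)%:Z).
have tE' : (-1) ^+ n * 2 ^+ n = 1 + 3 * t%:~R :> R.
  rewrite -exprMn mulN1r; move/(congr1 (fun z => z%:~R : R)): tE.
  by rewrite rmorphXn/= rmorphD/= rmorphM/=.
have natZ (m : nat) : (m%:Z)%:~R = m%:R :> R by [].
rewrite /corner /side !mxE -/(scale L) -/(scale L') kn pow2D.
rewrite expfzDr// eE rmorphD rmorphB !rmorphM /= rmorphXn /= natZ.
rewrite -[(-1) ^ n]/((-1) ^+ n).
set u := 2 ^ scale L; set W := (w 0 i)%:R; set m' := _%:~R; set m := _%:~R.
have -> : e%:~R * t%:~R * W = e%:~R * ((-1) ^+ n * 2 ^+ n - 1) / 3 * W.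
  by rewrite tE'; field.
by field.
Qed.

Lemma dset_nonempty L : exists x, dset w L x.
Proof.
exists (dyadic_cube R w L).1; apply/dsetE => i.
by rewrite /corner lexx ltrDl side_gt0.
Qed.

Lemma dset_subset L L' : dset (R := R) w L `<=` dset w L' <->
  forall i, corner L' i <= corner L i /\ corner L i + side L <= corner L' i + side L'.
Proof.
split=> [LL' i|LL' x /dsetE Lx]; last first.
  by apply/dsetE => i; have := Lx i; have := LL' i; lra.
have [x Lx] := dset_nonempty L.
pose y t : Rd R d := \row_j (if j == i then t else (dyadic_cube R w L).1 0 j).
have L0 := side_gt0 L.
have yL t : corner L i <= t < corner L i + side L -> dset w L (y t).
  move=> ht; apply/dsetE => j; rewrite mxE; case: eqP => [->//|_].
  by rewrite /corner lexx ltrDl.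
have y1 := (dsetE _ _).1 (LL' _ (yL (corner L i) _)) i.
have {}y1 : corner L' i <= corner L i < corner L' i + side L'.
  by move: y1; rewrite mxE eqxx; apply; rewrite lexx ltrDl.
split; first by lra.
rewrite leNgt; apply/negP => lt.
(* If [L] stuck out of [L'] on the right, this coordinate would belong to a point of [L] outside
   [L']. *)
pose t := Num.max (corner L i) (corner L' i + side L').
have tL : corner L i <= t < corner L i + side L.
  by rewrite /t le_max lexx gt_max ltrDl L0.
have := (dsetE _ _).1 (LL' _ (yL t tL)) i; rewrite mxE eqxx /t le_max gt_max; lra.
Qed.

Lemma dset_dilate_subset a b L L' :
  (forall i, corner L' i - (b - 1) / 2 * side L' <= corner L i - (a - 1) / 2 * side L /\
    corner L i - (a - 1) / 2 * side L + a * side L <=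
    corner L' i - (b - 1) / 2 * side L' + b * side L') ->
  dset_dilate (R := R) w a L `<=` dset_dilate w b L'.
Proof.
move=> LL' x /dset_dilateE Lx; apply/dset_dilateE => i.
by have := Lx i; have := LL' i; lra.
Qed.

Lemma dset_dilate1 L : dset_dilate (R := R) w 1 L = dset w L.
Proof.
by apply/seteqP; split=> x h; [apply/dsetE => i|apply/dset_dilateE => i];
   [have := (dset_dilateE _ _ _).1 h i|have := (dsetE _ _).1 h i]; lra.
Qed.

Lemma dyadic_nested L L' x : scale L <= scale L' -> dset w L x -> dset w L' x ->
  dset (R := R) w L `<=` dset w L'.
Proof.
move=> LL' /dsetE Lx /dsetE L'x; apply/dset_subset => i.
have [z zE] := corner_diff i LL'.
have side_n : side L' = side L * (2 ^+ absz (scale L' - scale L) : int)%:~R.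
  by rewrite rmorphXn/= -pow2D; congr (_ ^ _); lia.
by rewrite side_n; apply: (subset_grid (side_gt0 L) zE (Lx i)); rewrite -side_n.
Qed.

(** The corner of [3Q] is that of [Q] moved by one full side of [Q], hence a point of the grid of
    [L]. This is what makes [3Q] compatible with the lattice. *)
Lemma dset_subset_dilate3 L Q x : scale L <= scale Q -> dset w L x ->
  dset_dilate w 3 Q x -> dset (R := R) w L `<=` dset_dilate w 3 Q.
Proof.
move=> LQ /dsetE Lx /dset_dilateE Qx; rewrite -dset_dilate1.
apply: dset_dilate_subset => i.
have [z zE] := corner_diff i LQ.
pose n : int := 2 ^+ absz (scale Q - scale L).
have side_n : side Q = side L * n%:~R.
  by rewrite rmorphXn/= -pow2D; congr (_ ^ _); lia.
have zE' : corner Q i - side Q - corner L i = side L * (z - n)%:~R.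
  by rewrite rmorphB/= mulrBr -zE -side_n; ring.
have side_n3 : side L * (n * 3)%:~R = 3 * side Q by rewrite rmorphM/= mulrA -side_n mulrC.
have Qxi : corner Q i - side Q <= (x : 'rV[R]_d) 0 i < corner Q i - side Q + side L * (n * 3)%:~R.
  by rewrite side_n3; have := Qx i; lra.
by have := subset_grid (side_gt0 L) zE' (Lx i) Qxi; rewrite side_n3; lra.
Qed.

Lemma dyadic_at (k : int) x : exists2 L, scale L = k & dset w L x.
Proof.
have k0 := pow2_gt0 R k.
pose sigma i : R := (-1) ^ k * (w 0 i)%:R / 3.
pose L : dyadic_index d := (k, \row_i Num.floor ((x : 'rV[R]_d) 0 i / 2 ^ k - sigma i)).
exists L => //; apply/dsetE => i; rewrite /corner /side !mxE /= -/(sigma i).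
set y := (x : 'rV[R]_d) 0 i; set z := y / 2 ^ k.
have yz : y = 2 ^ k * z by rewrite mulrC divfK ?gt_eqF.
have /andP[h1 h2] : (Num.floor (z - sigma i))%:~R <= z - sigma i < (Num.floor (z - sigma i) + 1)%:~R.
  exact: floor_itv.
rewrite rmorphD/= in h2; move: (_%:~R) h1 h2 => fl h1 h2; rewrite yz; nra.
Qed.

Lemma dyadic_uniq L L' x : scale L = scale L' -> dset w L x -> dset w L' x -> L = L'.
Proof.
move=> LL' Lx L'x.
have /dset_subset s1 := dyadic_nested (eqW LL') Lx L'x.
have /dset_subset s2 := dyadic_nested (eqW (esym LL')) L'x Lx.
case: L L' LL' s1 s2 {Lx L'x} => k m [_ m'] /= <- s1 s2; congr pair.
apply/rowP => i; have [h1 _] := s1 i; have [h2 _] := s2 i.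
have : corner (k, m) i = corner (k, m') i by lra.
rewrite /corner !mxE /= => /(mulfI (lt0r_neq0 (pow2_gt0 R k)))/addIr.
by move=> /eqP; rewrite eqr_int => /eqP.
Qed.

Lemma dyadic_parent L : exists2 P, scale P = scale L + 1 & dset (R := R) w L `<=` dset w P.
Proof.
have [x Lx] := dset_nonempty L; have [P Ps Px] := dyadic_at (scale L + 1) x.
by exists P => //; apply: dyadic_nested Lx Px; rewrite Ps; lia.
Qed.

Definition maximal_in (A : set (dyadic_index d)) : set (dyadic_index d) :=
  [set L | A L /\ forall L', A L' -> dset (R := R) w L `<=` dset w L' -> scale L' <= scale L].

Lemma trivIset_maximal A : trivIset (maximal_in A) (dset (R := R) w).
Proof.
have wlog L L' x : maximal_in A L -> maximal_in A L' -> dset w L x ->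
    dset w L' x -> scale L <= scale L' -> L = L'.
  move=> [_ maxL] [AL' _] Lx L'x LL'; apply: (dyadic_uniq (x := x)) => //.
  by apply/eqP; rewrite eq_le LL' maxL//; exact: dyadic_nested Lx L'x.
move=> L L' qL qL' [x [Lx L'x]].
have [|/ltW] := leP (scale L) (scale L'); first exact: wlog Lx L'x.
by move=> h; apply/esym; exact: wlog L'x Lx h.
Qed.

Lemma maximal_cover A (N : int) L : (forall L, A L -> scale L <= N) -> A L ->
  exists2 L', maximal_in A L' & dset (R := R) w L `<=` dset w L'.
Proof.
move=> AN; have [n] := ubnP (absz (N - scale L)).
elim: n L => // n IH L Ln AL.
have [|notmax] := pselect (maximal_in A L); first by exists L.
have [L' [AL' LL' lt]] : exists L', [/\ A L', dset (R := R) w L `<=` dset w L' & scale L < scale L'].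
  apply: contrapT => no; apply: notmax; split=> // L' AL' LL'.
  by rewrite leNgt; apply/negP => lt; apply: no; exists L'.
have [|L'' mL'' L'L''] := IH L' _ AL'; first by have := AN _ AL'; have := AN _ AL; lia.
by exists L'' => //; exact: subset_trans L'L''.
Qed.

End dyadic_cubes.

(** * Maximal function *)

Section small.
Context (R : realType).

Lemma finite_pos_lb d (g : 'I_d -> R) : (forall i, 0 < g i) ->
  exists2 e : R, 0 < e & forall i, e <= g i.
Proof.
move=> g0; pose S := 1 + \sum_i (g i)^-1.
have S0 : 0 < S by rewrite ltr_pwDl// sumr_ge0// => i _; rewrite invr_ge0 ltW.
exists S^-1 => [|i]; first by rewrite invr_gt0.
rewrite invf_ple ?posrE// /S (bigD1 i)//= addrCA lerDl addr_ge0// sumr_ge0// => j _.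
by rewrite invr_ge0 ltW.
Qed.

Lemma pow2_below (e : R) : 0 < e -> exists k : int, 2 ^ k <= e.
Proof.
move=> e0; have [k /andP[ke _]] := dyadic_scale e0.
by exists (k - 1); exact: ltW.
Qed.

Lemma pow2_above (B : R) : exists n : nat, B <= 2 ^ n%:Z.
Proof.
exists (Num.bound `|B|); apply: (le_trans (ler_norm B)).
apply: (le_trans (ltW (archi_boundP (normr_ge0 B)))).
by rewrite -[_ ^ _]/(2 ^+ _) -natrX ler_nat ltnW// ltn_expl.
Qed.

End small.

Section weak_type.
Context (R : realType) (d : nat).
Hypothesis d0 : (0 < d)%N.
Implicit Types (f : Rd R d -> R[i]) (Q : cube R d) (p l : R).
Local Notation mu := (@leb R d).

(** The one-third trick in each coordinate independently, which is why all [3 ^ d] shifts occur. *)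
Lemma shifted_dyadic_cover Q (k : int) : 0 < Q.2 -> 3 * Q.2 <= 2 ^ k ->
  exists w L, scale L = k /\ cube_set Q `<=` dset w L.
Proof.
move=> Q0 Qk.
have /(_ _)/cid-/all_sig[wi] : forall i, exists wi : 'I_3, exists m : int,
    2 ^ k * (m%:~R + (-1) ^ k * wi%:R / 3) <= Q.1 0 i /\
    Q.1 0 i + Q.2 <= 2 ^ k * (m%:~R + (-1) ^ k * wi%:R / 3) + 2 ^ k.
  by move=> i; exact: one_third_trick.
move=> /(_ _)/cid-/all_sig[m wm].
exists (\row_i wi i), (k, \row_i m i); split=> // x /cube_setE Qx.
by apply/dsetE => i; rewrite /corner /side !mxE /=; have := Qx i; have := wm i; lra.
Qed.

(** Families of cubes of bounded volume have bounded scales, so that [maximal_cover] applies to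
    them. *)
Lemma volume_scale_bound (B : R) : exists N : int, forall L : dyadic_index d,
  side R L ^+ d <= B -> scale L <= N.
Proof.
have [n Bn] := pow2_above B; exists n%:Z => L LB.
rewrite leNgt; apply/negP => nL.
have : 2 ^ n%:Z < side R L by rewrite /side ltr_pow2.
have n1 : 1 <= (2 : R) ^ n%:Z by rewrite -[_ ^ _]/(2 ^+ _) exprn_ege1// ler1n.
move=> nL'; have : side R L <= side R L ^+ d.
  by rewrite ler_eXnr// (le_trans n1)// ltW.
lra.
Qed.

Lemma measure_dset w (L : dyadic_index d) :
  (mu : {measure set (Rd R d) -> \bar R}) (dset w L) = (side R L ^+ d)%:E.
Proof. exact: leb_dset. Qed.

Lemma integral_one (A : set (Rd R d)) : measurable A -> (\int[mu]_(x in A) 1 = mu A)%E.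
Proof. by move=> mA; rewrite integral_cst// mul1e. Qed.

(** The shifted lattices replace a Vitali covering. A cube with average above [l] lies in a shifted
    dyadic cube at most 6 times as long, whose own average is then large. The maximal cubes of this
    kind are disjoint in each lattice, with total volume at most [6 ^ d / l ^ p] times the integral,
    and there are [3 ^ d] lattices. *)
Lemma maximal_weak_type p f l : bcs f -> 1 <= p -> 0 < l ->
  exists U : set (Rd R d), [/\ measurable U,
    forall x, ~ (maximal p f x <= l%:E)%E -> U x &
    (mu U <= (18 ^+ d / l `^ p)%:E * pint mu p f setT)%E].
Proof.
move=> bf p1 l0; have mf := bcs_cmeasurable bf.
have lp0 : 0 < l `^ p by rewrite powR_gt0.
have p0 : 0 < p by lra.
pose c : R := 6 ^+ d / l `^ p.
have c0 : 0 < c by rewrite divr_gt0// exprn_gt0.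
pose A w := [set L : dyadic_index d |
  ((side R L ^+ d)%:E <= c%:E * pint mu p f (dset w L))%E].
pose I := pint mu p f setT.
have Ifin : I \is a fin_num.
  by rewrite ge0_fin_numE ?pint_ge0//; exact: bcs_pint_lty.
have pI w L : (pint mu p f (dset w L) <= I)%E.
  by apply: pint_subset; [exact: measurable_dset|exact: measurableT|exact: mf|].
have [N AN] : exists N, forall w L, A w L -> scale L <= N.
  have [N hN] := volume_scale_bound (c * fine I); exists N => w L AL.
  apply: hN; rewrite -lee_fin (le_trans AL)// [leRHS]EFinM fineK// lee_wpmul2l// lee_fin.
  exact: ltW.
pose U w : set (Rd R d) := \bigcup_(L in maximal_in R w (A w)) dset w L.
have mU w : measurable (U w).
  by apply: measurable_countable_bigcup => L _; exact: measurable_dset.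
have muU w : (mu (U w) <= c%:E * I)%E.
  rewrite -integral_one//.
  have mphi := measurable_cmodulus_pow p mf.
  have fp0 x : (0 <= (cmodulus (f x) `^ p)%:E)%E by rewrite lee_fin powR_ge0.
  apply: (@le_trans _ _ (\int[mu]_(x in U w) (c%:E * (cmodulus (f x) `^ p)%:E))%E).
    apply: le_integral_countable_bigcup.
    - by move=> L _; exact: measurable_dset.
    - exact: trivIset_maximal.
    - exact: measurable_cst.
    - exact: (emeasurable_funM (measurable_cst _) mphi).
    - by [].
    - by move=> x; rewrite mule_ge0// lee_fin ltW.
    - move=> L [AL _]; rewrite integral_one; last exact: measurable_dset.
      rewrite ge0_integralZl_EFin//.
      + by rewrite -[leLHS]/(leb (dset w L)) leb_dset; exact: AL.
      + exact: measurable_dset.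
      + exact: measurable_funTS mphi.
      + exact: ltW.
  rewrite ge0_integralZl_EFin//; [|exact: measurable_funTS mphi|exact: ltW].
  apply: lee_wpmul2l; first by rewrite lee_fin ltW.
  exact: (pint_subset mu p (mU w) measurableT mf (@subsetT _ _)).
exists (\bigcup_(w in [set: 'rV['I_3]_d]) U w); split.
- by apply: measurable_countable_bigcup => w _; exact: mU.
- move=> x /(maximal_le f x p1 (ltW l0)) /existsNP[Q /not_implyP[Q0 /not_implyP[Qx]]].
  move=> /negP; rewrite -ltNge => lt.
  have [k /andP[k1 k2]] : exists k, 2 ^ (k - 1) < 3 * Q.2 <= 2 ^ k.
    by apply: dyadic_scale; rewrite mulr_gt0.
  have [w [L [Lk QL]]] := shifted_dyadic_cover Q0 k2.
  have sL : side R L <= 6 * Q.2.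
    have -> : side R L = 2 ^ (k - 1) * 2 by rewrite /side Lk -[2 in RHS]expr1 -pow2D subrK.
    lra.
  have AL : A w L.
    rewrite /A /=; apply: (@le_trans _ _ (c%:E * (l `^ p * Q.2 ^+ d)%:E)%E).
      rewrite -EFinM lee_fin /c mulrA divfK ?gt_eqF// -exprMn.
      apply: lerXn2r; rewrite ?nnegrE; [exact: ltW (side_gt0 _ _)| |exact: sL].
      by rewrite mulr_ge0// ltW.
    apply: lee_wpmul2l; first by rewrite lee_fin ltW.
    apply: (le_trans (ltW lt)).
    by apply: pint_subset; [exact: measurable_cube|exact: measurable_dset|exact: mf|].
  have [L' mL' LL'] := maximal_cover R w (AN w) AL.
  by exists w => //; exists L' => //; apply: LL'; exact: QL.
- pose E := enum 'rV['I_3]_d; pose F k := U (nth 0 E k).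
  have UF : \bigcup_(w in [set: 'rV['I_3]_d]) U w `<=` \big[setU/set0]_(k < size E) F k.
    move=> x [w _ Ux]; rewrite -bigcup_mkord; exists (index w E).
      by rewrite /= index_mem mem_enum.
    by rewrite /F nth_index// mem_enum.
  apply: le_trans (@content_subadditive _ _ _ mu _ F (size E) _ _ UF) _.
  + by move=> k _; exact: mU.
  + by apply: measurable_countable_bigcup => w _; exact: mU.
  have cI : (c * fine I)%:E = (c%:E * I)%E by rewrite [LHS]EFinM fineK.
  apply: (@le_trans _ _ (\sum_(k < size E) (c * fine I)%:E)%E).
    by apply: lee_sum => k _; rewrite cI; exact: muU.
  rewrite sumEFin sumr_const card_ord -cardE card_mx mul1n card_ord.
  rewrite -[pint _ _ _ _]/I -{2}(fineK Ifin) -EFinM lee_fin.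
  rewrite -[leLHS]mulr_natl natrX mulrA ler_wpM2r//.
    by rewrite fine_ge0// pint_ge0.
  by rewrite /c mulrA -exprMn -natrM.
Qed.

(* A lossy Lebesgue differentiation theorem: enlarging the boxes of an almost
   optimal cover of a set by the factor 2 makes every point of the set interior
   to one of them, so that the dyadic cubes inside these boxes cover the set. *)
Lemma dyadic_cover w (B : set (Rd R d)) (m e : R) : (leb B = m%:E)%E -> 0 < e ->
  exists q : set (dyadic_index d),
    [/\ trivIset q (dset (R := R) w), B `<=` \bigcup_(L in q) dset w L,
        forall L, q L -> exists2 x, B x & dset w L x &
        (leb (\bigcup_(L in q) dset w L) <= (2 ^+ d * (m + e))%:E)%E].
Proof.
move=> Bm e0.
have Bfin : leb B \is a fin_num by rewrite Bm.
have [_ [[D b] /= BD <-] Dm] := lb_ereal_inf_adherent e0 Bfin.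
have {}Dm : (\esum_(k in D) (box_volume (b k).1 (b k).2)%:E <= (m + e)%:E)%E.
  by rewrite EFinD -Bm; exact: ltW Dm.
(* The boxes are half-open, so moving the lower corner down by the side lengths is enough to make
   their points interior. *)
pose c k : 'rV[R]_d := (b k).1 - ((b k).2 - (b k).1).
have cvol k : box_volume (c k) (b k).2 = 2 ^+ d * box_volume (b k).1 (b k).2.
  have -> : (2 : R) ^+ d = \prod_(i < d) 2 by rewrite prodr_const card_ord.
  rewrite /box_volume -big_split /=; apply: eq_bigr => i _; rewrite !mxE.
  by rewrite /Num.max; case: ltP => ?; case: ltP => ?; lra.
have Ecov : (\esum_(k in D) (box_volume (c k) (b k).2)%:E <= (2 ^+ d * (m + e))%:E)%E.
  rewrite esum_mkcond -nneseries_esumT; last first.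
    by move=> k; case: ifP => // _; rewrite lee_fin box_volume_ge0.
  rewrite esum_mkcond -nneseries_esumT in Dm; last first.
    by move=> k; case: ifP => // _; rewrite lee_fin box_volume_ge0.
  rewrite (eq_eseriesr (g := fun k => (2 ^+ d)%:E * (if k \in D then (box_volume (b k).1 (b k).2)%:E else 0))%E); last first.
    by move=> k _; case: ifP => _; rewrite ?mule0// -EFinM cvol.
  rewrite nneseriesZl; last first.
    by move=> k _; case: ifP => // _; rewrite lee_fin box_volume_ge0.
  by rewrite EFinM lee_wpmul2l// lee_fin exprn_ge0.
pose A := [set L : dyadic_index d | (exists2 x, B x & dset w L x) /\
  exists2 k, D k & dset w L `<=` box (c k) (b k).2].
have subV q : (forall L, q L -> A L) ->
    (leb (\bigcup_(L in q) dset w L) <= (2 ^+ d * (m + e))%:E)%E.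
  move=> qA; apply: le_trans Ecov; apply: ereal_inf_lbound.
  exists (D, fun k => (c k, (b k).2)) => //= x [L /qA[_ [k Dk Lk]] /Lk xk].
  by exists k.
have [N AN] : exists N, forall L, A L -> scale L <= N.
  have [N hN] := volume_scale_bound (2 ^+ d * (m + e)); exists N => L AL; apply: hN.
  rewrite -lee_fin -(leb_dset R w) -(bigcup_set1 (dset w) L).
  by apply: subV => _ ->.
exists (maximal_in R w A); split.
- exact: trivIset_maximal.
- move=> x Bx; have [k Dk xk] := BD _ Bx.
  have [r r0 rx] : exists2 r : R, 0 < r &
      forall i, c k 0 i + r <= (x : 'rV[R]_d) 0 i /\ (x : 'rV[R]_d) 0 i + r <= (b k).2 0 i.
    have [i|r r0 rg] := @finite_pos_lb R d (fun i => Num.min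
      ((x : 'rV[R]_d) 0 i - c k 0 i) ((b k).2 0 i - (x : 'rV[R]_d) 0 i)).
      by rewrite lt_min !mxE; have := xk i; lra.
    exists r => // i; have := rg i; rewrite le_min => /andP[]; lra.
  have [s sr] := pow2_below r0.
  have [L Ls Lx] := dyadic_at w s x.
  have AL : A L.
    split; first by exists x.
    exists k => // y /dsetE Ly i; have := Ly i.
    move/dsetE : Lx => /(_ i); have := rx i; rewrite /side Ls.
    rewrite -/(c k); lra.
  have [L' mL' LL'] := maximal_cover R w AN AL.
  by exists L' => //; exact: LL'.
- by move=> L [[]].
- by apply: subV => L [].
Qed.

(** Let [B] be the exceptional set. The cubes of [dyadic_cover] meet [A], so the integral of [|f|^p]
    over their union is at most [l^p] times its volume, that is [2^d l^p (|B| + e)] with [e]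
    arbitrary. Over [B] alone it is at least [(2^d + 1)^p l^p |B|], which forces [|B| = 0]. The
    summand 1 in the constant is what beats the loss [2^d] of the cover. *)
Lemma maximal_differentiation p f l (A : set (Rd R d)) : bcs f -> 1 <= p ->
  0 < l -> measurable A -> (forall x, A x -> (maximal p f x <= l%:E)%E) ->
  {ae mu, forall x, A x -> cmodulus (f x) <= (2 ^+ d + 1) * l}.
Proof.
move=> bf p1 l0 mA Al; have mf := bcs_cmeasurable bf.
have p0 : 0 < p by lra.
have lp0 : 0 < l `^ p by rewrite powR_gt0.
pose K : R := 2 ^+ d + 1.
have K1 : 1 <= K by rewrite lerDr exprn_ge0.
pose B := A `&` [set x | K * l < cmodulus (f x)].
have mB : measurable B.
  apply: measurableI; first exact: mA.
  have := measurable_fun_ltr (measurable_cst (K * l)) (measurable_cmodulus mf).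
  move=> /(_ measurableT [set true] I); rewrite setTI.
  by congr measurable.
exists B; split; [exact: mB| |]; last first.
  by move=> x /= /not_implyP[Ax /negP]; rewrite -ltNge.
have [Q Q0 fQ] := bcs_support bf.
have Bfin : mu B \is a fin_num.
  rewrite ge0_fin_numE//; apply: (@le_lt_trans _ _ (mu (cube_set Q))).
    apply: le_measure; rewrite ?inE; [exact: mB|exact: measurable_cube|].
    move=> x [_ /= fx]; apply: contrapT => /fQ fx0; move: fx.
    by rewrite fx0 cmodulus0 ltNge mulr_ge0 ?(ltW l0)//; lra.
  by rewrite (measure_cube (ltW Q0)) ltry.
pose m := fine (mu B); have mE : leb B = m%:E by rewrite /m fineK.
have m0 : 0 <= m by rewrite fine_ge0.
suff : m <= 0 by move=> m0'; rewrite -[mu B]/(leb B) mE; congr EFin; lra.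
have dd : 0 < (2 : R) ^+ d by rewrite exprn_gt0.
apply/ler_addgt0Pr => e e0; rewrite add0r.
have e'0 : 0 < e / 2 ^+ d by rewrite divr_gt0.
have [q [tq Bq qB qm]] := dyadic_cover 0 mE e'0.
set V := \bigcup_(L in q) _ in Bq qm.
have mV : measurable V by apply: measurable_countable_bigcup => L _; exact: measurable_dset.
have h1 : (pint mu p f V <= (l `^ p)%:E * mu V)%E.
  rewrite -integral_cst//; apply: le_integral_countable_bigcup.
  - by move=> L _; exact: measurable_dset.
  - exact: tq.
  - exact: measurable_cmodulus_pow.
  - exact: measurable_cst.
  - by move=> x; rewrite lee_fin powR_ge0.
  - by move=> x; rewrite lee_fin powR_ge0.
  - move=> L /qB[x [Ax _] Lx]; rewrite integral_cst; last exact: measurable_dset.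
    have := (maximal_le f x p1 (ltW l0)).1 (Al x Ax) (dyadic_cube R 0 L).
    move=> /(_ (side_gt0 R L) Lx) h; apply: (le_trans h).
    by rewrite EFinM measure_dset.
have h2 : (((K * l) `^ p * m)%:E <= pint mu p f B)%E.
  rewrite EFinM -mE -[leb B]/(mu B) -integral_cst; last exact: mB.
  apply: ge0_le_integral.
  - exact: mB.
  - by move=> x _; rewrite lee_fin powR_ge0.
  - exact: measurable_cst.
  - exact: measurable_cmodulus_powS.
  - move=> x [_ /= /ltW fx]; rewrite lee_fin ge0_ler_powR ?nnegrE ?cmodulus_ge0//.
      exact: ltW.
    by rewrite mulr_ge0// ?(ltW l0)//; lra.
have h3 : (pint mu p f B <= pint mu p f V)%E by apply: pint_subset.
have : (((K * l) `^ p * m)%:E <= (l `^ p * (2 ^+ d * (m + e / 2 ^+ d)))%:E)%E.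
  apply: (le_trans h2); apply: (le_trans h3); apply: (le_trans h1).
  by rewrite [leRHS]EFinM; apply: lee_wpmul2l; [rewrite lee_fin ltW|exact: qm].
rewrite lee_fin powRM ?(ltW l0)//; last by lra.
rewrite [_ `^ p * _ * _]mulrAC [leRHS]mulrC ler_pM2r// mulrDr [_ * (e / _)]mulrC divfK ?gt_eqF//.
have : K <= K `^ p by rewrite -[leLHS]powRr1 ?ler_powR//; lra.
rewrite /K in K1 *; nra.
Qed.

End weak_type.

(** * Stopping collections *)

Section stopping.
Context (R : realType) (d : nat).
Hypothesis d0 : (0 < d)%N.
Implicit Types (f : Rd R d -> R[i]) (p l : R).
Local Notation mu := (@leb R d).

(** Cubes are half-open, so a witnessing cube is first enlarged slightly on all sides; by continuity
    of the volume its average stays above [l], and it contains a neighbourhood of [x]. *)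
Lemma maximal_gt_open p f l (x : Rd R d) : cmeasurable f -> 1 <= p -> 0 < l ->
  ~ (maximal p f x <= l%:E)%E -> exists2 e : R, 0 < e & forall y : Rd R d,
    (forall i, `|(y : 'rV[R]_d) 0 i - (x : 'rV[R]_d) 0 i| < e) ->
    ~ (maximal p f y <= l%:E)%E.
Proof.
move=> mf p1 l0 /(maximal_le f x p1 (ltW l0))/existsNP[Q /not_implyP[Q0 /not_implyP[Qx]]].
move=> /negP; rewrite -ltNge => lt.
have lp0 : 0 < l `^ p by rewrite powR_gt0.
have [e e0 eQ] : exists2 e : R, 0 < e &
    ((l `^ p * (Q.2 + 2 * e) ^+ d)%:E < pint mu p f (cube_set Q))%E.
  have [v lv vI] : exists2 v : R, l `^ p * Q.2 ^+ d < v & (v%:E <= pint mu p f (cube_set Q))%E.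
    move: lt; case: (pint _ _ _ _) => [r| |]//; rewrite ?lte_fin => lt; first by exists r.
    by exists (l `^ p * Q.2 ^+ d + 1); rewrite ?ltrDl// leey.
  have Qv : Q.2 ^+ d < v / l `^ p by rewrite ltr_pdivlMr// mulrC.
  have /cvgr_lt/(_ _ Qv) := @exprn_continuous R d Q.2.
  move=> /nbhs_ballP[e /= e0 he]; exists (e / 4); first by rewrite divr_gt0.
  apply: lt_le_trans vI; rewrite lte_fin mulrC -ltr_pdivlMr//; apply: he.
  by rewrite /ball /= ltr_norml; lra.
exists e => // y yx /(maximal_le f y p1 (ltW l0)) h.
pose Q' : cube R d := (Q.1 - const_mx e, Q.2 + 2 * e).
have Q'0 : 0 < Q'.2 by rewrite /Q' /=; lra.
have Q'y : cube_set Q' y.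
  apply/cube_setE => i; rewrite !mxE /=; move/cube_setE : Qx => /(_ i).
  by have := yx i; rewrite ltr_norml; lra.
have := h Q' Q'0 Q'y; apply/negP; rewrite -ltNge; apply: (lt_le_trans eQ).
apply: pint_subset; [exact: measurable_cube|exact: measurable_cube|exact: mf|].
move=> z /cube_setE Qz; apply/cube_setE => i; rewrite !mxE /=.
by have := Qz i; lra.
Qed.

(** The measure bound keeps the selected cubes 5 scales below [Q], so the parent [P] of a selected
    [L] still competes in the selection. By maximality [9P] contains a point of [3Q] outside [E].
    This point lies in [32L], which gives the last conclusion, and it also prevents neighbours of
    very different size. Finally, if [3L] meets [2Q], then [9L] lies in [3Q], hence in [E], hence in
    the shadow. *)
Lemma stopping_collection_of_open w (Q : dyadic_index d) (E U : set (Rd R d)) :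
  (forall x, E x -> exists2 e : R, 0 < e & forall y : Rd R d,
    (forall i, `|(y : 'rV[R]_d) 0 i - (x : 'rV[R]_d) 0 i| < e) -> E y) ->
  measurable U -> E `<=` U -> (mu U <= ((side R Q / 32) ^+ d)%:E)%E ->
  exists q : set (dyadic_index d),
    [/\ stopping_collection R w Q q,
        forall x, dset_dilate w 3 Q x -> E x -> shadow w q x,
        shadow w q `<=` E,
        forall L, q L -> scale L <= scale Q - 5 &
        forall L, q L -> exists2 x, dset_dilate w (2 ^+ 5) L x & ~ E x].
Proof.
move=> Eopen mU EU muU.
pose A := [set L : dyadic_index d | [/\ scale L <= scale Q,
  dset (R := R) w L `<=` dset_dilate w 3 Q &
  forall x, dset_dilate w 9 L x -> dset_dilate w 3 Q x -> E x]].
have AN L : A L -> scale L <= scale Q by case.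
pose q := maximal_in R w A.
have dset9 L : dset (R := R) w L `<=` dset_dilate w 9 L.
  rewrite -dset_dilate1; apply: dset_dilate_subset => i.
  by have := side_gt0 R L; lra.
have qE L : q L -> dset w L `<=` E.
  by move=> [[_ L3 L9] _] x Lx; apply: L9; [exact: dset9|exact: L3].
have qscale L : q L -> scale L <= scale Q - 5.
  (* [L] lies in [E], so its volume is at most that of a cube of side [side R Q / 32], and
     [32 = 2 ^ 5]. *)
  move=> qL; rewrite -(ler_pow2 R) -[leLHS]/(side R L).
  have -> : 2 ^ (scale Q - 5) = side R Q / 32.
    have -> : side R Q = 2 ^ (scale Q - 5) * 2 ^+ 5 by rewrite -pow2D /side; congr (_ ^ _); lia.
    by rewrite -[32]/((2 ^ 5)%N%:R) natrX mulfK// expf_neq0.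
  have sQ : 0 <= side R Q / 32 by rewrite divr_ge0// ltW// side_gt0.
  rewrite -(@ler_pXn2r _ d d0) ?nnegrE ?(ltW (side_gt0 _ _))//.
  rewrite -lee_fin -(leb_dset R w); apply: le_trans muU; apply: le_measure; rewrite ?inE.
  - exact: measurable_dset.
  - exact: mU.
  - by move=> x /(qE _ qL)/EU.
have side5 L : q L -> 32 * side R L <= side R Q.
  move=> /qscale sL; rewrite /side; have := @pow2_add_le R (scale L) (scale Q) 5.
  have -> : (2 : R) ^+ 5 = 32 by rewrite -natrX.
  by apply; lia.
have parent3 L P : q L -> scale P = scale L + 1 -> dset (R := R) w L `<=` dset w P ->
    scale P <= scale Q /\ dset (R := R) w P `<=` dset_dilate w 3 Q.
  move=> qL sP LP; have sPQ : scale P <= scale Q by rewrite sP; have := qscale _ qL; lia.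
  split=> //; have [x Lx] := dset_nonempty R w L.
  apply: (dset_subset_dilate3 sPQ (LP _ Lx)).
  by case: qL => -[_ L3 _] _; exact: L3.
have parent_bad L P : q L -> scale P = scale L + 1 -> dset (R := R) w L `<=` dset w P ->
    exists x, [/\ dset_dilate w 9 P x, dset_dilate w 3 Q x & ~ E x].
  move=> qL sP LP; have [sPQ P3] := parent3 _ _ qL sP LP.
  apply: contrapT => no; case: (qL) => _ /(_ P) maxL.
  have : scale P <= scale L.
    apply: maxL => //; split=> // x P9 Q3; apply: contrapT => Ex; apply: no.
    by exists x.
  by rewrite sP; lia.
have side_parent L P : scale P = scale L + 1 -> side R P = 2 * side R L.
  by move=> sP; rewrite /side sP (pow2D R (scale L) 1) expr1 mulrC.
have Eshadow x : dset_dilate w 3 Q x -> E x -> shadow w q x.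
  move=> Qx Ex; have [e e0 eE] := Eopen x Ex.
  (* [9L] stays within 5 side lengths of every point of [L], so it remains in the neighbourhood of
     [x] contained in [E]. *)
  have e'0 : 0 < Num.min (e / 5) (side R Q) by rewrite lt_min divr_gt0// side_gt0.
  have [k] := pow2_below e'0; rewrite le_min => /andP[ke kQ].
  have {}kQ : k <= scale Q by rewrite -(ler_pow2 R).
  have [L Lk Lx] := dyadic_at w k x.
  have sL : side R L <= e / 5 by rewrite /side Lk.
  have AL : A L.
    split; [by rewrite Lk|by apply: dset_subset_dilate3 Lx Qx; rewrite Lk|].
    move=> y /dset_dilateE Ly _; apply: eE => i; rewrite ltr_norml.
    by move/dsetE : Lx => /(_ i); have := Ly i; lra.
  have [L' mL' LL'] := maximal_cover R w AN AL.
  by exists L' => //; exact: LL'.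
have far L L' : q L -> q L' -> dset_dilate (R := R) w 3 L `&` dset_dilate w 3 L' !=set0 ->
    scale L - 8 <= scale L'.
  move=> qL qL' [z [/dset_dilateE Lz /dset_dilateE L'z]].
  rewrite leNgt; apply/negP => far.
  (* A gap of 9 scales would put [9P], for the parent [P] of [L'], inside [9L]; but [9P] contains a
     point of [3Q] outside [E]. *)
  have [P sP L'P] := dyadic_parent R w L'.
  have [x [P9 Q3 Ex]] := parent_bad _ _ qL' sP L'P; apply: Ex.
  case: (qL) => -[_ _ L9] _; apply: L9 => //; apply: dset_dilate_subset P9 => i.
  have := (dset_subset R w L' P).1 L'P i; have := Lz i; have := L'z i.
  rewrite (side_parent _ _ _ _ sP).
  have : 2 ^+ 9 * side R L' <= side R L by apply: pow2_add_le; lia.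
  have -> : (2 : R) ^+ 9 = 512 by rewrite -natrX.
  by have := side_gt0 R L'; lra.
exists q; split.
- split.
  + exact: trivIset_maximal.
  + by move=> L [[]].
  + move=> y [L [qL [z [/dset_dilateE Lz /dset_dilateE Qz]]] L9y].
    have Q3y : dset_dilate w 3 Q y.
      apply/dset_dilateE => i; move/dset_dilateE : L9y => /(_ i).
      have := Lz i; have := Qz i; have := side5 _ qL; have := side_gt0 R L; lra.
    apply: (Eshadow _ Q3y); case: qL => -[_ _ L9] _; exact: L9.
  + by move=> x [L [[_ L3 _] _] /L3].
  + move=> L L' qL [qL' LL']; rewrite ler_norml.
    have := far _ _ qL qL' LL'; have := far _ _ qL' qL.
    rewrite setIC => /(_ LL'); lia.
- exact: Eshadow.
- by move=> x [L qL /(qE _ qL)].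
- exact: qscale.
- move=> L qL; have [P sP LP] := dyadic_parent R w L.
  have [x [P9 _ Ex]] := parent_bad _ _ qL sP LP; exists x => //.
  apply: dset_dilate_subset P9 => i.
  have := (dset_subset R w L P).1 LP i; rewrite (side_parent _ _ _ _ sP).
  have -> : (2 : R) ^+ 5 = 32 by rewrite -natrX.
  by have := side_gt0 R L; lra.
Qed.

End stopping.

(** * Pairings *)

Section kernel_measurability.
Context (R : realType) d1 d2 (T1 : measurableType d1) (T2 : measurableType d2).
Variable m2 : {sigma_finite_measure set T2 -> \bar R}.

(** Tonelli for the positive and negative parts; [fine] then sends infinite values of the difference
    to 0. *)
Lemma measurable_Rintegral_snd (h : T1 * T2 -> R) : measurable_fun [set: T1 * T2] h ->
  measurable_fun [set: T1] (fun x => \int[m2]_y h (x, y)).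
Proof.
move=> mh.
have mE : measurable_fun setT (EFin \o h) by exact/measurable_EFinP.
have mp := measurable_funepos mE; have mn := measurable_funeneg mE.
apply: (measurableT_comp (@fine_measurable _ _ measurableT)) => //.
rewrite (_ : (fun x => _) = (fun x => fubini_F m2 ((EFin \o h)^\+)%E x -
  fubini_F m2 ((EFin \o h)^\-)%E x)%E); last first.
  apply/funext => x; rewrite [LHS]integralE; congr (_ - _)%E;
    by apply: eq_integral => y _; rewrite ?funeposE ?funenegE.
apply: emeasurable_funB.
  by apply: measurable_fun_fubini_tonelli_F.
by apply: measurable_fun_fubini_tonelli_F.
Qed.

Lemma cmeasurable_slice (h : T1 * T2 -> R[i]) x : cmeasurable h ->
  cmeasurable (fun y => h (x, y)).
Proof.
by move=> [h1 h2]; split; [apply: (measurableT_comp h1)|apply: (measurableT_comp h2)];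
  exact: pair1_measurable.
Qed.

Lemma cmeasurable_kernel_mul (h : T1 * T2 -> R[i]) (f : T2 -> R[i]) :
  cmeasurable h -> cmeasurable f -> cmeasurable (fun z => h z * f z.2).
Proof.
move=> mh [f1 f2]; apply: cmeasurableM => //; split.
  by apply: (measurableT_comp f1); exact: measurable_snd.
by apply: (measurableT_comp f2); exact: measurable_snd.
Qed.

Lemma cmeasurable_kernel_integral (h : T1 * T2 -> R[i]) (f : T2 -> R[i]) :
  cmeasurable h -> cmeasurable f ->
  cmeasurable (fun x => cint m2 (fun y => h (x, y) * f y)).
Proof.
move=> mh mf; have [h1 h2] := cmeasurable_kernel_mul mh mf; split => /=.
  exact: (measurable_Rintegral_snd h1).
exact: (measurable_Rintegral_snd h2).
Qed.

End kernel_measurability.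

Fact bmf_key : unit. Proof. exact: tt. Qed.

(** The class of first arguments of pairings: it contains all truncations of integrable functions.
    Locked like [bcs]. *)
Definition bmf (R : realType) (d : nat) (f : Rd R d -> R[i]) : Prop :=
  locked_with bmf_key (cmeasurable f /\ exists M, forall x, cmodulus (f x) <= M).

Section pairing.
Context (R : realType) (d : nat).
Implicit Types (f g F G : Rd R d -> R[i]).
Local Notation mu := (@leb R d).

Lemma bmfP f : bmf f <-> cmeasurable f /\ exists M, forall x, cmodulus (f x) <= M.
Proof. by rewrite /bmf unlock. Qed.

Lemma bmfD f g : bmf f -> bmf g -> bmf (fun x => f x + g x).
Proof.
move=> /bmfP[mf [M fM]] /bmfP[mg [M' gM]]; apply/bmfP; split; first exact: cmeasurableD.
by exists (M + M') => x; rewrite (le_trans (cmodulusD _ _))// lerD.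
Qed.

Lemma bmfM f g : bmf f -> bmf g -> bmf (fun x => f x * g x).
Proof.
move=> /bmfP[mf [M fM]] /bmfP[mg [M' gM]]; apply/bmfP; split; first exact: cmeasurableM.
exists (M * M') => x; rewrite cmodulusM.
exact: (ler_pM (cmodulus_ge0 _) (cmodulus_ge0 _) (fM x) (gM x)).
Qed.

Lemma bmf_cst (c : R[i]) : bmf (fun _ : Rd R d => c).
Proof. by apply/bmfP; split; [exact: cmeasurable_cst|exists (cmodulus c)]. Qed.

Lemma bmf_indic (A : set (Rd R d)) : measurable A ->
  bmf (fun x => ((\1_A x : R)%:C)%C).
Proof.
move=> mA; apply/bmfP; split; first by apply: cmeasurable_real; exact: measurable_indic.
by exists 1 => x; rewrite cmodulusC indicE; case: (x \in A); rewrite ?normr1 ?normr0//.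
Qed.

Lemma bmf_sum I (s : seq I) (F : I -> Rd R d -> R[i]) : (forall i, bmf (F i)) ->
  bmf (fun x => \sum_(i <- s) F i x).
Proof.
move=> bF; elim: s => [|i s IH].
  by under eq_fun do rewrite big_nil; exact: bmf_cst.
by under eq_fun do rewrite big_cons; exact: bmfD.
Qed.

Lemma conjcD (z1 z2 : R[i]) : conjc (z1 + z2) = conjc z1 + conjc z2.
Proof. by rewrite rmorphD. Qed.

Lemma pairing_integrable F g : bmf F -> bcs g ->
  cintegrable mu (fun x => F x * conjc (g x)).
Proof.
move=> /bmfP[mF [M FM]] bg.
have bg' : cintegrable mu (fun x => conjc (g x)).
  split; first exact: cmeasurable_conj (bcs_cmeasurable bg).
  have := (bcs_cintegrable bg).2; congr (_ < _)%E.
  by apply: eq_integral => x _; rewrite cmodulus_conj.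
exact: cintegrable_bounded_mul bg' mF FM.
Qed.

Lemma pairingDl F G g : bmf F -> bmf G -> bcs g ->
  pairing (fun x => F x + G x) g = pairing F g + pairing G g.
Proof.
move=> bF bG bg; rewrite -[RHS](@cintD _ _ _ mu); try exact: pairing_integrable.
by congr cintegral; apply/funext => x; rewrite mulrDl.
Qed.

Lemma pairingDr F f g : bmf F -> bcs f -> bcs g ->
  pairing F (fun x => f x + g x) = pairing F f + pairing F g.
Proof.
move=> bF bf bg; rewrite -[RHS](@cintD _ _ _ mu); try exact: pairing_integrable.
by congr cintegral; apply/funext => x; rewrite conjcD mulrDr.
Qed.

Lemma conjcM_real (c : R) (z : R[i]) : conjc ((c%:C)%C * z) = (c%:C)%C * conjc z.
Proof. by case: z => a b; simpc. Qed.

Lemma pairingZl (c : R) F g : bmf F -> bcs g ->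
  pairing (fun x => (c%:C)%C * F x) g = (c%:C)%C * pairing F g.
Proof.
move=> bF bg; rewrite -[RHS](@cintZ _ _ _ mu); last exact: pairing_integrable.
by congr cintegral; apply/funext => x; rewrite mulrA.
Qed.

Lemma pairingZr (c : R) F g : bmf F -> bcs g ->
  pairing F (fun x => (c%:C)%C * g x) = (c%:C)%C * pairing F g.
Proof.
move=> bF bg; rewrite -[RHS](@cintZ _ _ _ mu); last exact: pairing_integrable.
by congr cintegral; apply/funext => x; rewrite conjcM_real mulrCA.
Qed.

Lemma pairing0l g : pairing (fun=> 0) g = 0.
Proof.
by rewrite /pairing -[RHS](@cint0 _ _ _ mu); congr cintegral; apply/funext => x; rewrite mul0r.
Qed.

Lemma pairing_cutoff F g (A : set (Rd R d)) : (forall x, ~ A x -> F x = 0) ->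
  pairing F (cutoff A g) = pairing F g.
Proof.
move=> FA; congr cintegral; apply/funext => x.
have [Ax|Ax] := pselect (A x); first by rewrite cutoff_in.
by rewrite FA// !mul0r.
Qed.

Lemma cmodulus_pairing_le F g : cmeasurable F -> bcs g ->
  ((cmodulus (pairing F g))%:E <=
   2%:E * \int[mu]_x (cmodulus (F x) * cmodulus (g x))%:E)%E.
Proof.
move=> mF bg; have mg := bcs_cmeasurable bg.
have mFg : cmeasurable (fun x => F x * conjc (g x)).
  exact: cmeasurableM mF (cmeasurable_conj mg).
apply: (le_trans (cmodulus_cint_le mu mFg)); rewrite le_eqVlt; apply/orP; left.
by apply/eqP; congr (_ * _)%E; apply: eq_integral => x _; rewrite cmodulusM cmodulus_conj.
Qed.

End pairing.

(** * Calderon-Zygmund decomposition *)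

Section Yspaces.
Context (R : realType) (d : nat).
Hypothesis d0 : (0 < d)%N.
Implicit Types (f g h b : Rd R d -> R[i]) (p l c : R).
Local Notation mu := (@leb R d).

(** [Lnorm] at [+oo] is the essential supremum only on a space of positive measure, and is 0
    otherwise. *)
Lemma leb_setT_gt0 : (0 < mu setT)%E.
Proof.
pose Q : cube R d := (0, 1).
apply: (@lt_le_trans _ _ (mu (cube_set Q))).
  by rewrite measure_cube//= lte_fin exprn_gt0.
by apply: le_measure; rewrite ?inE; [exact: measurable_cube|exact: measurableT|exact: subsetT].
Qed.

Lemma norm_Loo_scale c f : 0 < c ->
  norm_L +oo (fun x => (c%:C)%C * f x) = (c%:E * norm_L +oo f)%E.
Proof.
move=> c0; rewrite /norm_L Lnorm.unlock /=; case: ifPn => _; last by rewrite mule0.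
rewrite -ess_sup_pZl//; congr ess_sup; apply/funext => x /=.
by rewrite -EFinM cmodulusM cmodulusC normrM normr_id (gtr0_norm c0).
Qed.

Lemma pint_scale p c f A : 0 < c -> measurable A -> cmeasurable f ->
  pint mu p (fun x => (c%:C)%C * f x) A = ((c `^ p)%:E * pint mu p f A)%E.
Proof.
move=> c0 mA mf; rewrite /pint -ge0_integralZl_EFin; last 4 first.
- exact: mA.
- by move=> x _; rewrite lee_fin powR_ge0.
- exact: measurable_cmodulus_powS.
- exact: powR_ge0.
apply: eq_integral => x _; rewrite -EFinM cmodulusM cmodulusC ger0_norm ?(ltW c0)//.
by rewrite powRM ?(ltW c0)// cmodulus_ge0.
Qed.

Lemma cutoff_scale (A : set (Rd R d)) c f :
  cutoff A (fun x => (c%:C)%C * f x) = (fun x => (c%:C)%C * cutoff A f x).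
Proof. by apply/funext => x; rewrite /cutoff mulrCA. Qed.

Lemma average_scale p c f Q : 1 <= p -> 0 < c -> cmeasurable f ->
  average p (fun x => (c%:C)%C * f x) Q = (c%:E * average p f Q)%E.
Proof.
move=> p1 c0 mf; have p0 : 0 < p by lra.
have pn0 : p != 0 by rewrite gt_eqF.
rewrite /average /norm_L !Lnorm_pint// !pint_cutoff// pint_scale//; last exact: measurable_cube.
rewrite poweRM ?lee_fin ?powR_ge0 ?pint_ge0// poweR_EFin -powRrM mulfV// powRr1 ?(ltW c0)//.
by rewrite muleCA.
Qed.

Lemma maximal_scale p c f x : 1 <= p -> 0 < c -> cmeasurable f ->
  maximal p (fun x => (c%:C)%C * f x) x = (c%:E * maximal p f x)%E.
Proof.
move=> p1 c0 mf; rewrite /maximal -ereal_sup_pZl//; congr ereal_sup.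
apply/seteqP; split=> _ [Q Qx <-].
  by exists (average p f Q); [exists Q|rewrite average_scale].
by case: Qx => Q' Qx <-; exists Q' => //; rewrite average_scale.
Qed.

Section Ynorm.
Variables (w : 'rV['I_3]_d) (Q : dyadic_index d) (q : set (dyadic_index d)).

(** The localized constant tests functions of norm exactly 1, so every function of positive norm is
    normalized before it is used. *)
Lemma Ynorm_scale p c f : 1 <= p -> 0 < c -> cmeasurable f ->
  Ynorm w p%:E q (fun x => (c%:C)%C * f x) = (c%:E * Ynorm w p%:E q f)%E.
Proof.
move=> p1 c0 mf; rewrite /Ynorm cutoff_scale norm_Loo_scale// maxe_pMr ?lee_fin ?(ltW c0)//.
congr maxe; rewrite -ereal_sup_pZl//; congr ereal_sup.
have E L : ereal_inf [set maximal p (fun x => (c%:C)%C * f x) x | x in dset_dilate w (2 ^+ 5) L] =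
    (c%:E * ereal_inf [set maximal p f x | x in dset_dilate w (2 ^+ 5) L])%E.
  rewrite -ereal_inf_pZl//; congr ereal_inf; apply/seteqP; split=> _ [x Lx <-].
    by exists (maximal p f x); [exists x|rewrite maximal_scale].
  by case: Lx => y Ly <-; exists y => //; rewrite maximal_scale.
apply/seteqP; split=> _ [L Lq <-].
  by eexists; [exists L|rewrite E].
by case: Lq => L' qL' <-; exists L' => //; rewrite E.
Qed.

Lemma Ynormoo_scale c f : 0 < c ->
  Ynorm w +oo q (fun x => (c%:C)%C * f x) = (c%:E * Ynorm w +oo q f)%E.
Proof. exact: norm_Loo_scale. Qed.

Lemma supported_in_scale c f (A : set (Rd R d)) : supported_in f A ->
  supported_in (fun x => (c%:C)%C * f x) A.
Proof. by move=> fA x; rewrite mulf_eq0 negb_or => /andP[_ /fA]. Qed.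

Lemma in_Y_scale p c f : 1 <= p -> 0 < c -> bcs f -> in_Y w p%:E Q q f ->
  in_Y w p%:E Q q (fun x => (c%:C)%C * f x).
Proof.
move=> p1 c0 bf [_ f3 fY]; split.
- by apply: bcs_in_L => //; exact: bcsZ.
- exact: supported_in_scale.
- rewrite (Ynorm_scale p1 c0 (bcs_cmeasurable bf)).
  by rewrite lte_mul_pinfty// lee_fin ltW.
Qed.

Lemma in_Yoo_scale c f : 0 < c -> bcs f -> in_Y w +oo Q q f ->
  in_Y w +oo Q q (fun x => (c%:C)%C * f x).
Proof.
move=> c0 bf [_ f3 fY]; split.
- by apply: bcs_in_Loo; exact: bcsZ.
- exact: supported_in_scale.
- by rewrite Ynormoo_scale// lte_mul_pinfty// lee_fin ltW.
Qed.

(** The decomposition of [in_Xdot] with components that are also integrable, so that their means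
    scale. *)
Definition cancellative b : Prop := exists b_ : dyadic_index d -> Rd R d -> R[i],
  [/\ forall L, q L -> bcs (b_ L), forall L, q L -> supported_in (b_ L) (dset w L),
      forall L, q L -> cintegral (b_ L) = 0 &
      b = (fun x => \sum_(L \in q) b_ L x)].

Lemma in_Xdot_scale p c b : 1 <= p -> 0 < c -> bcs b -> cancellative b ->
  in_Y w p%:E Q q b -> in_Xdot w p%:E Q q (fun x => (c%:C)%C * b x).
Proof.
move=> p1 c0 bb [b_ [b1 b2 b3 b4]] bY; split; first exact: in_Y_scale.
exists (fun L x => (c%:C)%C * b_ L x); split.
- by move=> L qL; apply: supported_in_scale; exact: b2.
- move=> L qL; rewrite -[cintegral _]/(cint mu _) cintZ; last exact/bcs_cintegrable/b1.
  by rewrite -[cint mu _]/(cintegral _) b3// mulr0.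
- by rewrite {1}b4; apply/funext => x; rewrite mulr_fsumr.
Qed.

Lemma Ynorm_le p f l : 1 <= p -> 0 <= l ->
  {ae mu, forall x, ~ shadow w q x -> cmodulus (f x) <= l} ->
  (forall L, q L -> exists2 x, dset_dilate w (2 ^+ 5) L x & (maximal p f x <= l%:E)%E) ->
  (Ynorm w p%:E q f <= l%:E)%E.
Proof.
move=> p1 l0 off on; rewrite /Ynorm ge_max; apply/andP; split.
  apply: norm_Loo_le => //; apply: filterS off => x fx.
  have [sx|sx] := pselect (shadow w q x); last by rewrite cutoff_in//; exact: fx.
  by rewrite cutoff_out ?cmodulus0// => /(_ sx).
apply: ge_ereal_sup => _ [L qL <-]; have [x Lx fx] := on L qL.
by apply: le_trans fx; apply: ereal_inf_lbound; exists x.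
Qed.

(** The cube [32L] contains [x], so its average is at most [l]. The level [l] in [pint1_le] yields
    [l |L|] plus [l^(1-p) l^p |32L|], whence the factor [1 + 32 ^ d]. *)
Lemma integral_dset_le p f l L x : 1 <= p -> 0 < l -> cmeasurable f ->
  dset_dilate w (2 ^+ 5) L x -> (maximal p f x <= l%:E)%E ->
  (\int[mu]_(y in dset w L) (cmodulus (f y))%:E <=
   ((1 + 32 ^+ d) * l * side R L ^+ d)%:E)%E.
Proof.
move=> p1 l0 mf Lx fx; have lp0 : 0 < l `^ p by rewrite powR_gt0.
have e32 : (2 : R) ^+ 5 = 32 by rewrite -natrX.
have h : (pint mu p f (dset_dilate w (2 ^+ 5) L) <= (l `^ p * (32 * side R L) ^+ d)%:E)%E.
  have := (maximal_le f x p1 (ltW l0)).1 fx _ _ Lx; rewrite /= e32; apply.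
  by rewrite mulr_gt0// side_gt0.
apply: le_trans (pint1_le mu (measurable_dset w L) mf p1 l0) _.
rewrite measure_dset.
apply: (@le_trans _ _ (l%:E * (side R L ^+ d)%:E +
   (l `^ (1 - p))%:E * (l `^ p * (32 * side R L) ^+ d)%:E)%E).
  rewrite leeD2l//; apply: lee_wpmul2l; first by rewrite lee_fin powR_ge0.
  apply: le_trans h; apply: pint_subset.
  - exact: measurable_dset.
  - exact: measurable_dset_dilate.
  - exact: mf.
  - rewrite -dset_dilate1; apply: dset_dilate_subset => i.
    by rewrite e32; have := side_gt0 R L; lra.
rewrite -!EFinM -EFinD lee_fin mulrA -powRD; last by rewrite (gt_eqF l0) implybT.
rewrite subrK powRr1 ?(ltW l0)// exprMn le_eqVlt; apply/orP; left; apply/eqP; ring.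
Qed.

Hypothesis tq : trivIset q (dset (R := R) w).

Lemma measurable_shadow : measurable (shadow (R := R) w q).
Proof. by apply: measurable_countable_bigcup => L _; exact: measurable_dset. Qed.

(** Handles the functions that cannot be normalized. Off the shadow the essential supremum is 0; in
    a cube [L] the infimum of the maximal function over [32L] is 0, and [integral_dset_le] at
    arbitrarily small levels makes the integral over [L] vanish. *)
Lemma Ynorm0_norm1 p f : 1 <= p -> bcs f -> (Ynorm w p%:E q f <= 0)%E ->
  norm1 mu f = 0%E.
Proof.
move=> p1 bf; have mf := bcs_cmeasurable bf.
have mS := measurable_shadow; have mS' := measurableC mS.
rewrite /Ynorm ge_max => /andP[off on].
have fE : f = (fun x => cutoff (shadow w q) f x + cutoff (~` shadow w q) f x).
  apply/funext => x; have [sx|sx] := pselect (shadow w q x).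
    by rewrite cutoff_in// cutoff_out ?addr0// => /(_ sx).
  by rewrite cutoff_out// cutoff_in ?add0r.
apply/eqP; rewrite eq_le norm1_ge0 andbT fE.
apply: le_trans (norm1D _ (cmeasurable_cutoff mS mf) (cmeasurable_cutoff mS' mf)) _.
rewrite -[leRHS]adde0; apply: leeD; last first.
  move: off; rewrite /norm_L Lnorm.unlock /= leb_setT_gt0 => /ess_supP off.
  rewrite /norm1; apply: (@le_trans _ _ (\int[mu]_x (cst 0%E x))%E); last by rewrite integral0.
  apply: ae_ge0_le_integral.
  - exact: measurableT.
  - by move=> x _; rewrite lee_fin cmodulus_ge0.
  - exact: measurable_cmodulusE (cmeasurable_cutoff mS' mf).
  - by [].
  - exact: measurable_cst.
  - by apply: filterS off => x /= + _; rewrite ger0_norm// cmodulus_ge0.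
rewrite norm1_pint pint_cutoff ?oner_eq0//.
rewrite -[leRHS](@integral0 _ _ _ mu (shadow w q)).
apply: le_integral_countable_bigcup.
- by move=> L _; exact: measurable_dset.
- exact: tq.
- exact: measurable_cmodulus_pow.
- exact: measurable_cst.
- by move=> x; rewrite lee_fin powR_ge0.
- by [].
move=> L qL; rewrite integral0; apply/lee_addgt0Pr => e e0; rewrite add0e.
pose k := (1 + 32 ^+ d) * side R L ^+ d.
have k0 : 0 < k.
  by rewrite mulr_gt0 ?exprn_gt0 ?side_gt0// addr_gt0// exprn_gt0.
have ek0 : 0 < e / k by rewrite divr_gt0.
have : (ereal_inf [set maximal p f x | x in dset_dilate w (2 ^+ 5) L] < (e / k)%:E)%E.
  apply: (@le_lt_trans _ _ 0%E); last by rewrite lte_fin.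
  by apply: le_trans on; apply: ereal_sup_ubound; exists L.
move=> /ereal_inf_lt[_ [x Lx <-] /ltW fx].
have := integral_dset_le p1 ek0 mf Lx fx.
have -> : (1 + 32 ^+ d) * (e / k) * side R L ^+ d = e.
  by rewrite mulrAC -/k mulrC divfK ?gt_eqF.
apply: le_trans; apply: eqW.
by apply: eq_integral => y _; rewrite powRr1// cmodulus_ge0.
Qed.

(** * Good and bad parts along a stopping collection *)

Section calderon_zygmund.
Variables (h : Rd R d -> R[i]) (p l : R).
Hypothesis bh : bcs h.
Hypothesis h3 : forall x, ~ dset_dilate w 3 Q x -> h x = 0.
Hypothesis p1 : 1 <= p.
Hypothesis l0 : 0 < l.
Hypothesis q3 : shadow (R := R) w q `<=` dset_dilate w 3 Q.
Hypothesis hoff : forall x, dset_dilate w 3 Q x -> ~ shadow w q x ->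
  (maximal p h x <= l%:E)%E.
Hypothesis hon : forall L, q L ->
  exists2 x, dset_dilate w (2 ^+ 5) L x & (maximal p h x <= l%:E)%E.

Definition mean L : R[i] :=
  (((side R L ^+ d)^-1)%:C)%C * cintegral (cutoff (dset w L) h).

Definition bad_part L : Rd R d -> R[i] := cutoff (dset w L) (fun x => h x - mean L).

Definition bad : Rd R d -> R[i] := fun x => \sum_(L \in q) bad_part L x.

Definition good : Rd R d -> R[i] := fun x => h x - bad x.

(** The means are bounded by [2 (1 + 32 ^ d) l], the 2 being the loss of [cmodulus_cint_le]; the
    remaining 4 comes from [pint_perturb]. The result also exceeds the constant of
    [maximal_differentiation]. *)
Definition cz_constant : R := 8 * (1 + 32 ^+ d).

Lemma cz_constantP : [/\ 0 < cz_constant, 1 <= cz_constant,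
  2 ^+ d + 1 <= cz_constant & 4 * (2 * (1 + 32 ^+ d)) = cz_constant].
Proof.
have h1 : 1 <= (2 : R) ^+ d by rewrite exprn_ege1// ler1n.
have h2 : (2 : R) ^+ d <= 32 ^+ d by apply: lerXn2r; rewrite ?nnegrE//; lra.
by rewrite /cz_constant; split; lra.
Qed.

Lemma badE L x : q L -> dset w L x -> bad x = h x - mean L.
Proof.
move=> qL Lx; rewrite /bad -(@fsbig_widen _ _ _ _ [set L] q); last 2 first.
- by move=> _ ->.
- move=> L' [qL' /= L'L]; rewrite /bad_part cutoff_out// => L'x.
  by apply: L'L; apply: tq => //; exists x.
by rewrite fsbig_set1 /bad_part cutoff_in.
Qed.

Lemma bad_out x : ~ shadow w q x -> bad x = 0.
Proof.
move=> sx; rewrite /bad fsbig1// => L qL; rewrite /bad_part cutoff_out// => Lx.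
by apply: sx; exists L.
Qed.

Lemma cmodulus_mean L : q L -> cmodulus (mean L) <= 2 * (1 + 32 ^+ d) * l.
Proof.
move=> qL; have mh := bcs_cmeasurable bh; have [x Lx hx] := hon qL.
have v0 : 0 < side R L ^+ d by rewrite exprn_gt0// side_gt0.
rewrite /mean cmodulusM cmodulusC gtr0_norm ?invr_gt0// mulrC ler_pdivrMr//.
rewrite -lee_fin.
have mc := cmeasurable_cutoff (measurable_dset w L) mh.
apply: le_trans (cmodulus_cint_le mu mc) _.
have -> : (2 * (1 + 32 ^+ d) * l * side R L ^+ d)%:E =
    (2%:E * ((1 + 32 ^+ d) * l * side R L ^+ d)%:E)%E.
  by rewrite -EFinM; congr EFin; ring.
apply: lee_wpmul2l => //; apply: le_trans (integral_dset_le p1 l0 mh Lx hx).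
rewrite norm1_pint pint_cutoff ?oner_eq0// le_eqVlt; apply/orP; left; apply/eqP.
by apply: eq_integral => y _; rewrite powRr1// cmodulus_ge0.
Qed.

Lemma cmodulus_bad x : cmodulus (bad x) <= cmodulus (h x) + 2 * (1 + 32 ^+ d) * l.
Proof.
have [[L qL Lx]|sx] := pselect (shadow w q x).
  rewrite (badE qL Lx) (le_trans (cmodulusB _ _))// lerD2l; exact: cmodulus_mean.
rewrite (bad_out sx) cmodulus0 addr_ge0 ?cmodulus_ge0//.
by rewrite mulr_ge0 ?(ltW l0)// mulr_ge0// addr_ge0// exprn_ge0.
Qed.

Lemma cmeasurable_bad : cmeasurable bad.
Proof.
apply: (@cmeasurable_piecewise _ _ _ _ q (dset w) _ (fun L x => h x - mean L)).
- by move=> L _; exact: measurable_dset.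
- by move=> L; exact: cmeasurableB (bcs_cmeasurable bh) (cmeasurable_cst _ _).
- by move=> L x; exact: badE.
- exact: bad_out.
Qed.

Lemma bcs_in_dilate f : cmeasurable f -> (exists M, forall x, cmodulus (f x) <= M) ->
  (forall x, ~ dset_dilate w 3 Q x -> f x = 0) -> bcs f.
Proof.
move=> mf [M fM] f3; apply/bcsP; split; [exact: mf|by exists M|].
pose N := \sum_(i < d) `|corner R w Q i|.
exists (N + 3 * side R Q) => x fx i.
have : dset_dilate w 3 Q x by apply: contrapT => /f3 fx0; rewrite fx0 eqxx in fx.
move=> /dset_dilateE/(_ i).
have : `|corner R w Q i| <= N by rewrite /N (bigD1 i)//= lerDl sumr_ge0.
have := side_gt0 R Q; rewrite !ler_norml; lra.
Qed.

Lemma bcs_bad : bcs bad.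
Proof.
apply: bcs_in_dilate; first exact: cmeasurable_bad.
  have [M M0 hM] := bcs_bounded bh; exists (M + 2 * (1 + 32 ^+ d) * l) => x.
  by rewrite (le_trans (cmodulus_bad x))// lerD2r.
by move=> x Qx; apply: bad_out => /q3.
Qed.

Lemma bcs_good : bcs good.
Proof. exact: bcsB bh bcs_bad. Qed.

(** Since [|bad| <= |h| + 2 (1 + 32 ^ d) l] pointwise, every cube through the point of [32L] that is
    good for [h] also has a controlled average of [bad]. *)
Lemma Ynorm_bad : (Ynorm w p%:E q bad <= (cz_constant * l)%:E)%E.
Proof.
have [C0 C1 C2 C3] := cz_constantP.
apply: Ynorm_le => //; first by rewrite mulr_ge0 ?(ltW l0) ?(ltW C0).
  by apply: nearW => x sx; rewrite bad_out// cmodulus0 mulr_ge0 ?(ltW l0) ?(ltW C0).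
move=> L qL; have [x Lx hx] := hon qL; exists x => //.
apply/(maximal_le bad x p1); first by rewrite mulr_ge0 ?(ltW l0) ?(ltW C0).
move=> I I0 Ix; have hI := (maximal_le h x p1 (ltW l0)).1 hx I I0 Ix.
rewrite EFinM -(measure_cube (ltW I0)) -C3 -mulrA.
apply: (@pint_perturb _ _ _ mu p h bad _ l).
- exact: measurable_cube.
- exact: bcs_cmeasurable bh.
- exact: cmeasurable_bad.
- exact: p1.
- rewrite (ltW l0)/=; have : 1 <= (32 : R) ^+ d by rewrite exprn_ege1// ler1n.
  by have := l0; nra.
- by move=> y _; exact: cmodulus_bad.
- by rewrite (measure_cube (ltW I0)) -EFinM.
Qed.

Lemma in_Y_bad : in_Y w p%:E Q q bad.
Proof.
split; first exact: bcs_in_L bcs_bad.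
  move=> x bx; apply: contrapT => Qx; move: bx; rewrite bad_out ?eqxx//.
  by move=> /q3.
exact: le_lt_trans Ynorm_bad (ltry _).
Qed.

Lemma bcs_bad_part L : bcs (bad_part L).
Proof.
have -> : bad_part L = (fun x => cutoff (dset w L) h x - cutoff (dset w L) (fun=> mean L) x).
  by apply/funext => x; rewrite /bad_part /cutoff mulrBr.
apply: bcsB; first exact: bcs_cutoff (measurable_dset w L) bh.
apply/bcsP; split.
- exact: cmeasurable_cutoff (measurable_dset w L) (cmeasurable_cst _ _).
- by exists (cmodulus (mean L)) => x; exact: cmodulus_cutoff_le.
- exists (\sum_(i < d) `|corner R w L i| + side R L) => x cx i.
  have : dset w L x by apply: contrapT => Lx; rewrite cutoff_out// eqxx in cx.
  move=> /dsetE/(_ i).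
  have : `|corner R w L i| <= \sum_(i < d) `|corner R w L i| by rewrite (bigD1 i)//= lerDl sumr_ge0.
  have := side_gt0 R L; rewrite !ler_norml; lra.
Qed.

Lemma cancellative_bad : cancellative bad.
Proof.
exists bad_part; split=> [L _|L _ x bx|L qL|//]; first exact: bcs_bad_part.
  by apply: contrapT => Lx; move: bx; rewrite /bad_part cutoff_out// eqxx.
have v0 : 0 < side R L ^+ d by rewrite exprn_gt0// side_gt0.
have m0 : bcs (cutoff (dset w L) (fun=> mean L)).
  have -> : cutoff (dset w L) (fun=> mean L) =
      (fun x => cutoff (dset w L) h x - bad_part L x).
    by apply/funext => x; rewrite /bad_part /cutoff mulrBr opprB addrC subrK.
  by apply: bcsB; [exact: bcs_cutoff (measurable_dset w L) bh|exact: bcs_bad_part].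
have -> : bad_part L = (fun x => cutoff (dset w L) h x - cutoff (dset w L) (fun=> mean L) x).
  by apply/funext => x; rewrite /bad_part /cutoff mulrBr.
rewrite -[LHS]/(cint mu _) cintB; last 2 first.
- by apply: bcs_cintegrable; exact: bcs_cutoff (measurable_dset w L) bh.
- exact: bcs_cintegrable.
apply/eqP; rewrite subr_eq0; apply/eqP.
have int1 (c : R) : (\int[mu]_x ((\1_(dset w L) x : R) * c))%R = side R L ^+ d * c.
  rewrite RintegralZr; last 2 first.
  - exact: measurableT.
  - apply/integrableP; split; first by apply/measurable_EFinP; apply: measurable_indic; exact: measurable_dset.
    rewrite (eq_integral (fun x => (\1_(dset w L) x : R)%:E)).
      rewrite integral_indic; [|exact: measurableT|exact: measurable_dset].
      by rewrite setIT measure_dset ltry.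
    by move=> y _; rewrite gee0_abs// lee_fin.
  congr (_ * _); rewrite /Rintegral integral_indic; [|exact: measurableT|exact: measurable_dset].
  by rewrite setIT measure_dset.
rewrite [RHS](_ : _ = ((side R L ^+ d)%:C)%C * mean L); last first.
  rewrite realMz /cint -!int1; congr Complex; apply: eq_Rintegral => x _.
    by rewrite /cutoff realMz.
  by rewrite /cutoff realMz.
rewrite /mean mulrA -rmorphM mulfV ?gt_eqF// rmorph1 mul1r.
by [].
Qed.

(** The only place where the smallness of the maximal function off the shadow becomes a bound on the
    function itself. *)
Lemma ae_h : {ae mu, forall x, ~ shadow w q x -> cmodulus (h x) <= cz_constant * l}.
Proof.
have [C0 C1 C2 C3] := cz_constantP.
have mA : measurable (dset_dilate w 3 Q `&` ~` shadow (R := R) w q).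
  by apply: measurableI; [exact: measurable_dset_dilate|apply: measurableC; exact: measurable_shadow].
have := maximal_differentiation d0 bh p1 l0 mA (fun x Ax => hoff Ax.1 Ax.2).
apply: filterS => x hx sx.
have [Qx|Qx] := pselect (dset_dilate w 3 Q x); last first.
  by rewrite h3// cmodulus0 mulr_ge0 ?(ltW l0) ?(ltW C0).
by rewrite (le_trans (hx (conj Qx sx)))// ler_wpM2r// ltW.
Qed.

Lemma ae_good : {ae mu, forall x, cmodulus (good x) <= cz_constant * l}.
Proof.
have [C0 C1 C2 C3] := cz_constantP.
apply: filterS ae_h => x hx; have [[L qL Lx]|sx] := pselect (shadow w q x); last first.
  by rewrite /good bad_out// subr0; exact: hx.
rewrite /good (badE qL Lx) opprB addrC subrK (le_trans (cmodulus_mean qL))//.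
rewrite ler_wpM2r ?(ltW l0)// -C3 ler_peMl//; lra.
Qed.

Lemma in_Y_good : in_Y w +oo Q q good /\ (Ynorm w +oo q good <= (cz_constant * l)%:E)%E.
Proof.
have [C0 C1 C2 C3] := cz_constantP.
have Yg : (Ynorm w +oo q good <= (cz_constant * l)%:E)%E.
  by apply: norm_Loo_le ae_good; rewrite mulr_ge0 ?(ltW l0) ?(ltW C0).
split; last exact: Yg.
split; [exact: bcs_in_Loo bcs_good| |exact: le_lt_trans Yg (ltry _)].
move=> x gx; apply: contrapT => Qx; move: gx.
by rewrite /good h3// bad_out ?subrr ?eqxx// => /q3.
Qed.

Lemma in_Y_h : in_Y w p%:E Q q h /\ (Ynorm w p%:E q h <= (cz_constant * l)%:E)%E.
Proof.
have [C0 C1 C2 C3] := cz_constantP.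
have Cl : 0 <= cz_constant * l by rewrite mulr_ge0 ?(ltW l0) ?(ltW C0).
have Yh : (Ynorm w p%:E q h <= (cz_constant * l)%:E)%E.
  apply: Ynorm_le => //; first exact: ae_h.
  move=> L qL; have [x Lx hx] := hon qL; exists x => //; apply: le_trans hx _.
  by rewrite lee_fin ler_peMl// ltW.
split; last exact: Yh.
split; [exact: bcs_in_L bh| |exact: le_lt_trans Yh (ltry _)].
by move=> x hx; apply: contrapT => Qx; rewrite h3// eqxx in hx.
Qed.

End calderon_zygmund.
End Ynorm.
End Yspaces.

(** * Truncations and localized forms *)

Section disjoint_cubes.
Context (R : realType) (d : nat) (w : 'rV['I_3]_d).
Local Notation mu := (@leb R d).

Lemma sum_measureI_le (s : seq (dyadic_index d)) (V B : set (Rd R d)) : uniq s ->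
  trivIset [set` s] (dset (R := R) w) -> (forall L, L \in s -> dset w L `<=` B) ->
  measurable V -> measurable B -> (\sum_(L <- s) mu (V `&` dset w L) <= mu (V `&` B))%E.
Proof.
move=> us ts sB mV mB.
have ms L : measurable (V `&` dset (R := R) w L).
  by apply: measurableI mV _; exact: measurable_dset.
apply: (@le_trans _ _ (mu (\bigcup_(L in [set` s]) (V `&` dset w L)))); last first.
  apply: le_measure; rewrite ?inE; [|exact: measurableI|].
    by apply: measurable_countable_bigcup => L _; exact: ms.
  by move=> x [L Ls [Vx Lx]]; split=> //; exact: sB Lx.
rewrite measure_fin_bigcup//.
- by rewrite -fsbig_seq.
- exact: finite_seq.
- by apply: trivIset_setIl; exact: ts.
Qed.

Lemma sum_side_le (s : seq (dyadic_index d)) (B : set (Rd R d)) : uniq s ->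
  trivIset [set` s] (dset (R := R) w) -> (forall L, L \in s -> dset w L `<=` B) ->
  measurable B -> ((\sum_(L <- s) side R L ^+ d)%:E <= mu B)%E.
Proof.
move=> us ts sB mB; have := sum_measureI_le us ts sB measurableT mB.
rewrite setTI; apply: le_trans; rewrite -sumEFin; apply: lee_sum => L _.
by rewrite setTI -(leb_dset R w L).
Qed.

(* The cubes of [s] are the children of [Q] in the stopping-time tree. *)
Definition step_cover (F G : dyadic_index d -> R) (Q : dyadic_index d) : Prop :=
  exists s : seq (dyadic_index d), [/\ uniq s, trivIset [set` s] (dset (R := R) w),
    forall L, L \in s -> dset (R := R) w L `<=` dset w Q /\ scale L < scale Q,
    2 * \sum_(L <- s) side R L ^+ d <= side R Q ^+ d &
    F Q <= side R Q ^+ d * G Q + \sum_(L <- s) F L].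

Lemma step_cover_nil F G Q : F Q = 0 -> G Q = 0 -> step_cover F G Q.
Proof.
move=> F0 G0; exists [::]; split; [by []|by move=> i j|by move=> L| |].
  by rewrite big_nil mulr0 exprn_ge0// ltW// side_gt0.
by rewrite F0 G0 big_nil mulr0 addr0.
Qed.

(** Each cube has volume at least [(2 ^ n) ^ d], and the volumes add up to at most the measure of
    [B]. *)
Lemma finite_disjoint_cubes (q : set (dyadic_index d)) (B : set (Rd R d)) (n : int) :
  trivIset q (dset (R := R) w) -> (forall L, q L -> dset w L `<=` B) ->
  (forall L, q L -> n <= scale L) -> measurable B -> (mu B < +oo)%E -> finite_set q.
Proof.
move=> tq qB qn mB Boo; apply: contrapT => /infinite_set_fsetP inf.
pose c : R := (2 ^ n) ^+ d; have c0 : 0 < c by rewrite exprn_gt0// pow2_gt0.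
have [F Fq Fn] := inf (Num.bound (fine (mu B) / c)).
have Bfin : mu B \is a fin_num by rewrite ge0_fin_numE.
have := @sum_side_le (finmap.enum_fset F) B (finmap.fset_uniq F) _ _ mB.
have FqE L : L \in finmap.enum_fset F -> q L by move=> LF; exact: Fq.
move=> /(_ (sub_trivIset Fq tq) (fun L LF => qB L (FqE L LF))).
rewrite -(fineK Bfin) lee_fin leNgt => /negP; apply.
apply: (@lt_le_trans _ _ (\sum_(L <- finmap.enum_fset F) c)); last first.
  rewrite big_seq [leRHS]big_seq; apply: ler_sum => L LF.
  apply: lerXn2r; rewrite ?nnegrE ?(ltW (pow2_gt0 R n)) ?(ltW (side_gt0 R L))//.
  by rewrite ler_pow2; exact: qn (FqE _ LF).
rewrite big_const_seq count_predT iter_addr addr0 -mulr_natr.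
rewrite mulrC -ltr_pdivrMr//.
have := archi_boundP (divr_ge0 (fine_ge0 (measure_ge0 mu B)) (ltW c0)).
by move=> /lt_le_trans; apply; rewrite ler_nat.
Qed.

End disjoint_cubes.

Lemma lee_poweR (R : realType) (r : R) (x y : \bar R) : 0 <= r ->
  (0 <= x -> x <= y -> x `^ r <= y `^ r)%E.
Proof.
move=> r0 x0 xy; apply: gt0_ler_poweR; [exact: r0| | |exact: xy].
  by rewrite in_itv /= leey x0.
by rewrite in_itv /= leey (le_trans x0 xy).
Qed.

Section operators.
Context (R : realType) (d : nat).
Hypothesis d0 : (0 < d)%N.
Variable K : int -> Rd R d -> Rd R d -> R[i].
Hypothesis mK : forall s, cmeasurable (fun z : Rd R d * Rd R d => K s z.1 z.2).
Hypothesis suppK : forall s (x y : Rd R d), K s x y != 0 ->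
  euclid_norm ((x : 'rV[R]_d) - y) < 2 ^ s.
Hypothesis finK : (kernel_norm K < +oo)%E.
Implicit Types (f g : Rd R d -> R[i]).
Local Notation mu := (@leb R d).

(** Qualitative only: [C] depends on [s] and on the kernel norm, and serves integrability and
    boundedness but no final estimate. *)
Lemma kernel_bound s : exists2 C : R, 0 <= C &
  forall x, {ae mu, forall y, cmodulus (K s x y) <= C}.
Proof.
pose S := ereal_sup [set (norm_L +oo (K s x) + norm_L +oo (fun y => K s y x))%E
                    | x in [set: Rd R d]].
have KS x : (norm_L +oo (K s x) <= S)%E.
  apply: (@le_trans _ _ (norm_L +oo (K s x) + norm_L +oo (fun y => K s y x))%E).
    by rewrite leeDl// Lnorm_ge0.
  by apply: ereal_sup_ubound; exists x.
have S0 : (0 <= S)%E by apply: le_trans (KS 0); exact: Lnorm_ge0.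
have Sfin : S \is a fin_num.
  rewrite ge0_fin_numE// ltey; apply/eqP => Soo.
  have : (((2 : R) ^ (s * d%:Z))%:E * S <= kernel_norm K)%E.
    by apply: ereal_sup_ubound; exists s.
  rewrite Soo gt0_muley ?lte_fin ?pow2_gt0// leye_eq => /eqP h.
  by move: finK; rewrite h ltxx.
exists (fine S); first exact: fine_ge0.
move=> x; have := KS x; rewrite /norm_L Lnorm.unlock /= (leb_setT_gt0 R d).
move=> /ess_supP; apply: filterS => y /=.
by rewrite -{1}(fineK Sfin) lee_fin ger0_norm// cmodulus_ge0.
Qed.

Lemma cmeasurable_kernel s x : cmeasurable (K s x).
Proof. exact: (cmeasurable_slice x (mK s)). Qed.

Lemma norm1_kernel_mul s : exists2 C : R, 0 <= C & forall f x, cmeasurable f ->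
  (norm1 mu (fun y => (K s x y * f y)%R) <= C%:E * norm1 mu f)%E.
Proof.
have [C C0 KC] := kernel_bound s; exists C => // f x mf.
have mKf := cmeasurableM (cmeasurable_kernel s x) mf.
rewrite /norm1 -ge0_integralZl_EFin; last 4 first.
- exact: measurableT.
- by move=> y _; rewrite lee_fin cmodulus_ge0.
- exact: measurable_cmodulusE.
- exact: C0.
apply: ae_ge0_le_integral.
- exact: measurableT.
- by move=> y _; rewrite lee_fin cmodulus_ge0.
- exact: measurable_cmodulusE.
- by move=> y _; rewrite mule_ge0// lee_fin cmodulus_ge0.
- exact: (emeasurable_funM (measurable_cst _) (measurable_cmodulusE mf)).
apply: filterS (KC x) => y Ky _; rewrite -EFinM lee_fin cmodulusM.
by rewrite ler_wpM2r// cmodulus_ge0.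
Qed.

Lemma kernel_mul_integrable s f x : cintegrable mu f ->
  cintegrable mu (fun y => K s x y * f y).
Proof.
move=> [mf fo]; split; first exact: cmeasurableM (cmeasurable_kernel s x) mf.
have [C C0 h] := norm1_kernel_mul s; apply: le_lt_trans (h f x mf) _.
by rewrite lte_mul_pinfty// lee_fin.
Qed.

Definition kint s f (x : Rd R d) : R[i] := cintegral (fun y => K s x y * f y).

Lemma kintE s f x : kint s f x = cint mu (fun y => K s x y * f y).
Proof. by []. Qed.

Lemma kintD s f g x : cintegrable mu f -> cintegrable mu g ->
  kint s (fun y => f y + g y) x = kint s f x + kint s g x.
Proof.
move=> fi gi; rewrite !kintE -cintD; try exact: kernel_mul_integrable.
by congr cint; apply/funext => y; rewrite mulrDr.
Qed.

Lemma kintZ s (c : R) f x : cintegrable mu f ->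
  kint s (fun y => (c%:C)%C * f y) x = (c%:C)%C * kint s f x.
Proof.
move=> fi; rewrite !kintE -cintZ; last exact: kernel_mul_integrable.
by congr cint; apply/funext => y; rewrite mulrCA.
Qed.

Lemma kint_bmf s f : cintegrable mu f -> bmf (kint s f).
Proof.
move=> fi; apply/bmfP; split.
  by apply: (cmeasurable_kernel_integral mu (mK s)); exact: fi.1.
have [C C0 h] := norm1_kernel_mul s.
have fin : norm1 mu f \is a fin_num by rewrite ge0_fin_numE ?norm1_ge0//; exact: fi.2.
exists (2 * (C * fine (norm1 mu f))) => x.
rewrite -lee_fin EFinM [(C * _)%:E]EFinM fineK//.
apply: le_trans (cmodulus_cint_le mu (kernel_mul_integrable s x fi).1) _.
by apply: lee_wpmul2l => //; apply: h; exact: fi.1.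
Qed.

Lemma kint_null s f x : cmeasurable f -> norm1 mu f = 0%E -> kint s f x = 0.
Proof.
move=> mf f0; apply: (norm1_eq0_cint (mu := mu)).
  exact: cmeasurableM (cmeasurable_kernel s x) mf.
have [C C0 h] := norm1_kernel_mul s; have := h f x mf; rewrite f0 mule0 => le0.
by apply/eqP; rewrite eq_le le0 norm1_ge0.
Qed.

(* Scales [s <= s_L] move mass by less than the side length of [L]. *)
Lemma kint_support w (L : dyadic_index d) s f x : s <= scale L ->
  (forall y, ~ dset w L y -> f y = 0) -> ~ dset_dilate w 3 L x -> kint s f x = 0.
Proof.
move=> sL fL Lx; rewrite kintE -[RHS](cint0 mu); congr cint; apply/funext => y.
have [Ly|/fL ->] := pselect (dset w L y); last by rewrite mulr0.
have [->|/suppK Kxy] := eqVneq (K s x y) 0; first by rewrite mul0r.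
exfalso; apply: Lx; apply/dset_dilateE => i.
have {}Kxy : `|(x : 'rV[R]_d) 0 i - (y : 'rV[R]_d) 0 i| < side R L.
  apply: lt_le_trans (_ : 2 ^ s <= _); last by rewrite /side ler_pow2.
  by apply: le_lt_trans Kxy; have := normr_coord_le_euclid ((x : 'rV[R]_d) - y) i; rewrite !mxE.
move/dsetE : Ly => /(_ i); move: Kxy; rewrite ltr_norml; lra.
Qed.

Definition scales (M : nat) : seq int := [seq k%:Z - M%:Z | k <- iota 0 (M + M).+1].

Lemma mem_scales M s : (s \in scales M) = (- M%:Z <= s <= M%:Z).
Proof.
apply/mapP/idP => [[k]|sM]; first by rewrite mem_iota => ? ->; lia.
exists (absz (s + M%:Z)); last by lia.
by rewrite mem_iota; lia.
Qed.

Lemma uniq_scales M : uniq (scales M).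
Proof. by rewrite map_inj_uniq ?iota_uniq// => a b; lia. Qed.

(** The range of summation varies with [x] once the times do. A fixed list of scales with an
    indicator makes the sum manifestly linear in [f] and measurable in [x]. *)
Lemma truncationE (M : nat) f x (t1 t2 : int) : - M%:Z <= t1 -> t2 <= M%:Z ->
  truncation K f x t1 t2 =
  \sum_(s <- scales M) (if t1 < s <= t2 then kint s f x else 0).
Proof.
move=> t1M t2M; rewrite fsbig_seq ?uniq_scales//.
have SE : [set s | t1 < s <= t2] = [set` scales M] `&` [set s | t1 < s <= t2].
  apply/seteqP; split=> s /=; last by case.
  by move=> st; split=> //; rewrite mem_scales; lia.
rewrite /truncation SE fsbig_mkcondr; apply: eq_fsbigr => s _.
by congr (if _ then _ else _); apply/idP/idP; rewrite inE.
Qed.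

Lemma truncationE' f x (t1 t2 : int) : truncation K f x t1 t2 =
  \sum_(s <- scales (absz t1 + absz t2)) (if t1 < s <= t2 then kint s f x else 0).
Proof. by apply: truncationE; lia. Qed.

Lemma truncationD f g x t1 t2 : cintegrable mu f -> cintegrable mu g ->
  truncation K (fun y => f y + g y) x t1 t2 =
  truncation K f x t1 t2 + truncation K g x t1 t2.
Proof.
move=> fi gi; rewrite !truncationE' -big_split; apply: eq_bigr => s _ /=.
by case: ifP => _; rewrite ?kintD// addr0.
Qed.

Lemma truncationZ (c : R) f x t1 t2 : cintegrable mu f ->
  truncation K (fun y => (c%:C)%C * f y) x t1 t2 = (c%:C)%C * truncation K f x t1 t2.
Proof.
move=> fi; rewrite !truncationE' mulr_sumr; apply: eq_bigr => s _ /=.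
by case: ifP => _; rewrite ?kintZ// mulr0.
Qed.

Lemma truncation_null f x t1 t2 : cmeasurable f -> norm1 mu f = 0%E ->
  truncation K f x t1 t2 = 0.
Proof.
move=> mf f0; rewrite truncationE' big1// => s _.
by case: ifP => // _; exact: kint_null.
Qed.

Lemma truncation_support w (L : dyadic_index d) f x t1 t2 : t2 <= scale L ->
  (forall y, ~ dset w L y -> f y = 0) -> ~ dset_dilate w 3 L x ->
  truncation K f x t1 t2 = 0.
Proof.
move=> tL fL Lx; rewrite truncationE' big1// => s _.
case: ifP => // /andP[_ st]; apply: kint_support fL Lx; exact: le_trans tL.
Qed.

Lemma truncation_empty f x t1 t2 : t2 <= t1 -> truncation K f x t1 t2 = 0.
Proof.
move=> tt; rewrite truncationE' big1// => s _.
by case: ifPn => // st; exfalso; move: st; lia.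
Qed.

Lemma linearized_truncationD t1 t2 f g : cintegrable mu f -> cintegrable mu g ->
  linearized_truncation K t1 t2 (fun y => f y + g y) =
  (fun x => linearized_truncation K t1 t2 f x + linearized_truncation K t1 t2 g x).
Proof. by move=> fi gi; apply/funext => x; exact: truncationD fi gi. Qed.

Lemma linearized_truncationZ t1 t2 (c : R) f : cintegrable mu f ->
  linearized_truncation K t1 t2 (fun y => (c%:C)%C * f y) =
  (fun x => (c%:C)%C * linearized_truncation K t1 t2 f x).
Proof. by move=> fi; apply/funext => x; exact: truncationZ fi. Qed.

Lemma linearized_truncation_eq0 t1 t2 f :
  (forall x, truncation K f x (t1 x) (t2 x) = 0) -> linearized_truncation K t1 t2 f = (fun=> 0).
Proof. by move=> h; apply/funext => x; exact: h. Qed.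

Lemma measurable_bmt (t : Rd R d -> int) (P : int -> Prop) :
  bounded_measurable_time t -> measurable [set x | P (t x)].
Proof.
move=> [mt _]; have -> : [set x | P (t x)] = \bigcup_(n in P) (t @^-1` [set n]).
  apply/seteqP; split=> [x Px|x [n Pn /= ->]//].
  by exists (t x).
by apply: measurable_countable_bigcup => n _; exact: mt.
Qed.

Lemma bmt_min t (c : int) : bounded_measurable_time t ->
  bounded_measurable_time (fun x : Rd R d => Num.min (t x) c).
Proof.
move=> bt; split=> [n|].
  exact: (measurable_bmt (fun z => Num.min z c = n) bt).
by have [M tM] := bt.2; exists (M + `|c|) => x; have := tM x; lia.
Qed.

Lemma linearized_truncation_bmf t1 t2 f : bounded_measurable_time t1 ->
  bounded_measurable_time t2 -> cintegrable mu f ->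
  bmf (linearized_truncation K t1 t2 f).
Proof.
move=> b1 b2 fi; have [M1 h1] := b1.2; have [M2 h2] := b2.2.
pose M := (absz M1 + absz M2)%N.
rewrite (_ : linearized_truncation K t1 t2 f = (fun x => \sum_(s <- scales M)
    ((\1_([set x | t1 x < s] `&` [set x | s <= t2 x]) x : R)%:C)%C * kint s f x)).
  apply: bmf_sum => s; apply: bmfM; last exact: kint_bmf.
  apply: bmf_indic; apply: measurableI.
    exact: (measurable_bmt (fun z => z < s) b1).
  exact: (measurable_bmt (fun z => s <= z) b2).
apply/funext => x; rewrite /linearized_truncation (truncationE (M := M)); last 2 first.
- by have := h1 x; rewrite /M; lia.
- by have := h2 x; rewrite /M; lia.
apply: eq_bigr => s _; rewrite indicE in_setI.
have -> : (x \in [set x | t1 x < s]) = (t1 x < s) by apply/idP/idP; rewrite inE.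
have -> : (x \in [set x | s <= t2 x]) = (s <= t2 x) by apply/idP/idP; rewrite inE.
by case: (_ && _); rewrite ?mul1r ?mul0r.
Qed.

Lemma bmt_cst (c : int) : bounded_measurable_time (fun _ : Rd R d => c).
Proof.
split=> [n|]; last by exists `|c|.
rewrite (_ : _ @^-1` _ = if c == n then setT else set0).
  by case: ifP => _; [exact: measurableT|exact: measurable0].
by apply/seteqP; split=> x /=; case: eqP.
Qed.

Lemma measurable_maximal_truncation f : cintegrable mu f ->
  measurable_fun setT (maximal_truncation K f).
Proof.
move=> fi.
(* The value 0 at inadmissible indices does not change the supremum, which is nonnegative. *)
pose u (n : nat) (x : Rd R d) : \bar R := if pickle_inv (T := (int * int)%type) n is Some t then
  (if t.1 <= t.2 then (cmodulus (truncation K f x t.1 t.2))%:E else 0%E) else 0%E.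
have -> : maximal_truncation K f = (fun x => esups (u ^~ x) 0%N).
  apply/funext => x; rewrite /esups /=; apply/eqP; rewrite eq_le; apply/andP; split.
    apply: ereal_sup_le => _ [t tt <-]; exists (pickle t) => //.
    by rewrite /u pickleK_inv tt.
  apply: ge_ereal_sup => _ [n _ <-]; rewrite /u.
  have sup0 : (0%:E <= maximal_truncation K f x)%E.
    apply: le_trans (ereal_sup_ubound (ex_intro2 _ _ (0%Z, 0%Z) _ erefl)) => //.
    by rewrite lee_fin cmodulus_ge0.
  case: (pickle_inv n) => [t|//]; case: ifPn => // tt.
  by apply: ereal_sup_ubound; exists t.
apply: measurable_fun_esups => n; rewrite /u.
case: (pickle_inv n) => [t|]; last exact: measurable_cst.
case: (t.1 <= t.2); last exact: measurable_cst.
apply: measurable_cmodulusE.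
by have /bmfP[] := linearized_truncation_bmf (bmt_cst t.1) (bmt_cst t.2) fi.
Qed.

Lemma maximal_truncation_ge0 f x : (0 <= maximal_truncation K f x)%E.
Proof.
apply: le_trans (ereal_sup_ubound (ex_intro2 _ _ (0%Z, 0%Z) _ erefl)) => //.
by rewrite lee_fin cmodulus_ge0.
Qed.

Lemma truncation_le_maximal f x t1 t2 :
  ((cmodulus (truncation K f x t1 t2))%:E <= maximal_truncation K f x)%E.
Proof.
have [tt|/ltW tt] := leP t1 t2.
  by apply: ereal_sup_ubound; exists (t1, t2).
by rewrite truncation_empty// cmodulus0 maximal_truncation_ge0.
Qed.

(** * Consequences of the [L^r] bound *)

Section strong_type.
Variables (r A : R).
Hypothesis r1 : 1 < r.
Hypothesis A0 : 0 < A.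
Hypothesis opA : (operator_norm r (maximal_truncation K) <= A%:E)%E.

(** The operator norm tests the unit ball. Dividing by a positive upper bound [c] of the norm, not
    by the norm itself, covers null functions too. *)
Lemma maximal_truncation_strong f (c : R) : bcs f -> 0 < c ->
  (pint mu r f setT <= (c `^ r)%:E)%E ->
  (\int[mu]_x (maximal_truncation K (fun x => ((c^-1)%:C)%C * f x)%R x `^ r) <= (A `^ r)%:E)%E.
Proof.
move=> bf c0 fc; have r0 : 0 < r := lt_trans ltr01 r1.
have rn0 : r != 0 by rewrite gt_eqF.
pose u : Rd R d -> R[i] := fun x => ((c^-1)%:C)%C * f x.
have bu : bcs u by exact: bcsZ.
have u1 : (norm_L r%:E u <= 1)%E.
  rewrite /norm_L Lnorm_pint// -[leRHS](poweR1r r^-1).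
  apply: lee_poweR; [by rewrite invr_ge0 ltW|exact: pint_ge0|].
  rewrite (pint_scale r (_ : 0 < c^-1) measurableT (bcs_cmeasurable bf)) ?invr_gt0//.
  apply: (@le_trans _ _ ((c^-1 `^ r)%:E * (c `^ r)%:E)%E).
    by apply: lee_wpmul2l; rewrite ?lee_fin ?powR_ge0.
  by rewrite -EFinM -powRM ?invr_ge0 ?(ltW c0)// mulVf ?gt_eqF// powR1.
have : (Lnorm mu r%:E (maximal_truncation K u) <= A%:E)%E.
  apply: le_trans opA; apply: ereal_sup_ubound; exists u; last by [].
  by split; [exact: bcs_in_L (ltW r1) bu|exact: u1].
pose J := (\int[mu]_x (maximal_truncation K u x `^ r))%E.
have JE : (\int[mu]_x (`|maximal_truncation K u x| `^ r))%E = J.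
  by apply: eq_integral => x _; rewrite gee0_abs// maximal_truncation_ge0.
rewrite Lnorm.unlock /= JE => h; rewrite -[leLHS]/J.
have J0 : (0 <= J)%E by apply: integral_ge0 => x _; exact: poweR_ge0.
have -> : J = ((J `^ r^-1) `^ r)%E by rewrite -poweRrM mulVf// poweRe1.
rewrite -poweR_EFin; by apply: lee_poweR; [exact: ltW|exact: poweR_ge0|].
Qed.

Lemma linearized_truncation_strong f t1 t2 (c : R) :
  bounded_measurable_time t1 -> bounded_measurable_time t2 -> bcs f -> 0 < c ->
  (pint mu r f setT <= (c `^ r)%:E)%E ->
  (pint mu r (linearized_truncation K t1 t2 f) setT <= ((A * c) `^ r)%:E)%E.
Proof.
move=> b1 b2 bf c0 fc; have r0 : 0 < r := lt_trans ltr01 r1.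
have fi := bcs_cintegrable bf.
pose u : Rd R d -> R[i] := fun x => ((c^-1)%:C)%C * f x.
have ui : cintegrable mu u by exact/bcs_cintegrable/bcsZ.
have /bmfP[mTu _] := linearized_truncation_bmf b1 b2 ui.
have fE : f = (fun x => (c%:C)%C * u x).
  by apply/funext => x; rewrite /u mulrA -rmorphM mulfV ?gt_eqF// mul1r.
rewrite {1}fE (linearized_truncationZ _ _ _ ui) (pint_scale r c0 measurableT mTu).
rewrite mulrC powRM ?(ltW c0) ?(ltW A0)// EFinM.
apply: lee_wpmul2l; first by rewrite lee_fin powR_ge0.
apply: le_trans (maximal_truncation_strong bf c0 fc).
apply: ge0_le_integral.
- exact: measurableT.
- by move=> x _; rewrite lee_fin powR_ge0.
- exact: measurable_cmodulus_pow mTu.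
- apply: (measurableT_comp (measurable_poweR _)).
  exact: measurable_maximal_truncation ui.
- move=> x _; rewrite -poweR_EFin; apply: lee_poweR; [exact: ltW|by rewrite lee_fin cmodulus_ge0|].
  exact: truncation_le_maximal.
Qed.

(** As [t2 <= scale L], the truncation lives on [3L], and [g] costs a factor [G2]. Its integral over
    [3L] is estimated by [pint1_le] at level [A * G1]: the constant term gives [3 ^ d A G1 |L|] and
    the [L^r] bound gives [A G1 |L|], with no dependence on [r]. The leading 2 is that of
    [cmodulus_pairing_le]. *)
Lemma pairing_strong w (L : dyadic_index d) f g t1 t2 (G1 G2 : R) :
  bounded_measurable_time t1 -> bounded_measurable_time t2 ->
  (forall x, t2 x <= scale L) -> bcs f -> bcs g -> 0 < G1 -> 0 <= G2 ->
  (forall x, ~ dset w L x -> f x = 0) ->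
  {ae mu, forall x, cmodulus (f x) <= G1} ->
  {ae mu, forall x, cmodulus (g x) <= G2} ->
  cmodulus (pairing (linearized_truncation K t1 t2 f) g) <=
  2 * (3 ^+ d + 1) * A * G1 * G2 * side R L ^+ d.
Proof.
move=> b1 b2 t2L bf bg G10 G20 fL fG gG.
have mf := bcs_cmeasurable bf; have mg := bcs_cmeasurable bg.
have r0 : 0 < r := lt_trans ltr01 r1.
have rn0 : r != 0 by rewrite gt_eqF.
set T := linearized_truncation K t1 t2 f.
have bT : bmf T by exact: linearized_truncation_bmf b1 b2 (bcs_cintegrable bf).
have /bmfP[mT _] := bT.
have sL := side_gt0 R L; have vL : 0 < side R L ^+ d by rewrite exprn_gt0.
pose c := G1 * (side R L ^+ d) `^ r^-1.
have c0 : 0 < c by rewrite mulr_gt0// powR_gt0.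
have cr : c `^ r = G1 `^ r * side R L ^+ d.
  by rewrite powRM ?powR_ge0 ?(ltW G10)// -powRrM mulVf// powRr1// ltW.
have fc : (pint mu r f setT <= (c `^ r)%:E)%E.
  rewrite (pint_setT mu rn0 fL) cr EFinM -(@measure_dset R d w L).
  rewrite -(@integral_cst _ _ _ mu _ (measurable_dset w L)).
  apply: ae_ge0_le_integral.
  - exact: measurable_dset.
  - by move=> x _; rewrite lee_fin powR_ge0.
  - exact: measurable_cmodulus_powS.
  - by move=> x _; rewrite lee_fin powR_ge0.
  - exact: measurable_cst.
  - apply: filterS fG => x fx _; rewrite lee_fin.
    by apply: ge0_ler_powR; rewrite ?nnegrE ?cmodulus_ge0 ?(ltW r0) ?(ltW G10).
have Tr := linearized_truncation_strong b1 b2 bf c0 fc.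
have T3 x : ~ dset_dilate w 3 L x -> T x = 0.
  by move=> Lx; apply: truncation_support Lx => //; exact: t2L.
have m3 : (mu : {measure set (Rd R d) -> \bar R}) (dset_dilate w 3 L) = ((3 * side R L) ^+ d)%:E.
  by rewrite measure_cube//= mulr_ge0// ltW.
have AG0 : 0 < A * G1 by rewrite mulr_gt0.
have := pint1_le mu (measurable_dset_dilate w 3 L) mT (ltW r1) AG0.
rewrite m3 => h1.
have h2 : (pint mu r T (dset_dilate w 3 L) <= ((A * c) `^ r)%:E)%E.
  apply: le_trans Tr.
  by apply: pint_subset; [exact: measurable_dset_dilate|exact: measurableT|exact: mT|].
rewrite -lee_fin; apply: (le_trans (cmodulus_pairing_le mT bg)).
have -> : (2 * (3 ^+ d + 1) * A * G1 * G2 * side R L ^+ d)%:E =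
   (2%:E * ((A * G1 * (3 ^+ d + 1) * side R L ^+ d)%:E * G2%:E))%E.
  by rewrite -!EFinM; congr EFin; ring.
apply: lee_wpmul2l => //.
apply: (@le_trans _ _ (\int[mu]_(x in dset_dilate w 3 L) ((cmodulus (T x))%:E * G2%:E))%E).
  rewrite [leRHS]integral_mkcond; apply: ae_ge0_le_integral.
  - exact: measurableT.
  - by move=> x _; rewrite lee_fin mulr_ge0// cmodulus_ge0.
  - by apply/measurable_EFinP; apply: measurable_funM; exact: measurable_cmodulus.
  - by move=> x _; rewrite patchE; case: ifP => // _; rewrite mule_ge0// lee_fin cmodulus_ge0.
  - apply/(measurable_restrictT _ (measurable_dset_dilate w 3 L)).
    apply: emeasurable_funM; last exact: measurable_cst.
    by apply: measurable_funTS; exact: measurable_cmodulusE.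
  - apply: filterS gG => x gx _; rewrite patchE; case: ifPn => [_|/negP].
      by rewrite -EFinM lee_fin ler_wpM2l// cmodulus_ge0.
    by rewrite inE => /T3 ->; rewrite cmodulus0 mul0r.
rewrite ge0_integralZr; last 4 first.
- exact: measurable_dset_dilate.
- by apply: measurable_funTS; exact: measurable_cmodulusE.
- by move=> x _; rewrite lee_fin cmodulus_ge0.
- by rewrite lee_fin.
apply: lee_wpmul2r; first by rewrite lee_fin.
apply: (le_trans h1).
apply: (@le_trans _ _ ((A * G1)%:E * ((3 * side R L) ^+ d)%:E +
  ((A * G1) `^ (1 - r))%:E * ((A * c) `^ r)%:E)%E).
  by rewrite leeD2l//; apply: lee_wpmul2l h2; rewrite lee_fin powR_ge0.
have Ac : (A * c) `^ r = (A * G1) `^ r * side R L ^+ d.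
  by rewrite (powRM _ (ltW A0) (ltW c0)) cr (powRM _ (ltW A0) (ltW G10)) mulrA.
rewrite -!EFinM -EFinD lee_fin Ac.
rewrite mulrA -powRD; last by rewrite (gt_eqF AG0) implybT.
rewrite subrK powRr1 ?(ltW AG0)// exprMn.
by apply: eqW; ring.
Qed.

(** * One step of the stopping-time recursion *)

Section one_step.
Variables (p1 p2 : R).
Hypothesis hp1 : 1 <= p1.
Hypothesis hp2 : 1 <= p2.
Hypothesis locA : (localized_constant K p1 p2 <= A%:E)%E.
Variables (t1 t2 : Rd R d -> int).
Hypothesis bt1 : bounded_measurable_time t1.
Hypothesis bt2 : bounded_measurable_time t2.
Variable M : int.
(* A lower bound of the times makes all forms at scales [<= M] vanish, hence the
   sums over stopping collections finite. *)
Hypothesis t1M : forall x, M <= t1 x.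
Variable w : 'rV['I_3]_d.

(** The common shape of the terms of [localized_form], without [1 / |Q|]. That the subtracted terms
    are the same form at smaller cubes is what makes the recursion close up. *)
Definition top_form (L : dyadic_index d) f g : R[i] :=
  pairing (linearized_truncation K t1 (fun x => Num.min (t2 x) (scale L))
            (cutoff (dset w L) f)) g.

Lemma top_form_bmf L f : bcs f ->
  bmf (linearized_truncation K t1 (fun x => Num.min (t2 x) (scale L))
    (cutoff (dset w L) f)).
Proof.
move=> bf; apply: linearized_truncation_bmf; [exact: bt1|exact: bmt_min bt2|].
by apply: bcs_cintegrable; apply: bcs_cutoff bf; exact: measurable_dset.
Qed.

Lemma bcs_cutoff_dset L f : bcs f -> bcs (cutoff (dset w L) f).
Proof. by apply: bcs_cutoff; exact: measurable_dset. Qed.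

Lemma top_formDl L f g h : bcs f -> bcs g -> bcs h ->
  top_form L (fun x => f x + g x) h = top_form L f h + top_form L g h.
Proof.
move=> bf bg bh; have fi := bcs_cintegrable (bcs_cutoff_dset L bf).
have gi := bcs_cintegrable (bcs_cutoff_dset L bg).
rewrite /top_form -pairingDl; [|exact: top_form_bmf|exact: top_form_bmf|exact: bh].
rewrite -(linearized_truncationD _ _ fi gi).
rewrite (_ : cutoff _ _ = (fun x => cutoff (dset w L) f x + cutoff (dset w L) g x)); first by [].
by apply/funext => x; exact: mulrDr.
Qed.

Lemma top_formDr L f g h : bcs f -> bcs g -> bcs h ->
  top_form L f (fun x => g x + h x) = top_form L f g + top_form L f h.
Proof. by move=> bf bg bh; apply: pairingDr; [exact: top_form_bmf|exact: bg|exact: bh]. Qed.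

Lemma top_formZl L (c : R) f h : bcs f -> bcs h ->
  top_form L (fun x => (c%:C)%C * f x) h = (c%:C)%C * top_form L f h.
Proof.
move=> bf bh; rewrite /top_form -pairingZl; [|exact: top_form_bmf|exact: bh].
have fi := bcs_cintegrable (bcs_cutoff_dset L bf).
by rewrite -(linearized_truncationZ _ _ _ fi) cutoff_scale.
Qed.

Lemma top_formZr L (c : R) f h : bcs f -> bcs h ->
  top_form L f (fun x => (c%:C)%C * h x) = (c%:C)%C * top_form L f h.
Proof. by move=> bf bh; apply: pairingZr; [exact: top_form_bmf|exact: bh]. Qed.

Lemma norm1_cutoff (B : set (Rd R d)) f : measurable B -> cmeasurable f ->
  norm1 mu f = 0%E -> norm1 mu (cutoff B f) = 0%E.
Proof.
move=> mB mf f0; apply/eqP; rewrite eq_le norm1_ge0 andbT -f0.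
by apply: norm1_le; [exact: cmeasurable_cutoff|exact: mf|exact: cmodulus_cutoff_le].
Qed.

Lemma top_form_null_l L f h : bcs f -> norm1 mu f = 0%E -> top_form L f h = 0.
Proof.
move=> bf f0; have mf := bcs_cmeasurable bf.
have c0 := norm1_cutoff (measurable_dset w L) mf f0.
rewrite /top_form linearized_truncation_eq0 ?pairing0l// => x.
by apply: truncation_null c0; exact: cmeasurable_cutoff (measurable_dset w L) mf.
Qed.

Lemma pairing_null_r F g : bmf F -> bcs g -> norm1 mu g = 0%E -> pairing F g = 0.
Proof.
move=> /bmfP[mF [N FN]] bg g0; have mg := bcs_cmeasurable bg.
have N0 : 0 <= N by rewrite (le_trans (cmodulus_ge0 (F point))).
apply: (norm1_eq0_cint (mu := mu)); first exact: cmeasurableM mF (cmeasurable_conj mg).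
apply/eqP; rewrite eq_le norm1_ge0 andbT.
apply: (@le_trans _ _ (norm1 mu (fun x => (N%:C)%C * g x)%R)).
  apply: norm1_le.
  - exact: cmeasurableM mF (cmeasurable_conj mg).
  - exact: cmeasurableM (cmeasurable_cst _ _) mg.
  - move=> x; rewrite !cmodulusM cmodulus_conj cmodulusC ger0_norm//.
    by rewrite ler_wpM2r// cmodulus_ge0.
by rewrite norm1Z// g0 mule0.
Qed.

Lemma top_form_null_r L f h : bcs f -> bcs h -> norm1 mu h = 0%E -> top_form L f h = 0.
Proof. by move=> bf bh h0; apply: pairing_null_r bh h0; exact: top_form_bmf. Qed.

Lemma top_form_empty L f h : scale L <= M -> top_form L f h = 0.
Proof.
move=> LM; rewrite /top_form linearized_truncation_eq0 ?pairing0l// => x.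
by apply: truncation_empty; have := t1M x; lia.
Qed.

Section fixed_collection.
Variables (Q : dyadic_index d) (q : set (dyadic_index d)).
Hypothesis qQ : stopping_collection R w Q q.

(** At scales at most [M] the forms vanish, and only finitely many disjoint cubes in [Q] are larger;
    so the sum of [localized_form] is a sum over a list. *)
Lemma stopping_seq : exists s : seq (dyadic_index d), [/\ uniq s,
  forall L, L \in s -> [/\ q L, dset (R := R) w L `<=` dset w Q & M < scale L] &
  forall L, q L -> dset (R := R) w L `<=` dset w Q -> M < scale L -> L \in s].
Proof.
pose F := [set L : dyadic_index d | [/\ q L, dset (R := R) w L `<=` dset w Q & M < scale L]].
have Ffin : finite_set F.
  apply: (@finite_disjoint_cubes R d w F (dset w Q) M).
  - by apply: sub_trivIset (_ : trivIset q _); [move=> L []|case: qQ].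
  - by move=> L [].
  - by move=> L [_ _ /ltW].
  - exact: measurable_dset.
  - by rewrite measure_dset ltry.
have /finite_seqP[s sE] := Ffin.
exists (undup s); split; first exact: undup_uniq.
- by move=> L; rewrite mem_undup => Ls; have : F L by rewrite sE.
- by move=> L qL LQ LM; rewrite mem_undup; have : [set` s] L by rewrite -sE.
Qed.

Variable s : seq (dyadic_index d).
Hypothesis us : uniq s.
Hypothesis sq : forall L, L \in s -> [/\ q L, dset (R := R) w L `<=` dset w Q & M < scale L].
Hypothesis qs : forall L, q L -> dset (R := R) w L `<=` dset w Q -> M < scale L -> L \in s.

Definition step_form f g := top_form Q f g - \sum_(L <- s) top_form L f g.

Lemma localized_formE f g : localized_form w K t1 t2 Q q f g =
  (((side R Q ^+ d)^-1)%:C)%C * step_form f g.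
Proof.
rewrite /localized_form volumeE; last exact: ltW (side_gt0 R Q).
rewrite /step_form (_ : \sum_(L \in _) _ = \sum_(L <- s) top_form L f g)//.
rewrite [RHS]fsbig_seq//.
rewrite -(@fsbig_widen _ _ _ _ [set` s] [set L | q L /\ dset (R := R) w L `<=` dset w Q]
  (fun L => top_form L f g)); [by []|by move=> L /sq[]|].
move=> L [[qL LQ] Ls]; apply: top_form_empty; rewrite leNgt; apply/negP => LM.
by apply: Ls; exact: qs.
Qed.

Lemma step_split (F G H : dyadic_index d -> R[i]) : (forall L, F L = G L + H L) ->
  F Q - \sum_(L <- s) F L = (G Q - \sum_(L <- s) G L) + (H Q - \sum_(L <- s) H L).
Proof. by move=> FGH; rewrite FGH (eq_bigr _ (fun L _ => FGH L)) big_split opprD addrACA. Qed.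

Lemma step_formDl f g h : bcs f -> bcs g -> bcs h ->
  step_form (fun x => f x + g x) h = step_form f h + step_form g h.
Proof. by move=> bf bg bh; exact: step_split (fun L => top_formDl L bf bg bh). Qed.

Lemma step_formDr f g h : bcs f -> bcs g -> bcs h ->
  step_form f (fun x => g x + h x) = step_form f g + step_form f h.
Proof. by move=> bf bg bh; exact: step_split (fun L => top_formDr L bf bg bh). Qed.

Lemma step_formZ (a b : R) f g : bcs f -> bcs g ->
  step_form (fun x => (a%:C)%C * f x) (fun x => (b%:C)%C * g x) =
  ((a * b)%:C)%C * step_form f g.
Proof.
move=> bf bg; have bg' := bcsZ (b%:C)%C bg.
have E L : top_form L (fun x => (a%:C)%C * f x) (fun x => (b%:C)%C * g x) =
    ((a * b)%:C)%C * top_form L f g.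
  by rewrite (top_formZl L a bf bg') (top_formZr L b bf bg) mulrA rmorphM.
by rewrite /step_form E mulrBr mulr_sumr; congr (_ - _); apply: eq_bigr => L _; exact: E.
Qed.

Lemma Ynorm_ge0 p f : (0 <= Ynorm w p q f)%E.
Proof. by case: p => [p| |] /=; rewrite ?le_max Lnorm_ge0. Qed.

Lemma nonneg_sup_ge0 (X : set (\bar R)) : (0 <= nonneg_sup X)%E.
Proof. by rewrite /nonneg_sup le_max lexx. Qed.

Lemma nonneg_sup_ubound (X : set (\bar R)) x : X x -> (x <= nonneg_sup X)%E.
Proof. by move=> Xx; rewrite /nonneg_sup le_max ereal_sup_ubound ?orbT. Qed.

Lemma localized_le_l b f : in_Xdot w p1%:E Q q b -> Ynorm w p1%:E q b = 1%E ->
  in_Y w p2%:E Q q f -> Ynorm w p2%:E q f = 1%E ->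
  ((cmodulus (localized_form w K t1 t2 Q q b f))%:E <= A%:E)%E.
Proof.
move=> b1 b2 f1 f2; apply: le_trans locA; apply: le_trans; last first.
  by apply: nonneg_sup_ubound; exists w, Q, q, t1, t2; split.
apply: le_trans (leeDl _ (nonneg_sup_ge0 _)).
by apply: nonneg_sup_ubound; exists (b, f).
Qed.

Lemma localized_le_r f b : in_Y w +oo Q q f -> Ynorm w +oo q f = 1%E ->
  in_Xdot w p2%:E Q q b -> Ynorm w p2%:E q b = 1%E ->
  ((cmodulus (localized_form w K t1 t2 Q q f b))%:E <= A%:E)%E.
Proof.
move=> f1 f2 b1 b2; apply: le_trans locA; apply: le_trans; last first.
  by apply: nonneg_sup_ubound; exists w, Q, q, t1, t2; split.
apply: le_trans (leeDr _ (nonneg_sup_ge0 _)).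
by apply: nonneg_sup_ubound; exists (f, b).
Qed.

Lemma step_form_le f g (y1 y2 : R) : bcs f -> bcs g -> 0 < y1 -> 0 < y2 ->
  ((cmodulus (localized_form w K t1 t2 Q q (fun x => ((y1^-1)%:C)%C * f x)
     (fun x => ((y2^-1)%:C)%C * g x)))%:E <= A%:E)%E ->
  cmodulus (step_form f g) <= A * y1 * y2 * side R Q ^+ d.
Proof.
move=> bf bg y10 y20; have v0 : 0 < side R Q ^+ d by rewrite exprn_gt0// side_gt0.
rewrite localized_formE step_formZ// !cmodulusM !cmodulusC lee_fin.
rewrite !gtr0_norm ?invr_gt0 ?mulr_gt0 ?invr_gt0//.
have y12 : 0 < y1 * y2 by rewrite mulr_gt0.
rewrite -invfM ler_pdivrMl// ler_pdivrMl// => /le_trans; apply.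
by apply: eqW; ring.
Qed.

Lemma step_form_null_l f g : bcs f -> norm1 mu f = 0%E -> step_form f g = 0.
Proof.
move=> bf f0; rewrite /step_form top_form_null_l// big1 ?subrr// => L _.
exact: top_form_null_l.
Qed.

Lemma step_form_null_r f g : bcs f -> bcs g -> norm1 mu g = 0%E -> step_form f g = 0.
Proof.
move=> bf bg g0; rewrite /step_form top_form_null_r// big1 ?subrr// => L _.
exact: top_form_null_r.
Qed.

Lemma Ynormoo0_norm1 f : bcs f -> (Ynorm w +oo q f <= 0)%E -> norm1 mu f = 0%E.
Proof.
move=> bf; have mf := bcs_cmeasurable bf.
rewrite /= /norm_L Lnorm.unlock /= (leb_setT_gt0 R d) => /ess_supP off.
apply/eqP; rewrite eq_le norm1_ge0 andbT -(integral0 mu setT).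
apply: ae_ge0_le_integral.
- exact: measurableT.
- by move=> x _; rewrite lee_fin cmodulus_ge0.
- exact: measurable_cmodulusE.
- by [].
- exact: measurable_cst.
- by apply: filterS off => x /= + _; rewrite ger0_norm// cmodulus_ge0.
Qed.

Lemma Ynorm_cases p f (l : R) : (Ynorm w p q f <= l%:E)%E ->
  (Ynorm w p q f <= 0)%E \/ exists y : R, [/\ 0 < y, y <= l & Ynorm w p q f = y%:E].
Proof.
move=> fl; have := Ynorm_ge0 p f; case E : (Ynorm w p q f) fl => [y| |]//=.
rewrite !lee_fin => yl y0; have [y0'|y0'] := leP y 0; first by left.
by right; exists y.
Qed.

Lemma step_form_bad_l b f (l1 l2 : R) : 0 <= l1 -> 0 <= l2 -> bcs b -> bcs f ->
  cancellative w q b -> in_Y w p1%:E Q q b -> in_Y w p2%:E Q q f ->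
  (Ynorm w p1%:E q b <= l1%:E)%E -> (Ynorm w p2%:E q f <= l2%:E)%E ->
  cmodulus (step_form b f) <= A * l1 * l2 * side R Q ^+ d.
Proof.
move=> l10 l20 bb bf cb Yb Yf nb nf; have v0 : 0 < side R Q ^+ d by rewrite exprn_gt0// side_gt0.
have tq : trivIset q (dset (R := R) w) by case: qQ.
have rhs0 : 0 <= A * l1 * l2 * side R Q ^+ d by rewrite !mulr_ge0// ?(ltW A0) ?(ltW v0).
have [b0|[y1 [y10 yl1 b1]]] := Ynorm_cases nb.
  rewrite step_form_null_l ?cmodulus0//; exact: (Ynorm0_norm1 tq hp1 bb b0).
have [f0|[y2 [y20 yl2 f1]]] := Ynorm_cases nf.
  by rewrite step_form_null_r ?cmodulus0//; exact: (Ynorm0_norm1 tq hp2 bf f0).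
apply: (@le_trans _ _ (A * y1 * y2 * side R Q ^+ d)).
  apply: step_form_le => //; apply: localized_le_l.
  - by apply: in_Xdot_scale => //; rewrite invr_gt0.
  - by rewrite (Ynorm_scale w q hp1 (_ : 0 < y1^-1) (bcs_cmeasurable bb)) ?invr_gt0// b1 -EFinM mulVf ?gt_eqF.
  - by apply: in_Y_scale => //; rewrite invr_gt0.
  - by rewrite (Ynorm_scale w q hp2 (_ : 0 < y2^-1) (bcs_cmeasurable bf)) ?invr_gt0// f1 -EFinM mulVf ?gt_eqF.
rewrite ler_wpM2r ?(ltW v0)// -!mulrA ler_wpM2l ?(ltW A0)//.
by apply: ler_pM => //; exact: ltW.
Qed.

Lemma step_form_bad_r f b (l1 l2 : R) : 0 <= l1 -> 0 <= l2 -> bcs f -> bcs b ->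
  cancellative w q b -> in_Y w +oo Q q f -> in_Y w p2%:E Q q b ->
  (Ynorm w +oo q f <= l1%:E)%E -> (Ynorm w p2%:E q b <= l2%:E)%E ->
  cmodulus (step_form f b) <= A * l1 * l2 * side R Q ^+ d.
Proof.
move=> l10 l20 bf bb cb Yf Yb nf nb; have v0 : 0 < side R Q ^+ d by rewrite exprn_gt0// side_gt0.
have tq : trivIset q (dset (R := R) w) by case: qQ.
have rhs0 : 0 <= A * l1 * l2 * side R Q ^+ d by rewrite !mulr_ge0// ?(ltW A0) ?(ltW v0).
have [f0|[y1 [y10 yl1 f1]]] := Ynorm_cases nf.
  by rewrite step_form_null_l ?cmodulus0//; exact: Ynormoo0_norm1 bf f0.
have [b0|[y2 [y20 yl2 b1]]] := Ynorm_cases nb.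
  by rewrite step_form_null_r ?cmodulus0//; exact: (Ynorm0_norm1 tq hp2 bb b0).
apply: (@le_trans _ _ (A * y1 * y2 * side R Q ^+ d)).
  apply: step_form_le => //; apply: localized_le_r.
  - by apply: in_Yoo_scale => //; rewrite invr_gt0.
  - by rewrite Ynormoo_scale ?invr_gt0// f1 -EFinM mulVf ?gt_eqF.
  - by apply: in_Xdot_scale => //; rewrite invr_gt0.
  - by rewrite (Ynorm_scale w q hp2 (_ : 0 < y2^-1) (bcs_cmeasurable bb)) ?invr_gt0// b1 -EFinM mulVf ?gt_eqF.
rewrite ler_wpM2r ?(ltW v0)// -!mulrA ler_wpM2l ?(ltW A0)//.
by apply: ler_pM => //; exact: ltW.
Qed.

Lemma step_form_split (f1 f2 b1 g1 b2 g2 : Rd R d -> R[i]) :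
  bcs f2 -> bcs b1 -> bcs g1 -> bcs b2 -> bcs g2 ->
  f1 = (fun x => b1 x + g1 x) -> f2 = (fun x => b2 x + g2 x) ->
  step_form f1 f2 = step_form b1 f2 + (step_form g1 b2 + step_form g1 g2).
Proof.
move=> bf2 bb1 bg1 bb2 bg2 -> f2E.
by rewrite (step_formDl bb1 bg1 bf2) {2}f2E (step_formDr bg1 bb2 bg2).
Qed.

Lemma top_form_good L g1 g2 (G1 G2 : R) : bcs g1 -> bcs g2 -> 0 < G1 -> 0 <= G2 ->
  {ae mu, forall x, cmodulus (g1 x) <= G1} ->
  {ae mu, forall x, cmodulus (g2 x) <= G2} ->
  cmodulus (top_form L g1 g2) <= 2 * (3 ^+ d + 1) * A * G1 * G2 * side R L ^+ d.
Proof.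
move=> b1 b2 G10 G20 g1G g2G; apply: (pairing_strong (w := w)).
- exact: bt1.
- exact: bmt_min bt2.
- by move=> x; rewrite ge_min lexx orbT.
- exact: bcs_cutoff_dset b1.
- exact: b2.
- exact: G10.
- exact: G20.
- by move=> x Lx; rewrite cutoff_out.
- by apply: filterS g1G => x; apply: le_trans; exact: cmodulus_cutoff_le.
- exact: g2G.
Qed.

(** Nothing is gained from the subtraction here: all forms are estimated separately, and by
    disjointness the forms at the [L] together cost as much as the one at [Q], whence 4 in place of
    2. *)
Lemma step_form_good g1 g2 (G1 G2 : R) : bcs g1 -> bcs g2 -> 0 < G1 -> 0 <= G2 ->
  {ae mu, forall x, cmodulus (g1 x) <= G1} ->
  {ae mu, forall x, cmodulus (g2 x) <= G2} ->
  cmodulus (step_form g1 g2) <= 4 * (3 ^+ d + 1) * A * G1 * G2 * side R Q ^+ d.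
Proof.
move=> b1 b2 G10 G20 g1G g2G.
have h L := top_form_good L b1 b2 G10 G20 g1G g2G.
apply: le_trans (cmodulusB _ _) _.
set k := 2 * (3 ^+ d + 1) * A * G1 * G2 in h.
have k0 : 0 <= k by rewrite /k !mulr_ge0 ?addr_ge0 ?exprn_ge0// ltW.
have -> : 4 * (3 ^+ d + 1) * A * G1 * G2 * side R Q ^+ d =
  k * side R Q ^+ d + k * side R Q ^+ d by rewrite /k; ring.
apply: lerD; first exact: h.
apply: le_trans (cmodulus_sum _ _ _) _.
apply: (@le_trans _ _ (\sum_(L <- s) k * side R L ^+ d)).
  by apply: ler_sum => L _; exact: h.
rewrite -mulr_sumr; apply: ler_wpM2l => //.
rewrite -lee_fin -(@measure_dset R d w Q).
apply: (@sum_side_le R d w).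
- exact: us.
- by apply: sub_trivIset (_ : trivIset q _); [move=> L /sq[]|case: qQ].
- by move=> L /sq[].
- exact: measurable_dset.
Qed.

Section calderon_zygmund_step.
Variables (f1 f2 : Rd R d -> R[i]) (l1 l2 : R).
Hypothesis bf1 : bcs f1.
Hypothesis bf2 : bcs f2.
Hypothesis f13 : forall x, ~ dset_dilate w 3 Q x -> f1 x = 0.
Hypothesis f23 : forall x, ~ dset_dilate w 3 Q x -> f2 x = 0.
Hypothesis l10 : 0 < l1.
Hypothesis l20 : 0 < l2.
Hypothesis off1 : forall x, dset_dilate w 3 Q x -> ~ shadow w q x ->
  (maximal p1 f1 x <= l1%:E)%E.
Hypothesis off2 : forall x, dset_dilate w 3 Q x -> ~ shadow w q x ->
  (maximal p2 f2 x <= l2%:E)%E.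
Hypothesis on1 : forall L, q L ->
  exists2 x, dset_dilate w (2 ^+ 5) L x & (maximal p1 f1 x <= l1%:E)%E.
Hypothesis on2 : forall L, q L ->
  exists2 x, dset_dilate w (2 ^+ 5) L x & (maximal p2 f2 x <= l2%:E)%E.

(** One [cz_constant] for each argument; 1 for each of the two terms with a bad part, and
    [4 (3 ^ d + 1)] for the good ones. *)
Definition step_constant : R := cz_constant R d ^+ 2 * (2 + 4 * (3 ^+ d + 1)).

Lemma step_form_bound :
  cmodulus (step_form f1 f2) <= step_constant * A * l1 * l2 * side R Q ^+ d.
Proof.
have tq : trivIset q (dset (R := R) w) by case: qQ.
have q3 : shadow (R := R) w q `<=` dset_dilate w 3 Q by case: qQ.
have [C0 _ _ _] := cz_constantP R d; set C := cz_constant R d in C0.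
have bb1 := bcs_bad tq bf1 hp1 l10 q3 on1.
have bb2 := bcs_bad tq bf2 hp2 l20 q3 on2.
have bg1 := bcs_good tq bf1 hp1 l10 q3 on1.
have bg2 := bcs_good tq bf2 hp2 l20 q3 on2.
have Cl1 : 0 < C * l1 by rewrite mulr_gt0.
have Cl2 : 0 < C * l2 by rewrite mulr_gt0.
rewrite (@step_form_split f1 f2 (bad w q f1) (good w q f1) (bad w q f2) (good w q f2)) => //; last 2 first.
- by apply/funext => x; rewrite /good addrC subrK.
- by apply/funext => x; rewrite /good addrC subrK.
have [Yh2 Nh2] := in_Y_h d0 bf2 f23 hp2 l20 off2 on2.
have [Yg1 Ng1] := in_Y_good d0 tq bf1 f13 hp1 l10 q3 off1 on1.
have c1 : cancellative w q (bad w q f1) by exact: cancellative_bad.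
have c2 : cancellative w q (bad w q f2) by exact: cancellative_bad.
have e1 := step_form_bad_l (ltW Cl1) (ltW Cl2) bb1 bf2 c1
  (in_Y_bad tq bf1 hp1 l10 q3 on1) Yh2 (Ynorm_bad tq bf1 hp1 l10 on1) Nh2.
have e2 := step_form_bad_r (ltW Cl1) (ltW Cl2) bg1 bb2 c2
  Yg1 (in_Y_bad tq bf2 hp2 l20 q3 on2) Ng1 (Ynorm_bad tq bf2 hp2 l20 on2).
have e3 := step_form_good bg1 bg2 Cl1 (ltW Cl2)
  (ae_good d0 tq bf1 f13 hp1 l10 off1 on1) (ae_good d0 tq bf2 f23 hp2 l20 off2 on2).
apply: le_trans (cmodulusD _ _) _.
apply: le_trans (lerD e1 (le_trans (cmodulusD _ _) (lerD e2 e3))) _.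
apply: eqW.
by rewrite /step_constant -/C; ring.
Qed.

End calderon_zygmund_step.
End fixed_collection.
(** The truncation at [L] lives on [3L], hence on [3Q]. The functions may thus be replaced by their
    restrictions to [3Q], whose level sets are controlled by the averages over [3Q]. *)
Lemma top_form_cut L Q f g : dset (R := R) w L `<=` dset w Q ->
  top_form L (cutoff (dset_dilate w 3 Q) f) (cutoff (dset_dilate w 3 Q) g) = top_form L f g.
Proof.
move=> LQ; have /dset_subset LQi := LQ.
have L3 : dset_dilate (R := R) w 3 L `<=` dset_dilate w 3 Q.
  by apply: dset_dilate_subset => i; have := LQi i; have := side_gt0 R L; lra.
have L1 : dset (R := R) w L `<=` dset_dilate w 3 Q.
  rewrite -dset_dilate1; apply: dset_dilate_subset => i.
  by have := LQi i; have := side_gt0 R L; lra.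
rewrite /top_form (_ : cutoff (dset w L) (cutoff _ f) = cutoff (dset w L) f); last first.
  apply/funext => x; have [Lx|Lx] := pselect (dset w L x); last by rewrite !cutoff_out.
  by rewrite !cutoff_in//; exact: L1.
apply: pairing_cutoff => x Qx; apply: (truncation_support (w := w) (L := L)).
- by rewrite ge_min lexx orbT.
- by move=> y Ly; rewrite cutoff_out.
- by move=> /L3.
Qed.

Definition tripled (L : dyadic_index d) : cube R d := dilate 3 (dyadic_cube R w L).

Lemma tripled_gt0 L : 0 < (tripled L).2.
Proof. by rewrite /tripled /= mulr_gt0// pow2_gt0. Qed.

Lemma tripled_side L : (tripled L).2 = 3 * side R L.
Proof. by []. Qed.

Lemma average_fin p f I : 1 <= p -> bcs f -> average p f I \is a fin_num.
Proof.
move=> hp bf; rewrite /average fin_numM//.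
have [_ h] := bcs_in_L hp (bcs_cutoff (measurable_cube I) bf).
by rewrite ge0_fin_numE// Lnorm_ge0.
Qed.

Definition tavg p f L : R := fine (average p f (tripled L)).

Lemma tavg_ge0 p f L : 0 <= tavg p f L.
Proof. by apply: fine_ge0; exact: average_ge0. Qed.

Lemma pint_tripled p f L : 1 <= p -> bcs f ->
  (pint mu p f (dset_dilate w 3 L) <= (tavg p f L `^ p * (3 * side R L) ^+ d)%:E)%E.
Proof.
move=> hp bf; rewrite -tripled_side -average_le ?tripled_gt0 ?tavg_ge0//.
by rewrite /tavg fineK//; exact: average_fin.
Qed.

Lemma tavg0_norm1 p f L : 1 <= p -> bcs f -> tavg p f L = 0 ->
  norm1 mu (cutoff (dset_dilate w 3 L) f) = 0%E.
Proof.
move=> hp bf f0; have := pint_tripled L hp bf; rewrite f0 powR0 ?gt_eqF//; last by lra.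
rewrite mul0r => p0; apply/eqP; rewrite eq_le norm1_ge0 andbT.
have mf := bcs_cmeasurable bf.
have m3 : measurable (dset_dilate (R := R) w 3 L) by exact: measurable_dset_dilate.
rewrite norm1_pint pint_cutoff ?oner_neq0; last by [].
apply/lee_addgt0Pr => e e0; rewrite add0e.
have v0 : 0 < (3 * side R L) ^+ d by rewrite exprn_gt0// mulr_gt0// side_gt0.
have c0 : 0 < e / (3 * side R L) ^+ d by rewrite divr_gt0.
have -> : pint mu 1 f (dset_dilate w 3 L) = (\int[mu]_(x in dset_dilate w 3 L) (cmodulus (f x))%:E)%E.
  by apply: eq_integral => x _; rewrite powRr1// cmodulus_ge0.
apply: le_trans (pint1_le mu m3 mf hp c0) _.
have -> : (mu : {measure set (Rd R d) -> \bar R}) (dset_dilate w 3 L) = ((3 * side R L) ^+ d)%:E.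
  by rewrite measure_cube// ltW// tripled_gt0.
have -> : pint mu p f (dset_dilate w 3 L) = 0%E.
  by apply/eqP; rewrite eq_le p0 pint_ge0.
by rewrite mule0 adde0 -EFinM divfK ?gt_eqF.
Qed.

(* [1728 = 18 * 3 * 32]: the weak type constant, the dilation by 3 and the
   smallness required in [stopping_collection_of_open]. *)
Definition level_constant : R := 2 * 1728 ^+ d.

Lemma level_constant_ge1 : 1 <= level_constant.
Proof.
have : 1 <= (1728 : R) ^+ d by rewrite exprn_ege1// ler1n.
by rewrite /level_constant; lra.
Qed.

(** The factor [2^-1] leaves room for two exceptional sets, one for each function. Since
    [level_constant <= level_constant ^ p], the level needs no dependence on [p]. *)
Lemma weak_level p f Q : 1 <= p -> bcs f -> 0 < tavg p f Q ->
  exists U : set (Rd R d), [/\ measurable U,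
    forall x, ~ (maximal p (cutoff (dset_dilate w 3 Q) f) x <=
                 (level_constant * tavg p f Q)%:E)%E -> U x &
    (mu U <= (2^-1 * (side R Q / 32) ^+ d)%:E)%E].
Proof.
move=> hp bf a0; have p0 : p != 0 by rewrite gt_eqF//; lra.
set a := tavg p f Q in a0 *; have c1 := level_constant_ge1.
have c0 : 0 < level_constant by lra.
have l0 : 0 < level_constant * a by rewrite mulr_gt0.
have m3 : measurable (dset_dilate (R := R) w 3 Q) by exact: measurable_dset_dilate.
have [U [mU EU Ule]] := maximal_weak_type d0 (bcs_cutoff m3 bf) hp l0.
exists U; split=> //; apply: le_trans Ule _; rewrite pint_cutoff//.
have lp0 : 0 < (level_constant * a) `^ p by rewrite powR_gt0.
apply: (@le_trans _ _ ((18 ^+ d / (level_constant * a) `^ p)%:E *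
    (a `^ p * (3 * side R Q) ^+ d)%:E)%E).
  by apply: lee_wpmul2l; [rewrite lee_fin divr_ge0 ?exprn_ge0 ?(ltW lp0)|exact: pint_tripled].
rewrite -EFinM lee_fin powRM ?(ltW c0) ?(ltW a0)//.
have ap0 : 0 < a `^ p by rewrite powR_gt0.
have cp : level_constant <= level_constant `^ p.
  by rewrite -{1}(powRr1 (ltW c0)) ler_powR.
have cp0 : 0 < level_constant `^ p by lra.
have v0 : 0 < side R Q ^+ d by rewrite exprn_gt0// side_gt0.
rewrite [leLHS](_ : _ = 54 ^+ d * side R Q ^+ d / level_constant `^ p); last first.
  rewrite exprMn (_ : (54 : R) = 18 * 3); last by rewrite -natrM.
  rewrite exprMn; field; by rewrite !gt_eqF.
rewrite ler_pdivrMr//.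
apply: (@le_trans _ _ (2^-1 * (side R Q / 32) ^+ d * level_constant)).
  rewrite /level_constant expr_div_n (_ : (1728 : R) = 54 * 32); last by rewrite -natrM.
  have e32 : 0 < (32 : R) ^+ d by rewrite exprn_gt0.
  rewrite exprMn le_eqVlt; apply/orP; left; apply/eqP; field.
  by rewrite gt_eqF.
by rewrite ler_wpM2l// mulr_ge0// exprn_ge0// divr_ge0// ltW// side_gt0.
Qed.

Definition tree_constant : R := step_constant * level_constant ^+ 2.

Lemma tree_step f1 f2 Q : bcs f1 -> bcs f2 ->
  step_cover w (fun L => cmodulus (top_form L f1 f2))
    (fun L => tree_constant * A * tavg p1 f1 L * tavg p2 f2 L) Q.
Proof.
move=> b1 b2; have v0 : 0 < side R Q ^+ d by rewrite exprn_gt0// side_gt0.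
have m3 : measurable (dset_dilate (R := R) w 3 Q) by exact: measurable_dset_dilate.
have topE L : dset (R := R) w L `<=` dset w Q ->
  top_form L f1 f2 = top_form L (cutoff (dset_dilate w 3 Q) f1) (cutoff (dset_dilate w 3 Q) f2).
  by move=> LQ; rewrite top_form_cut.
set h1 := cutoff _ f1 in topE; set h2 := cutoff _ f2 in topE.
have bh1 : bcs h1 by exact: bcs_cutoff.
have bh2 : bcs h2 by exact: bcs_cutoff.
(* With a vanishing average the level [l1] would be 0; but then the function is null on [3Q], the
   form is 0 and [Q] is a leaf. The same holds for [f2]. *)
have [a10|a10] := eqVneq (tavg p1 f1 Q) 0.
  apply: step_cover_nil; last by rewrite a10 mulr0 mul0r.
  rewrite topE; last by [].
  by rewrite (top_form_null_l Q h2 bh1 (tavg0_norm1 hp1 b1 a10)) cmodulus0.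
have [a20|a20] := eqVneq (tavg p2 f2 Q) 0.
  apply: step_cover_nil; last by rewrite a20 mulr0.
  rewrite topE; last by [].
  by rewrite (top_form_null_r Q bh1 bh2 (tavg0_norm1 hp2 b2 a20)) cmodulus0.
have {}a10 : 0 < tavg p1 f1 Q by rewrite lt_neqAle eq_sym a10 tavg_ge0.
have {}a20 : 0 < tavg p2 f2 Q by rewrite lt_neqAle eq_sym a20 tavg_ge0.
have [U1 [mU1 EU1 U1le]] := weak_level hp1 b1 a10.
have [U2 [mU2 EU2 U2le]] := weak_level hp2 b2 a20.
have c0 : 0 < level_constant := lt_le_trans ltr01 level_constant_ge1.
set l1 := level_constant * tavg p1 f1 Q in EU1; set l2 := level_constant * tavg p2 f2 Q in EU2.
have l10 : 0 < l1 by rewrite mulr_gt0.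
have l20 : 0 < l2 by rewrite mulr_gt0.
pose E := [set x | ~ (maximal p1 h1 x <= l1%:E)%E] `|` [set x | ~ (maximal p2 h2 x <= l2%:E)%E].
have oE x : E x -> exists2 e : R, 0 < e & forall y : Rd R d,
    (forall i, `|(y : 'rV[R]_d) 0 i - (x : 'rV[R]_d) 0 i| < e) -> E y.
  case=> Ex.
    have [e e0 he] := maximal_gt_open (bcs_cmeasurable bh1) hp1 l10 Ex.
    by exists e => // y /he Ey; left.
  have [e e0 he] := maximal_gt_open (bcs_cmeasurable bh2) hp2 l20 Ex.
  by exists e => // y /he Ey; right.
have EU : E `<=` U1 `|` U2 by move=> x [/EU1|/EU2]; [left|right].
have Ule : (mu (U1 `|` U2) <= ((side R Q / 32) ^+ d)%:E)%E.
  apply: le_trans (measureU2 _ mU1 mU2) _.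
  apply: le_trans (leeD U1le U2le) _.
  by rewrite -EFinD lee_fin -mulrDl [leLHS](_ : _ = (side R Q / 32) ^+ d)//; lra.
have [q [qQ Eq qE qsc qx]] := @stopping_collection_of_open R d d0 w Q E _ oE (measurableU _ _ mU1 mU2) EU Ule.
have [s [us sq qs]] := stopping_seq qQ.
exists s.
have ts : trivIset [set` s] (dset (R := R) w).
  by apply: sub_trivIset (_ : trivIset q _); [move=> L /sq[]|case: qQ].
split.
- exact: us.
- exact: ts.
- move=> L /sq[qL LQ _]; split; first exact: LQ.
  by apply: le_lt_trans (qsc L qL) _; rewrite ltrBlDr ltrDl.
(* The children lie in the exceptional set, of measure at most [(side R Q / 32) ^ d]; as [0 < d],
   this is less than half of [|Q|]. *)
- have h : ((\sum_(L <- s) side R L ^+ d)%:E <= mu (U1 `|` U2))%E.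
    apply: (sum_side_le us ts); last exact: measurableU.
    move=> L /sq[qL _ _] x Lx; apply/EU/qE; by exists L.
  have := le_trans h Ule; rewrite lee_fin expr_div_n => h2'.
  have : side R Q ^+ d / 32 ^+ d <= side R Q ^+ d / 2.
    rewrite ler_pM2l// lef_pV2 ?posrE ?exprn_gt0//.
    apply: (@le_trans _ _ (32 ^+ 1)); first by rewrite expr1; lra.
    by rewrite ler_weXn2l// ler1n.
  by move: h2'; lra.
have NE x : ~ E x -> (maximal p1 h1 x <= l1%:E)%E /\ (maximal p2 h2 x <= l2%:E)%E.
  by move=> /not_orP[/contrapT ? /contrapT ?].
have h13 x : ~ dset_dilate w 3 Q x -> h1 x = 0 by move=> Qx; rewrite /h1 cutoff_out.
have h23 x : ~ dset_dilate w 3 Q x -> h2 x = 0 by move=> Qx; rewrite /h2 cutoff_out.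
have off x : dset_dilate w 3 Q x -> ~ shadow w q x ->
    (maximal p1 h1 x <= l1%:E)%E /\ (maximal p2 h2 x <= l2%:E)%E.
  by move=> Qx sx; apply: NE => Ex; apply: sx; exact: Eq.
have := @step_form_bound Q q qQ s us sq qs h1 h2 l1 l2 bh1 bh2 h13 h23 l10 l20
  (fun x Qx sx => (off x Qx sx).1) (fun x Qx sx => (off x Qx sx).2).
move=> /(_ (fun L qL => let: ex_intro2 x Lx Ex := qx L qL in ex_intro2 _ _ x Lx (NE x Ex).1)
  (fun L qL => let: ex_intro2 x Lx Ex := qx L qL in ex_intro2 _ _ x Lx (NE x Ex).2)) hs.
(* The children lie in [Q], so their forms are the same for the cut and the uncut functions; the
   recursion continues with [f1] and [f2] themselves. *)
have -> : top_form Q f1 f2 = step_form Q s h1 h2 + \sum_(L <- s) top_form L f1 f2.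
  rewrite topE; last by [].
  rewrite /step_form -addrA [X in _ + X](_ : _ = 0) ?addr0//.
  rewrite addrC; apply/eqP; rewrite subr_eq0; apply/eqP.
  by rewrite big_seq [RHS]big_seq; apply: eq_bigr => L /sq[_ LQ _]; exact: topE.
apply: le_trans (cmodulusD _ _) _; apply: lerD; last exact: cmodulus_sum.
apply: le_trans hs _; apply: eqW.
by rewrite /tree_constant /l1 /l2; ring.
Qed.

End one_step.
End strong_type.

End operators.

(** * Stopping-time tree and sparse families *)

Lemma ler_sum_mem (R : numDomainType) (I : eqType) (s : seq I) (F G : I -> R) :
  (forall i, i \in s -> F i <= G i) -> \sum_(i <- s) F i <= \sum_(i <- s) G i.
Proof. by move=> FG; rewrite big_seq [leRHS]big_seq; exact: ler_sum. Qed.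

Section tree.
Context (R : realType) (d : nat) (w : 'rV['I_3]_d).
Local Notation mu := (@leb R d).
Local Notation I := (dyadic_index d).

(** Packing is tested on arbitrary measurable sets [V], because it is later applied to cubes of
    other lattices. A repeated entry of [S] counts each time. *)
Definition carleson (c : R) (S : seq I) (B : set (Rd R d)) : Prop :=
  forall V : set (Rd R d), measurable V ->
    ((\sum_(P <- S | `[< dset (R := R) w P `<=` V >]) side R P ^+ d)%:E <= c%:E * mu (V `&` B))%E.

Variables (F G : I -> R) (M : int).
Hypothesis F0 : forall Q, scale Q <= M -> F Q = 0.
Hypothesis FS : forall Q, step_cover w F G Q.

(** Induction on the height of [scale Q] above [M]. The constant 2 reproduces itself: if [Q] lies in
    [V], the descendants contribute at most twice the volume of the children, hence at most [|Q|];
    otherwise [Q] is not counted and the disjoint sets [V] intersected with the children add up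
    within [V] intersected with [Q]. *)
Lemma stopping_tree Q : exists S : seq I,
  [/\ forall P, P \in S -> dset (R := R) w P `<=` dset w Q,
      F Q <= \sum_(P <- S) side R P ^+ d * G P & carleson 2 S (dset w Q)].
Proof.
have [n] : exists n : nat, scale Q <= M + n%:Z by exists (absz (scale Q - M)); lia.
elim: n Q => [|n IH] Q Qn.
  exists [::]; split=> [//||V mV]; first by rewrite big_nil F0//; lia.
  by rewrite big_nil mule_ge0.
have [s [us ts sQ sh FQ]] := FS Q.
have /choice[T TP] : forall L, exists T : seq I, L \in s ->
    [/\ forall P, P \in T -> dset (R := R) w P `<=` dset w L,
      F L <= \sum_(P <- T) side R P ^+ d * G P & carleson 2 T (dset w L)].
  move=> L; case Ls: (L \in s); last by exists [::].
  have [_ LQ] := sQ L Ls; have [|T hT] := IH L; first by lia.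
  by exists T.
exists (Q :: flatten [seq T L | L <- s]); split.
- move=> P; rewrite in_cons => /orP[/eqP ->//|/flattenP[_ /mapP[L Ls ->] PT]].
  by have [h _ _] := TP L Ls; apply: subset_trans (h P PT) _; exact: (sQ L Ls).1.
- apply: le_trans FQ _; rewrite big_cons big_flatten big_map lerD2l.
  by apply: ler_sum_mem => L Ls; have [_ h _] := TP L Ls.
- move=> V mV; rewrite big_cons big_flatten big_map.
  have mQ : measurable (dset (R := R) w Q) by exact: measurable_dset.
  have h : ((\sum_(L <- s) \sum_(P <- T L | `[< dset (R := R) w P `<=` V >]) side R P ^+ d)%:E <=
      2%:E * \sum_(L <- s) mu (V `&` dset w L))%E.
    rewrite -sumEFin ge0_sume_distrr; last by move=> L _; exact: measure_ge0.
    rewrite big_seq [leRHS]big_seq; apply: lee_sum => L Ls.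
    by have [_ _ h] := TP L Ls; exact: h V mV.
  case: asboolP => QV; last first.
    apply: le_trans h _; apply: lee_wpmul2l => //.
    by apply: sum_measureI_le => // L /sQ[].
  have -> : V `&` dset w Q = dset w Q by rewrite setIidr.
  rewrite EFinD (leb_dset R w Q).
  have -> : (2%:E * (side R Q ^+ d)%:E = (side R Q ^+ d)%:E + (side R Q ^+ d)%:E)%E.
    by rewrite -EFinM -EFinD; congr EFin; ring.
  apply: leeD2l; apply: le_trans h _.
  apply: (@le_trans _ _ (2%:E * (\sum_(L <- s) side R L ^+ d)%:E)%E); last first.
    by rewrite -EFinM lee_fin.
  apply: lee_wpmul2l => //; rewrite -sumEFin; apply: lee_sum => L _.
  rewrite -(leb_dset R w L); apply: le_measure; rewrite ?inE.
  + by apply: measurableI mV _; exact: measurable_dset.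
  + exact: measurable_dset.
  + exact: subIsetr.
Qed.

End tree.

(** * Sparse families from a Carleson family *)

Section sparse_selection.
Context (R : realType) (d : nat).
Hypothesis d0 : (0 < d)%N.
Local Notation mu := (@leb R d).
Local Notation I := (dyadic_index d).

Lemma dset_inj (w : 'rV['I_3]_d) (L L' : I) : dset (R := R) w L `<=` dset w L' ->
  dset (R := R) w L' `<=` dset w L -> L = L'.
Proof.
move=> LL' L'L; have [x Lx] := dset_nonempty R w L.
apply: (@dyadic_uniq R d w L L' x) => //; last exact: LL'.
have /dset_subset/(_ (Ordinal d0)) h1 := LL'; have /dset_subset/(_ (Ordinal d0)) h2 := L'L.
apply/eqP; rewrite eq_le -!(ler_pow2 R) -!/(side R _).
by apply/andP; split; lra.
Qed.

Lemma dyadic_cube_inj (w : 'rV['I_3]_d) : injective (dyadic_cube (d := d) R w).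
Proof. by move=> L L' LL'; apply: (@dset_inj w); rewrite /dset LL'. Qed.

Lemma leq_mod_gap (a b c N : nat) : a = b %[mod N] -> (a < b)%N -> (b <= a + c)%N ->
  (N <= c)%N.
Proof.
move=> ab lt le; apply: (@leq_trans (b - a)); last by rewrite leq_subLR.
apply: dvdn_leq; first by rewrite subn_gt0.
by rewrite -eqn_mod_dvd ?(ltnW lt)// eq_sym; apply/eqP.
Qed.

(** Chebyshev's inequality for the function that counts the cubes of [s] through a point. *)
Lemma counting_le (w : 'rV['I_3]_d) (s : seq I) (B : set (Rd R d)) (n : nat) : measurable B ->
  (forall x, B x -> (n <= count (fun P => `[< dset w P x >]) s)%N) ->
  ((n%:R)%:E * mu B <= (\sum_(P <- s) side R P ^+ d)%:E)%E.
Proof.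
move=> mB Bn.
have mi (C : set (Rd R d)) : measurable C -> measurable_fun setT (fun x => (\1_C x : R)%:E).
  by move=> mC; apply/measurable_EFinP; exact: measurable_indic.
have i0 (C : set (Rd R d)) x : (0 <= (\1_C x : R)%:E)%E by rewrite lee_fin.
have md P : measurable (dset (R := R) w P) by exact: measurable_dset.
apply: (@le_trans _ _ (\int[mu]_x (\sum_(P <- s) (\1_(dset w P) x)%:E))%E); last first.
  rewrite ge0_integral_sum; last 3 first.
  - exact: measurableT.
  - by move=> P; exact: mi (md P).
  - by move=> P x _; exact: i0.
  rewrite -sumEFin; apply: lee_sum => P _; rewrite integral_indic//.
  by rewrite setIT -(leb_dset R w P).
rewrite -[X in (_ * mu X)%E]setIT -integral_indic; [|exact: measurableT|exact: mB].
rewrite -ge0_integralZl_EFin; last 4 first.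
- exact: measurableT.
- by move=> x _; exact: i0.
- exact: mi mB.
- exact: ler0n.
apply: ge0_le_integral.
- exact: measurableT.
- by move=> x _; apply: mule_ge0; [rewrite lee_fin|exact: i0].
- by apply: emeasurable_funM; [exact: measurable_cst|exact: mi mB].
- by apply: emeasurable_sum => P; exact: mi (md P).
- move=> x _; rewrite -EFinM sumEFin lee_fin indicE.
  have [/set_mem /Bn Bx|_] := boolP (x \in B); last by rewrite mulr0 sumr_ge0.
  rewrite mulr1; apply: (@le_trans _ _ (\sum_(P <- s) (`[< dset (R := R) w P x >] : nat)%:R)).
    by rewrite -natr_sum ler_nat; apply: leq_trans Bx _; rewrite -sum1_count big_mkcond /=.
  by apply: ler_sum => P _; rewrite indicE; case: asboolP => // h; rewrite mem_set.
Qed.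

Section one_lattice.
Variables (w : 'rV['I_3]_d) (T : seq I) (l : nat).
Hypothesis uT : uniq T.
Hypothesis l0 : (0 < l)%N.
Hypothesis TV : carleson w (l%:R : R) T setT.
Definition inside (P Q : I) : bool := `[< dset (R := R) w P `<=` dset w Q >].

Definition ancestor (Q P : I) : bool := (inside Q P) && (P != Q).

Definition depth (Q : I) : nat := count (ancestor Q) T.

Definition depth_class (j : nat) : seq I := [seq P <- T | (depth P %% (2 * l))%N == j].

(** A strict ancestor of [P] in [T] is either a strict ancestor of [Q] or a cube inside [Q] through
    [x]. So the latter number at least [depth P - depth Q], which is positive and divisible by
    [2 * l]. *)
Lemma depth_gap (j : nat) (Q P : I) (x : Rd R d) : Q \in depth_class j ->
  P \in depth_class j -> inside P Q -> P != Q -> dset w P x ->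
  (2 * l <= count (fun P' => (inside P' Q) && `[< dset w P' x >]) T)%N.
Proof.
rewrite !mem_filter => /andP[/eqP Qj QT] /andP[/eqP Pj PT] /asboolP PQ PneQ Px.
have lt : (depth Q < depth P)%N.
  apply: (@leq_trans (count (predU (ancestor Q) (pred1 Q)) T)).
    have := count_predUI (ancestor Q) (pred1 Q) T.
    rewrite (@eq_count _ (predI (ancestor Q) (pred1 Q)) pred0); last first.
      by move=> P' /=; rewrite /ancestor; case: eqP; rewrite ?andbF ?andbT.
    rewrite count_pred0 addn0 => ->.
    by rewrite -addn1 leq_add2l -has_count has_pred1.
  apply: sub_count => P' /= /orP[/andP[/asboolP QP' P'Q]|/eqP ->].
    apply/andP; split; first by apply/asboolP; exact: subset_trans QP'.
    apply/eqP => P'P; move: PneQ; rewrite -P'P => /eqP; apply.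
    by apply: (@dset_inj w) => //; rewrite P'P.
  by apply/andP; split; [exact/asboolP|rewrite eq_sym].
have le : (depth P <= depth Q + count (fun P' => (inside P' Q) && `[< dset w P' x >]) T)%N.
  rewrite -count_predUI; apply: leq_trans (leq_addr _ _).
  apply: sub_count => P' /andP[/asboolP PP' P'P] /=.
  have P'x := PP' _ Px; have Qx := PQ _ Px.
  have [QP'|QP'] := leP (scale Q) (scale P').
    have QsP' := dyadic_nested QP' Qx P'x.
    have [->|P'Q] := eqVneq P' Q; last by apply/orP; left; apply/andP; split=> //; exact/asboolP.
    by apply/orP; right; apply/andP; split; exact/asboolP.
  apply/orP; right; apply/andP; split; apply/asboolP => //.
  exact: dyadic_nested (ltW QP') P'x Qx.
by apply: (@leq_mod_gap (depth Q) (depth P)) lt le; rewrite Qj Pj.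
Qed.

Definition below (s : seq I) (Q : I) : set (Rd R d) :=
  \bigcup_(P in [set P | [/\ P \in s, inside P Q & P != Q]]) dset w P.

Lemma measurable_below s Q : measurable (below s Q).
Proof. by apply: measurable_countable_bigcup => P _; exact: measurable_dset. Qed.

(* Every point covered by a smaller cube of the same class lies in at least
   [2 * l] members of [T] inside [Q], whose total volume is at most [l |Q|]. *)
Lemma below_small j Q : Q \in depth_class j ->
  (mu (below (depth_class j) Q) <= (side R Q ^+ d / 2)%:E)%E.
Proof.
move=> Qj; have mB := measurable_below (depth_class j) Q.
have N0 : 0 < (2 * l)%:R :> R by rewrite ltr0n muln_gt0.
have h : (((2 * l)%:R)%:E * mu (below (depth_class j) Q) <=
    (\sum_(P <- [seq P <- T | inside P Q]) side R P ^+ d)%:E)%E.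
  apply: (counting_le (w := w) mB) => x [P [Pj PQ PneQ] Px].
  rewrite count_filter; apply: leq_trans (depth_gap Qj Pj PQ PneQ Px) _.
  by apply: sub_count => P' /andP[h1 h2] /=; rewrite h1 h2.
have := le_trans h; rewrite big_filter => /(_ _ (TV (measurable_dset w Q))).
rewrite setIT (leb_dset R w Q) -EFinM => {}h.
rewrite -(lee_pmul2l _ (_ : (0 < ((2 * l)%:R : R)%:E)%E)) ?lte_fin//.
apply: le_trans h _; rewrite -EFinM lee_fin natrM le_eqVlt; apply/orP; left; apply/eqP.
by field.
Qed.

Lemma class_sparse j :
  sparse 2^-1 [set dyadic_cube R w Q | Q in [set` depth_class j]].
Proof.
split.
- exact/finite_set_countable/finite_image/finite_seq.
- by move=> _ [Q _ <-]; exact: pow2_gt0.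
pose S := [set dyadic_cube R w Q | Q in [set` depth_class j]].
(* [sparse] indexes the sets [E] by geometric cubes, so [below] is restated for these; [dyadic_cube]
   is injective. *)
pose B (Q : cube R d) : set (Rd R d) :=
  \bigcup_(P in [set P | [/\ S P, cube_set P `<=` cube_set Q & P != Q]]) cube_set P.
have BE Q : B (dyadic_cube R w Q) = below (depth_class j) Q.
  apply/seteqP; split=> x.
    move=> [_ [[P Pj <-] PQ PneQ] Px]; exists P => //; split=> //; first exact/asboolP.
    by apply: contraNneq PneQ => ->.
  move=> [P [Pj /asboolP PQ PneQ] Px]; exists (dyadic_cube R w P) => //; split=> //.
    by exists P.
  by apply: contraNneq PneQ => /dyadic_cube_inj ->.
exists (fun Q => cube_set Q `\` B Q); split.
- move=> _ [Q Qj <-]; rewrite BE; apply: measurableD; last exact: measurable_below.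
  exact: measurable_dset.
- by move=> Q _ x [].
- move=> _ _ [P Pj <-] [Q Qj <-] [x [[Px PB] [Qx QB]]]; congr dyadic_cube.
  wlog PQ : P Q Pj Qj Px Qx PB QB / scale P <= scale Q.
    move=> wl; have [PQ|/ltW QP] := leP (scale P) (scale Q); first exact: wl PQ.
    by apply/esym/wl.
  apply: contrapT => PneQ; apply: QB; exists (dyadic_cube R w P) => //; split.
  + by exists P.
  + exact: (dyadic_nested PQ Px Qx).
  + by apply/eqP => /dyadic_cube_inj.
- move=> _ [Q Qj <-]; rewrite BE.
  have mB := measurable_below (depth_class j) Q.
  have mQ : measurable (dset (R := R) w Q) by exact: measurable_dset.
  have mD : measurable (dset w Q `\` below (depth_class j) Q) by exact: measurableD.
  have vE : leb (cube_set (dyadic_cube R w Q)) = (side R Q ^+ d)%:E by exact: leb_dset.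
  rewrite vE -EFinM.
  have h1 : (mu (dset w Q) <= mu (dset w Q `\` below (depth_class j) Q) +
      mu (below (depth_class j) Q))%E.
    apply: le_trans (measureU2 _ mD mB); apply: le_measure; rewrite ?inE//.
      exact: measurableU.
    by move=> x Qx; have [Bx|Bx] := pselect (below (depth_class j) Q x); [right|left].
  have := le_trans h1 (leeD2l _ (below_small Qj)).
  rewrite (leb_dset R w Q) -leeBlDr// -EFinB.
  by rewrite [X in (X%:E <= _)%E](_ : _ = 2^-1 * side R Q ^+ d)//; lra.
Qed.

End one_lattice.
Lemma pigeonhole (J : finType) (j0 : J) (F : J -> R) :
  exists j, \sum_i F i <= #|J|%:R * F j.
Proof.
apply: contrapT => /forallNP noj.
have J0 : 0 < #|J|%:R :> R by rewrite ltr0n; apply/card_gt0P; exists j0.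
have lt j : F j < (\sum_i F i) / #|J|%:R.
  by rewrite ltr_pdivlMr// mulrC ltNge; apply/negP; exact: noj.
have : \sum_i F i < \sum_(i : J) (\sum_i F i) / #|J|%:R.
  by apply: ltr_sum => //; apply/hasP; exists j0; rewrite ?mem_index_enum.
have -> (c : R) : \sum_(i : J) c = c * #|J|%:R by rewrite sumr_const mulr_natr.
by rewrite divfK ?gt_eqF// ltxx.
Qed.

Lemma sum_undup_le (J : eqType) (s : seq J) (p : pred J) (F : J -> R) :
  (forall j, 0 <= F j) -> \sum_(j <- undup s | p j) F j <= \sum_(j <- s | p j) F j.
Proof.
move=> F0; elim: s => //= j s IH; rewrite [leRHS]big_cons.
have js : \sum_(j <- s | p j) F j <= (if p j then F j + \sum_(j <- s | p j) F j
    else \sum_(j <- s | p j) F j) by case: ifP => // _; rewrite lerDr.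
case: ifP => _; first exact: le_trans js.
by rewrite big_cons; case: ifP => // _; rewrite lerD2l.
Qed.

(** A lattice and a depth class modulo twice [2 * 16 ^ d], the Carleson constant after each cube is
    replaced by one 16 times as long. *)
Definition lattice_classes : finType := ('rV['I_3]_d * 'I_(2 * (2 * 16 ^ d)))%type.

(** The 2 is the Carleson constant, lost when cubes with the same image in a shifted lattice are
    merged; the cardinality is lost by keeping only the best lattice and class. *)
Definition sparse_constant : R := 2 * #|lattice_classes|%:R.

Section selection.
Variables (w : 'rV['I_3]_d) (S : seq I) (Q : I) (G : I -> R) (H : cube R d -> R) (c : R).
Hypothesis H0 : forall J, 0 <= H J.
Hypothesis c0 : 0 <= c.
Hypothesis CS : carleson w (2 : R) S (dset w Q).
Hypothesis GH : forall P w' P', P \in S -> scale P' = scale P + 4 ->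
  cube_set (dilate 3 (dyadic_cube R w P)) `<=` dset w' P' ->
  G P <= c * H (dyadic_cube R w' P').

(** Each [3P] is sent to a containing cube [phi P] of side [16 side P], as [16 = 2 ^ 4] is the first
    power of 2 above [3 * 3]. Many [P] may share one image, but they all lie inside it, so testing
    the Carleson condition on the image bounds their total volume by twice its volume. Among the
    images, the pair of lattice and class with the largest sum is kept. *)
Lemma sparse_of_carleson : exists X : set (cube R d), sparse 2^-1 X /\
  ((\sum_(P <- S) side R P ^+ d * G P)%:E <=
   (sparse_constant * c)%:E * \esum_(J in X) (volume J * H J)%:E)%E.
Proof.
have v0 (P : I) : 0 <= side R P ^+ d by rewrite exprn_ge0// ltW// side_gt0.
have e16 : (2 : R) ^+ 4 = 16 by rewrite -natrX.
have /choice[phi phiP] : forall P : I, exists u : 'rV['I_3]_d * I, scale u.2 = scale P + 4 /\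
    cube_set (dilate 3 (dyadic_cube R w P)) `<=` dset u.1 u.2.
  move=> P; have s0 := side_gt0 R P.
  have [||w' [P' [P's P'P]]] := @shifted_dyadic_cover R d (dilate 3 (dyadic_cube R w P)) (scale P + 4).
  - by rewrite /= mulr_gt0// pow2_gt0.
  - by rewrite pow2D e16; change (3 * (3 * side R P) <= side R P * 16); lra.
  - by exists (w', P').
have phi_side P : side R (phi P).2 = 16 * side R P.
  by rewrite /side (phiP P).1 pow2D e16 mulrC.
have phi_sub P : dset (R := R) w P `<=` dset (phi P).1 (phi P).2.
  apply: subset_trans (phiP P).2 => x Px; move: Px; rewrite -dset_dilate1.
  apply: (@dset_dilate_subset R d w 1 3 P P) => i.
  by have := side_gt0 R P; lra.
pose U := undup [seq phi P | P <- S].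
pose T v : seq I := [seq u.2 | u <- U & u.1 == v].
have uU : uniq U by exact: undup_uniq.
have uT v : uniq (T v).
  rewrite map_inj_in_uniq ?filter_uniq// => -[a b] [a' b'].
  by rewrite !mem_filter /= => /andP[/eqP -> _] /andP[/eqP -> _] ->.
pose l : nat := (2 * 16 ^ d)%N.
have l0 : (0 < l)%N by rewrite muln_gt0 expn_gt0.
(* If [phi P] lies in [V], so does [P], whose volume is smaller by [16 ^ d]; removing repetitions
   only decreases the sum. *)
have CT v : carleson v (l%:R : R) (T v) setT.
  move=> V mV; rewrite setIT big_map big_filter_cond.
  apply: (@le_trans _ _ ((16 ^+ d * \sum_(P <- S | `[< dset (R := R) w P `<=` V >]) side R P ^+ d)%:E)); last first.
    rewrite EFinM natrM natrX [(2 * _)%R]mulrC EFinM -muleA; apply: lee_wpmul2l.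
      by rewrite lee_fin exprn_ge0.
    apply: le_trans (CS mV) _; apply: lee_wpmul2l => //.
    apply: le_measure; rewrite ?inE; [|exact: mV|exact: subIsetl].
    by apply: measurableI mV _; exact: measurable_dset.
  rewrite lee_fin; apply: le_trans (sum_undup_le _ _ (fun u => v0 u.2)) _.
  rewrite big_map mulr_sumr big_mkcond [leRHS]big_mkcond; apply: ler_sum => P _.
  case: ifP => [/andP[/eqP <- /asboolP PV]|_].
    by rewrite (introT (asboolP _) (subset_trans (@phi_sub P) PV)) phi_side exprMn.
  by case: ifP => // _; apply: mulr_ge0; [exact: exprn_ge0|exact: v0].
have N0 : (0 < 2 * l)%N by rewrite muln_gt0.
pose key (u : 'rV['I_3]_d * I) : lattice_classes :=
  (u.1, Ordinal (ltn_pmod (depth u.1 (T u.1) u.2) N0)).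
pose vl (u : 'rV['I_3]_d * I) : R := side R u.2 ^+ d * H (dyadic_cube R u.1 u.2).
have [[v j] vj] := @pigeonhole lattice_classes (0, Ordinal N0)
  (fun k => \sum_(u <- U | key u == k) vl u).
exists [set dyadic_cube R v P | P in [set` depth_class v (T v) l j]].
split; first exact: class_sparse.
apply: (@le_trans _ _ ((sparse_constant * c)%:E *
   (\sum_(u <- U | key u == (v, j)) vl u)%:E)%E); last first.
  apply: lee_wpmul2l; first by rewrite lee_fin !mulr_ge0.
  apply: esum_ge; exists [set dyadic_cube R v P | P in [set` depth_class v (T v) l j]].
    by split=> //; exact/finite_image/finite_seq.
  rewrite (_ : [set dyadic_cube R v P | P in _] =
      [set` [seq dyadic_cube R v P | P <- depth_class v (T v) l j]]); last first.
    apply/seteqP; split=> [_ [P Pj <-]|J /mapP[P Pj ->]]; last by exists P.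
    by apply/mapP; exists P.
  rewrite -fsbig_seq; last first.
    by rewrite map_inj_uniq ?filter_uniq//; exact: dyadic_cube_inj.
  rewrite big_map big_filter big_map big_filter_cond sumEFin lee_fin.
  apply: eqW; apply: eq_big => [u|u].
    rewrite /key xpair_eqE; case: eqP => [->|//].
    by rewrite -val_eqE.
  rewrite /key xpair_eqE => /andP[/eqP uv _].
  by rewrite /vl uv volumeE// ltW// pow2_gt0.
rewrite -EFinM lee_fin.
apply: (@le_trans _ _ (c * (2 * \sum_(u <- U) vl u))); last first.
  rewrite /sparse_constant [leRHS](_ : _ = c * (2 * (#|lattice_classes|%:R *
    \sum_(u <- U | key u == (v, j)) vl u))); last by ring.
  rewrite (partition_big key predT)//=; apply: ler_wpM2l => //.
  by apply: ler_wpM2l.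
have -> : c * (2 * \sum_(u <- U) vl u) = \sum_(u <- U) (2 * side R u.2 ^+ d) *
    (c * H (dyadic_cube R u.1 u.2)).
  by rewrite !mulr_sumr; apply: eq_bigr => u _; rewrite /vl; ring.
(* Groups the cubes of [S] by their image [u]; the first inequality is the Carleson condition tested
   on [u]. *)
apply: (@le_trans _ _ (\sum_(u <- U) (\sum_(P <- S | phi P == u) side R P ^+ d) *
    (c * H (dyadic_cube R u.1 u.2)))); last first.
  apply: ler_sum => u _; apply: ler_wpM2r; first by rewrite mulr_ge0.
  have mu2 : measurable (dset (R := R) u.1 u.2) by exact: measurable_dset.
  have := CS mu2; set m := (_ * mu _)%E => h.
  have hm : (m <= (2 * side R u.2 ^+ d)%:E)%E.
    rewrite EFinM -(leb_dset R u.1 u.2) /m; apply: lee_wpmul2l => //.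
    apply: le_measure; rewrite ?inE; [|exact: mu2|exact: subIsetl].
    by apply: measurableI mu2 _; exact: measurable_dset.
  have := le_trans h hm; rewrite lee_fin; apply: le_trans.
  rewrite big_mkcond [leRHS]big_mkcond; apply: ler_sum => P _.
  case: eqP => [<-|_]; last by case: ifP => // _; exact: v0.
  by rewrite (introT (asboolP _) (@phi_sub P)).
under [leRHS]eq_bigr do rewrite mulr_suml.
rewrite (exchange_big_dep predT)//=; apply: ler_sum_mem => P PS.
have PU : phi P \in U by rewrite mem_undup; apply/mapP; exists P.
rewrite big_mkcond (bigD1_seq (phi P))//= eqxx.
apply: (@le_trans _ _ (side R P ^+ d * (c * H (dyadic_cube R (phi P).1 (phi P).2)))).
  apply: ler_wpM2l; first exact: v0.
  exact: GH PS (phiP P).1 (phiP P).2.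
rewrite lerDl; apply: sumr_ge0 => u _; case: ifP => // _.
by apply: mulr_ge0; [exact: v0|exact: mulr_ge0].
Qed.

End selection.
End sparse_selection.

(** * Linearization of the maximal truncation *)

Lemma mulJ_cmodulus (R : realType) (z : R[i]) : z * conjc z = ((cmodulus z ^+ 2)%:C)%C.
Proof.
case: z => u v; rewrite /cmodulus /= sqr_sqrtr ?addr_ge0 ?sqr_ge0//.
by apply/eqP; rewrite eq_complex /=; apply/andP; split; apply/eqP; ring.
Qed.

Section linearization.
Context (R : realType) (d : nat).
Hypothesis d0 : (0 < d)%N.
Variable K : int -> Rd R d -> Rd R d -> R[i].
Hypothesis mK : forall s, cmeasurable (fun z : Rd R d * Rd R d => K s z.1 z.2).
Hypothesis finK : (kernel_norm K < +oo)%E.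
Implicit Types (f g : Rd R d -> R[i]).
Local Notation mu := (@leb R d).

Definition time_pair (n : nat) : int * int :=
  odflt (0, 0) (pickle_inv (T := (int * int)%type) n).

Lemma time_pairK (t : int * int) : time_pair (pickle t) = t.
Proof. by rewrite /time_pair pickleK_inv. Qed.

Variable f : Rd R d -> R[i].
Hypothesis fi : cintegrable mu f.

Definition size_at (t : int * int) (x : Rd R d) : R := cmodulus (truncation K f x t.1 t.2).

(** A running argmax over an enumeration of all time pairs. At stage [n] only finitely many pairs
    have been compared, so the times are bounded and measurable, and the attained sizes increase to
    the maximal truncation. *)
Fixpoint greedy_time (n : nat) (x : Rd R d) : int * int :=
  if n is n.+1 then
    if size_at (greedy_time n x) x < size_at (time_pair n) x then time_pair n
    else greedy_time n x
  else (0, 0).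

Definition greedy (n : nat) (x : Rd R d) : R := size_at (greedy_time n x) x.

Lemma greedyS n x : greedy n.+1 x = Num.max (greedy n x) (size_at (time_pair n) x).
Proof. by rewrite /greedy /=; case: ltP. Qed.

Lemma greedy_nondecreasing x : {homo (fun n => greedy n x) : n m / (n <= m)%N >-> n <= m}.
Proof.
apply: homo_leq => [y|y z t|n]; [exact: lexx|exact: le_trans|].
by rewrite greedyS le_max lexx.
Qed.

Lemma size_at_le_greedy t x : size_at t x <= greedy (pickle t).+1 x.
Proof. by rewrite greedyS time_pairK le_max lexx orbT. Qed.

Lemma bounded_measurable_if (D : set (Rd R d)) (t t' : Rd R d -> int) : measurable D ->
  bounded_measurable_time t -> bounded_measurable_time t' ->
  bounded_measurable_time (fun x => if x \in D then t x else t' x).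
Proof.
move=> mD [mt [N tN]] [mt' [N' t'N]]; split=> [n|].
  rewrite (_ : _ @^-1` _ = (D `&` t @^-1` [set n]) `|` (~` D `&` t' @^-1` [set n])).
    apply: measurableU; apply: measurableI; [exact: mD|exact: mt|exact: measurableC|exact: mt'].
  apply/seteqP; split=> x /=.
    by case: ifPn => [/set_mem Dx <-|/negP Dx <-]; [left|right; split=> // /mem_set].
  by move=> [[/mem_set -> //]|[Dx tx]]; rewrite memNset.
by exists (Num.max N N') => x; rewrite le_max; case: ifP => _; rewrite ?tN ?t'N ?orbT.
Qed.

Lemma bounded_measurable_greedy n :
  bounded_measurable_time (fun x => (greedy_time n x).1) /\
  bounded_measurable_time (fun x => (greedy_time n x).2).
Proof.
elim: n => [|n [IH1 IH2]]; first by split; exact: bmt_cst.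
pose D : set (Rd R d) := [set x | greedy n x < size_at (time_pair n) x].
have /bmfP[m1 _] := linearized_truncation_bmf d0 mK finK IH1 IH2 fi.
have /bmfP[m2 _] := linearized_truncation_bmf d0 mK finK
  (bmt_cst R d (time_pair n).1) (bmt_cst R d (time_pair n).2) fi.
have mD : measurable D.
  have := measurable_fun_ltr (measurable_cmodulus m1) (measurable_cmodulus m2).
  move=> /(_ measurableT [set true]); rewrite setTI; exact.
have DE x : (greedy n x < size_at (time_pair n) x) = (x \in D).
  by apply/idP/idP => [?|/set_mem//]; rewrite mem_set.
split.
- rewrite (_ : (fun x => _) = fun x => if x \in D then (time_pair n).1 else (greedy_time n x).1).
    exact: bounded_measurable_if mD (bmt_cst _ _ _) IH1.
  by apply/funext => x /=; rewrite -DE /greedy; case: ifP.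
- rewrite (_ : (fun x => _) = fun x => if x \in D then (time_pair n).2 else (greedy_time n x).2).
    exact: bounded_measurable_if mD (bmt_cst _ _ _) IH2.
  by apply/funext => x /=; rewrite -DE /greedy; case: ifP.
Qed.

Lemma measurable_greedy n : measurable_fun setT (greedy n).
Proof.
have [b1 b2] := bounded_measurable_greedy n.
have /bmfP[m _] := linearized_truncation_bmf d0 mK finK b1 b2 fi.
exact: measurable_cmodulus m.
Qed.

Lemma maximal_truncation_greedy x :
  maximal_truncation K f x = ereal_sup (range (fun n => (greedy n x)%:E)).
Proof.
apply/eqP; rewrite eq_le; apply/andP; split.
  apply: ge_ereal_sup => _ [t _ <-].
  apply: (@le_trans _ _ (greedy (pickle t).+1 x)%:E).
    by rewrite lee_fin; exact: size_at_le_greedy.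
  by apply: ereal_sup_ubound; exists (pickle t).+1.
apply: ge_ereal_sup => _ [n _ <-].
exact: truncation_le_maximal.
Qed.

Lemma integral_maximal_truncation (g : Rd R d -> R[i]) : cmeasurable g ->
  (\int[mu]_x (maximal_truncation K f x * (cmodulus (g x))%:E) =
   ereal_sup (range (fun n => \int[mu]_x (greedy n x * cmodulus (g x))%:E)))%E.
Proof.
move=> mg.
pose F n x := (greedy n x * cmodulus (g x))%:E.
have F0 n x : setT x -> (0 <= F n x)%E by move=> _; rewrite lee_fin mulr_ge0 ?cmodulus_ge0.
have mF n : measurable_fun setT (F n).
  apply/measurable_EFinP; apply: measurable_funM; first exact: measurable_greedy.
  exact: measurable_cmodulus.
have ndF x : setT x -> {homo F ^~ x : n m / (n <= m)%N >-> (n <= m)%E}.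
  move=> _ n m nm; rewrite lee_fin ler_wpM2r ?cmodulus_ge0//.
  exact: greedy_nondecreasing.
have cF x : (F ^~ x @ \oo --> maximal_truncation K f x * (cmodulus (g x))%:E)%E.
  have h := ereal_nondecreasing_cvgn (ndF x I).
  suff -> : (maximal_truncation K f x * (cmodulus (g x))%:E = ereal_sup (range (F ^~ x)))%E by [].
  have FE : F ^~ x = (fun n => (cmodulus (g x))%:E * (greedy n x)%:E)%E.
    by apply/funext => n; rewrite /F mulrC EFinM.
  rewrite maximal_truncation_greedy muleC FE.
  (* Only a positive factor can be pulled out of the supremum; if [g x = 0], the convention that 0
     times [+oo] is 0 makes both sides vanish. *)
  have := cmodulus_ge0 (g x); rewrite le_eqVlt => /predU1P[<-|c0].
    rewrite mul0e (_ : (fun n => _) = fun=> 0%E); last by apply/funext => n; rewrite mul0e.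
    by rewrite ereal_sup_cst//; apply/set0P; exists 0%N.
  rewrite -ereal_sup_pZl//; congr ereal_sup.
  by rewrite -[RHS](image_comp (fun n => (greedy n x)%:E) (fun z => (cmodulus (g x))%:E * z)%E).
have := monotone_convergence mu measurableT mF F0 ndF.
have -> : (fun x => limn (F ^~ x)) = (fun x => maximal_truncation K f x * (cmodulus (g x))%:E)%E.
  by apply/funext => x; apply/cvg_lim.
move=> ->; apply/cvg_lim => //; apply: ereal_nondecreasing_cvgn => n m nm.
apply: ge0_le_integral.
- exact: measurableT.
- exact: F0.
- exact: mF.
- exact: mF.
- by move=> x _; exact: ndF.
Qed.

Lemma measurable_truncation_fun : cmeasurable (maximal_truncation_fun K f).
Proof.
split=> /=; last exact: measurable_cst.
exact: measurableT_comp (@fine_measurable R setT measurableT) (measurable_maximal_truncation d0 mK finK fi).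
Qed.

Lemma cmodulus_pairing_maximal_le g : bcs g ->
  ((cmodulus (pairing (maximal_truncation_fun K f) g))%:E <=
   2%:E * \int[mu]_x (maximal_truncation K f x * (cmodulus (g x))%:E))%E.
Proof.
move=> bg; have mg := bcs_cmeasurable bg.
have m := cmeasurableM measurable_truncation_fun (cmeasurable_conj mg).
apply: le_trans (cmodulus_cint_le mu m) _; apply: lee_wpmul2l => //.
apply: ge0_le_integral.
- exact: measurableT.
- by move=> x _; rewrite lee_fin cmodulus_ge0.
- exact: measurable_cmodulusE.
- apply: emeasurable_funM; last exact: measurable_cmodulusE.
  exact: (measurable_maximal_truncation d0 mK finK fi).
- move=> x _; rewrite cmodulusM cmodulus_conj EFinM; apply: lee_wpmul2r.
    by rewrite lee_fin cmodulus_ge0.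
  have T0 := maximal_truncation_ge0 K f x.
  (* [fine] sends [+oo] to 0, which only decreases the left-hand side. *)
  rewrite /maximal_truncation_fun cmodulusC ger0_norm ?fine_ge0//.
  by case: (maximal_truncation K f x) T0.
Qed.

(* [h] is [g] with the phase of the truncation; 3 instead of 2, the constant of
   [cmodulus_cint_le], makes the inequality strict before passing to a supremum. *)
Lemma linearize g (z : R) : bcs g -> 0 < z ->
  z <= cmodulus (pairing (maximal_truncation_fun K f) g) ->
  exists t1 t2 : Rd R d -> int, [/\ bounded_measurable_time t1, bounded_measurable_time t2 &
    exists h, [/\ bcs h, forall x, cmodulus (h x) <= cmodulus (g x) &
      z / 3 <= cmodulus (pairing (linearized_truncation K t1 t2 f) h)]].
Proof.
move=> bg z0 zle; have mg := bcs_cmeasurable bg.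
have := cmodulus_pairing_maximal_le bg; rewrite integral_maximal_truncation// => h.
have {h}zs : ((z / 3)%:E < ereal_sup (range (fun n => \int[mu]_x (greedy n x * cmodulus (g x))%:E)))%E.
  apply: (@lt_le_trans _ _ (z / 2)%:E); first by rewrite lte_fin; lra.
  rewrite -(@lee_pmul2l _ 2%:E)//; apply: le_trans h.
  by rewrite -EFinM lee_fin; lra.
have [_ [n _ <-] zn] := ereal_sup_gt zs.
have [b1 b2] := bounded_measurable_greedy n.
exists (fun x => (greedy_time n x).1), (fun x => (greedy_time n x).2); split => //.
set F := linearized_truncation _ _ _ _.
have bF := linearized_truncation_bmf d0 mK finK b1 b2 fi; rewrite -/F in bF.
have /bmfP[mF _] := bF.
(* The inverse is written as a power to have its measurability. Where [F] vanishes it is 0, so [c F]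
   is [|g|] times the phase of [F], and 0 where [F] is. *)
pose c x : R := cmodulus (g x) * (cmodulus (F x)) `^ (-1).
have mc : measurable_fun setT c.
  apply: measurable_funM; first exact: measurable_cmodulus.
  exact: (measurableT_comp (measurable_powR _)) (measurable_cmodulus mF).
have cE x : c x = cmodulus (g x) / cmodulus (F x).
  by rewrite /c powR_inv1// cmodulus_ge0.
have c0 x : 0 <= c x by rewrite cE divr_ge0// cmodulus_ge0.
exists (fun x => ((c x)%:C)%C * F x).
have hg x : cmodulus (((c x)%:C)%C * F x) <= cmodulus (g x).
  rewrite cmodulusM cmodulusC ger0_norm// cE.
  have [->|F0] := eqVneq (cmodulus (F x)) 0; first by rewrite mulr0 cmodulus_ge0.
  by rewrite divfK.
have bh : bcs (fun x => ((c x)%:C)%C * F x).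
  have [_ [N gN] [N' gN']] := (bcsP g).1 bg; apply/bcsP; split.
  - exact: cmeasurableM (cmeasurable_real mc) mF.
  - by exists N => x; exact: le_trans (hg x) (gN x).
  - exists N' => x hx; apply: gN'; apply: contraNneq hx => gx.
    by rewrite /c gx cmodulus0 mul0r mul0r.
split=> //.
have prodE x : F x * conjc (((c x)%:C)%C * F x) = ((greedy n x * cmodulus (g x))%:C)%C.
  rewrite conjcM_real mulrCA mulJ_cmodulus -rmorphM /=; congr (_%:C)%C.
  change (greedy n x) with (cmodulus (F x)); rewrite cE.
  have [->|F0] := eqVneq (cmodulus (F x)) 0; first by rewrite expr0n mulr0 mul0r.
  by field.
set J := (\int[mu]_x _)%E in zn.
have Joo : (J < +oo)%E.
  have [_] := pairing_integrable bF bh; rewrite (_ : norm1 _ _ = J)//.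
  apply: eq_integral => x _; rewrite prodE cmodulusC ger0_norm//.
  by rewrite mulr_ge0 ?cmodulus_ge0.
have Jfin : J \is a fin_num.
  by rewrite ge0_fin_numE// integral_ge0// => x _; rewrite lee_fin mulr_ge0 ?cmodulus_ge0.
apply: le_trans (normr_Re_le _); apply: le_trans (ler_norm _).
have -> : complex.Re (pairing F (fun x => ((c x)%:C)%C * F x)) = fine J.
  by congr fine; apply: eq_integral => x _; rewrite prodE.
by rewrite -lee_fin fineK// ltW.
Qed.

End linearization.

(** * Sparse bound *)

Section sparse_bound.
Context (R : realType) (d : nat).
Hypothesis d0 : (0 < d)%N.
Local Notation mu := (@leb R d).

(** The volumes of [P'] and [3P] have ratio [(16 / 3) ^ d]; its power [1 / p] is at most [16 ^ d]
    for all [p >= 1]. *)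
Lemma tavg_le (w w' : 'rV['I_3]_d) (P P' : dyadic_index d) (p : R) (f g : Rd R d -> R[i]) :
  1 <= p -> bcs f -> bcs g -> (forall x, cmodulus (f x) <= cmodulus (g x)) ->
  scale P' = scale P + 4 -> cube_set (dilate 3 (dyadic_cube R w P)) `<=` dset w' P' ->
  tavg w p f P <= 16 ^+ d * fine (average p g (dyadic_cube R w' P')).
Proof.
move=> hp bf bg fg P's PP'; set a := fine _.
have a0 : 0 <= a by apply: fine_ge0; exact: average_ge0.
have p0 : 0 <= p by lra.
have c1 : 1 <= (16 : R) ^+ d by rewrite exprn_ege1// ler1n.
have ca0 : 0 <= 16 ^+ d * a by rewrite mulr_ge0// exprn_ge0.
rewrite /tavg -lee_fin fineK; last exact: average_fin.
rewrite average_le//; last by rewrite /tripled /= mulr_gt0// pow2_gt0.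
have mf := bcs_cmeasurable bf; have mg := bcs_cmeasurable bg.
have m3 : measurable (cube_set (tripled R w P)) by exact: measurable_cube.
have mP' : measurable (dset (R := R) w' P') by exact: measurable_dset.
apply: (@le_trans _ _ (pint mu p g (cube_set (tripled R w P)))).
  by apply: pint_le => //.
apply: (@le_trans _ _ (pint mu p g (dset w' P'))); first exact: pint_subset.
have : (average p g (dyadic_cube R w' P') <= a%:E)%E.
  by rewrite /a fineK//; exact: average_fin.
rewrite average_le//; last exact: pow2_gt0.
move=> /le_trans; apply; rewrite lee_fin.
have s0 := side_gt0 R P.
change (a `^ p * side R P' ^+ d <= (16 ^+ d * a) `^ p * (3 * side R P) ^+ d).
have -> : side R P' = 16 * side R P.
  by rewrite /side P's pow2D mulrC; congr (_ * _); rewrite -natrX.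
rewrite powRM ?exprn_ge0// !exprMn.
have h1 : (16 : R) ^+ d <= (16 ^+ d) `^ p by rewrite -[leLHS]powRr1 ?exprn_ge0// ler_powR.
have h2 : 1 <= (3 : R) ^+ d by rewrite exprn_ege1// ler1n.
have ap : 0 <= a `^ p := powR_ge0 _ _.
have sd : 0 <= side R P ^+ d by rewrite exprn_ge0// ltW.
have as0 := mulr_ge0 ap sd.
have : 16 ^+ d * 1 <= (16 ^+ d) `^ p * (3 : R) ^+ d by apply: ler_pM => //; rewrite exprn_ge0.
by rewrite mulr1 => /(ler_wpM2r as0); rewrite [leRHS](_ : _ = (16 ^+ d) `^ p * a `^ p *
  (3 ^+ d * side R P ^+ d)); last ring; rewrite [leLHS](_ : _ = a `^ p * (16 ^+ d * side R P ^+ d)); last ring.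
Qed.

Variable K : int -> Rd R d -> Rd R d -> R[i].
Hypothesis mK : forall s, cmeasurable (fun z : Rd R d * Rd R d => K s z.1 z.2).
Hypothesis suppK : forall s (x y : Rd R d), K s x y != 0 ->
  euclid_norm ((x : 'rV[R]_d) - y) < 2 ^ s.
Hypothesis finK : (kernel_norm K < +oo)%E.
Variables (r p1 p2 A : R).
Hypothesis r1 : 1 < r.
Hypothesis hp1 : 1 <= p1.
Hypothesis hp2 : 1 <= p2.
Hypothesis A0 : 0 < A.
Hypothesis opA : (operator_norm r (maximal_truncation K) <= A%:E)%E.
Hypothesis locA : (localized_constant K p1 p2 <= A%:E)%E.

(** The 3 is lost in [linearize]; one [16 ^ d] for each average is lost in [tavg_le]. *)
Definition domination_constant : R :=
  3 * (sparse_constant R d * (tree_constant R d * (16 ^+ d) ^+ 2)).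

Lemma sparse_constant_gt0 : 0 < sparse_constant R d.
Proof.
apply: mulr_gt0 => //; rewrite ltr0n; apply/card_gt0P.
have N0 : (0 < 2 * (2 * 16 ^ d))%N by rewrite !muln_gt0 expn_gt0.
by exists (0, Ordinal N0).
Qed.

Lemma tree_constant_gt0 : 0 < tree_constant R d.
Proof.
have [C0 _ _ _] := cz_constantP R d.
have c0 : 0 < level_constant R d := lt_le_trans ltr01 (level_constant_ge1 R d).
have h : 0 <= (3 : R) ^+ d by rewrite exprn_ge0.
rewrite /tree_constant /step_constant; apply: mulr_gt0; last exact: exprn_gt0.
apply: mulr_gt0; first exact: exprn_gt0.
by apply: addr_gt0 => //; apply: mulr_gt0 => //; exact: ltr_wpDl.
Qed.

Lemma domination_constant_gt0 : 0 < domination_constant.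
Proof.
apply: mulr_gt0 => //; apply: mulr_gt0; first exact: sparse_constant_gt0.
by apply: mulr_gt0; [exact: tree_constant_gt0|rewrite !exprn_gt0].
Qed.

(** Provides the root of the tree: with [N] above the upper time and the support of [f] inside [Q],
    the whole linearized form is the top form at [Q]. *)
Lemma top_cube (f : Rd R d -> R[i]) (N : int) : bcs f ->
  exists (w : 'rV['I_3]_d) (Q : dyadic_index d), N <= scale Q /\ cutoff (dset w Q) f = f.
Proof.
move=> bf; have [J J0 fJ] := bcs_support bf.
have [k Jk] := pow2_above (3 * J.2).
have Jm : 3 * J.2 <= 2 ^ Num.max k%:Z N.
  by apply: le_trans Jk _; rewrite ler_pow2 le_max lexx.
have [w [Q [Qk JQ]]] := shifted_dyadic_cover J0 Jm.
exists w, Q; split; first by rewrite Qk le_max lexx orbT.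
apply/funext => x; have [Qx|Qx] := pselect (dset w Q x); first by rewrite cutoff_in.
by rewrite cutoff_out// fJ// => /JQ.
Qed.

Lemma linearized_sparse_bound (f g h : Rd R d -> R[i]) t1 t2 : bcs f -> bcs g -> bcs h ->
  (forall x, cmodulus (h x) <= cmodulus (g x)) ->
  bounded_measurable_time t1 -> bounded_measurable_time t2 ->
  exists X : set (cube R d), sparse 2^-1 X /\
    ((cmodulus (pairing (linearized_truncation K t1 t2 f) h))%:E <=
     (domination_constant * A / 3)%:E *
       \esum_(J in X) ((volume J)%:E * average p1 f J * average p2 g J))%E.
Proof.
move=> bf bg bh hg bt1 bt2.
have [N1 t1N] := bt1.2; have [N2 t2N] := bt2.2.
have [w [Q [NQ fQ]]] := top_cube N2 bf.
have t1M x : - N1 <= t1 x by have := t1N x; lia.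
have -> : pairing (linearized_truncation K t1 t2 f) h = top_form K t1 t2 w Q f h.
  rewrite /top_form fQ (_ : (fun x => Num.min (t2 x) (scale Q)) = t2)//.
  by apply/funext => x; apply/min_idPl; have := t2N x; lia.
pose F L := cmodulus (top_form K t1 t2 w L f h).
pose G L := tree_constant R d * A * tavg w p1 f L * tavg w p2 h L.
have F0 L : scale L <= - N1 -> F L = 0.
  by move=> LM; rewrite /F (top_form_empty d0 finK r1 A0 opA hp1 hp2 locA t2 t1M) ?cmodulus0.
have FS L := tree_step d0 mK suppK finK r1 A0 opA hp1 hp2 locA bt1 bt2 t1M w L bf bh.
have [S [_ FQ CS]] := stopping_tree F0 FS Q.
pose H J := fine (average p1 f J) * fine (average p2 g J).
have H0 J : 0 <= H J by apply: mulr_ge0; apply: fine_ge0; exact: average_ge0.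
have TA : 0 <= tree_constant R d * A by exact: mulr_ge0 (ltW tree_constant_gt0) (ltW A0).
have c0 : 0 <= tree_constant R d * A * (16 ^+ d) ^+ 2.
  by apply: mulr_ge0; [exact: TA|apply: exprn_ge0; exact: exprn_ge0].
have GH P w' P' : P \in S -> scale P' = scale P + 4 ->
    cube_set (dilate 3 (dyadic_cube R w P)) `<=` dset w' P' ->
    G P <= tree_constant R d * A * (16 ^+ d) ^+ 2 * H (dyadic_cube R w' P').
  move=> _ P's PP'.
  have e1 := tavg_le hp1 bf bf (fun x => lexx _) P's PP'.
  have e2 := tavg_le hp2 bh bg hg P's PP'.
  have := ler_pM (tavg_ge0 w p1 f P) (tavg_ge0 w p2 h P) e1 e2.
  move=> /(ler_wpM2l TA); rewrite /G /H !mulrA => /le_trans; apply.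
  by apply: eqW; ring.
have [X [spX hX]] := sparse_of_carleson d0 H0 c0 CS GH.
exists X; split=> //; apply: le_trans (_ : (_ <= (\sum_(P <- S) side R P ^+ d * G P)%:E)%E) _.
  by rewrite lee_fin.
apply: le_trans hX _.
rewrite [(domination_constant * A / 3)](_ : _ = sparse_constant R d *
  (tree_constant R d * A * (16 ^+ d) ^+ 2)); last first.
  by rewrite /domination_constant; field.
apply: lee_wpmul2l; first by rewrite lee_fin; exact: mulr_ge0 (ltW sparse_constant_gt0) c0.
apply: le_esum => J _; rewrite -(fineK (average_fin J hp1 bf)) -(fineK (average_fin J hp2 bg)).
by rewrite -!EFinM mulrA.
Qed.

Lemma sparse_norm_le :
  (sparse_norm p1 p2 (maximal_truncation_fun K) <= (domination_constant * A)%:E)%E.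
Proof.
apply: ereal_inf_lbound; exists (domination_constant * A) => //; split.
  exact: mulr_gt0 domination_constant_gt0 A0.
move=> f1 f2; rewrite -!bcsE => b1 b2.
have DA0 : 0 <= domination_constant * A by exact: mulr_ge0 (ltW domination_constant_gt0) (ltW A0).
set z := cmodulus _.
have : 0 <= z by exact: cmodulus_ge0.
(* A vanishing pairing is dominated by the empty family; [linearize] asks for [z > 0]. *)
rewrite le_eqVlt => /predU1P[<-|z0].
  exists set0; split; last by rewrite esum_set0 mule0.
  by split=> //; exists (fun=> set0); split=> // i j [].
have [t1 [t2 [bt1 bt2 [h [bh hg zh]]]]] :=
  linearize d0 mK finK (bcs_cintegrable b1) b2 z0 (lexx _).
have [X [spX hX]] := linearized_sparse_bound b1 b2 bh hg bt1 bt2.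
exists X; split=> //.
have h3 : ((z / 3)%:E <= (cmodulus (pairing (linearized_truncation K t1 t2 f1) h))%:E)%E.
  by rewrite lee_fin.
have e3 : (0 <= (3 : R)%:E)%E by rewrite lee_fin.
have := lee_wpmul2l e3 (le_trans h3 hX); rewrite muleA -!EFinM.
have -> : 3 * (z / 3) = z by field.
by have -> : 3 * (domination_constant * A / 3) = domination_constant * A by field.
Qed.

End sparse_bound.

Theorem theorem3 (R : realType) (d : nat) (hd : (0 < d)%N) :
  exists C : R, 0 < C /\
  forall (K : int -> Rd R d -> Rd R d -> R[i]) (r p1 p2 : R),
    (forall s, cmeasurable (fun z : Rd R d * Rd R d => K s z.1 z.2)) ->
    (forall s (x y : Rd R d), K s x y != 0 ->
       euclid_norm ((x : 'rV[R]_d) - y) < 2 ^ s) ->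
    (kernel_norm K < +oo)%E ->
    1 < r ->
    (operator_norm r (maximal_truncation K) < +oo)%E ->
    1 <= p1 -> 1 <= p2 ->
    (localized_constant K p1 p2 < +oo)%E ->
    (sparse_norm p1 p2 (maximal_truncation_fun K) <=
     C%:E * (operator_norm r (maximal_truncation K)
             + localized_constant K p1 p2))%E.
Proof.
have D0 := domination_constant_gt0 R d.
exists (domination_constant R d); split=> // K r p1 p2 mK suppK finK r1 op hp1 hp2 loc.
set a := operator_norm _ _ in op *; set b := localized_constant _ _ _ in loc *.
have a0 : (0 <= a)%E.
  apply: le_trans (ereal_sup_ubound (ex_intro2 _ _ (fun=> 0) _ erefl)); first exact: Lnorm_ge0.
  split.
    by apply: bcs_in_L; [exact: ltW|exact: bcs0].
  rewrite /norm_L (_ : (fun _ => _) = cst 0%E); last by apply/funext => x; rewrite cmodulus0.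
  by rewrite Lnorm0// gt_eqF// lte_fin (lt_trans ltr01 r1).
have b0 : (0 <= b)%E by exact: nonneg_sup_ge0.
have afin : a \is a fin_num by rewrite ge0_fin_numE.
have bfin : b \is a fin_num by rewrite ge0_fin_numE.
have [a1 b1] : 0 <= fine a /\ 0 <= fine b by split; exact: fine_ge0.
(* The bound is proved for a positive [A], while both quantities may vanish; the excess [e], divided
   by the constant in advance, is removed in the limit. *)
apply/lee_addgt0Pr => e e0; have De : 0 < e / domination_constant R d by rewrite divr_gt0.
pose A := fine a + fine b + e / domination_constant R d.
have A0 : 0 < A by rewrite ltr_wpDl// addr_ge0.
have aA : (a <= A%:E)%E by rewrite -(fineK afin) lee_fin /A; lra.
have bA : (b <= A%:E)%E by rewrite -(fineK bfin) lee_fin /A; lra.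
apply: le_trans (sparse_norm_le hd mK suppK finK r1 hp1 hp2 A0 aA bA) _.
have -> : (a + b = (fine a + fine b)%:E)%E by rewrite EFinD !fineK.
rewrite -EFinM -EFinD lee_fin /A mulrDr [X in _ + X]mulrC divfK//.
by rewrite gt_eqF.
Qed.
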